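(* There is an algorithm which, for any $\lambda\in(0,1]$ (rational), any $\epsilon\in\mathbb Q_{>0}$ and any differentiable $\lambda$-quasar-convex function $f:\mathcal X\to\mathbb R$ whose gradient mapping $F:=\nabla f$ satisfies assumptions (i)–(iii) listed in the context with parameters $L,B$, runs in time $\mathrm{poly}(d,\log(B/\epsilon),\log(1/\lambda),\log L)$ and outputs a point $x\in\mathcal X$ such that $f(x)\le\min_{x'\in\mathcal X}f(x')+\epsilon$.
   Context: $\|\cdot\|$ is the Euclidean norm. $f:\mathcal X\to\mathbb R$ is differentiable (on an open superset of $\mathcal X$). For $\lambda\in(0,1]$ and a minimizer $x$ of $f$ over $\mathcal X$, $f$ is $\lambda$-quasar-convex (with respect to $x$) if $$f(x)\ge f(x')+\tfrac1\lambda\langle\nabla f(x'),x-x'\rangle\quad\text{for all }x'\in\mathcal X.$$ The minimizer $x$ is not known to the algorithm. $\mathcal X\subseteq\mathbb R^d$ is convex and compact and in isotropic position: a uniformly random $x\in\mathcal X$ has $\mathbb E[x]=0$, $\mathbb E[xx^\top]=I_d$; accordingly, $\mathcal B_1(0)\subseteq\mathcal X\subseteq\mathcal B_R(0)$ for some $R\le\mathrm{poly}(d)$, where $\mathcal B_r(0)$ is the closed Euclidean ball of radius $r$. It is accessed through a separation oracle: given $x\in\mathbb Q^d$, the oracle either asserts $x\in\mathcal X$ or returns $c\in\mathbb Q^d$ with $\|c\|_\infty=1$ and $\langle c,x'\rangle<\langle c,x\rangle$ for every $x'\in\mathcal X$. Assumptions on $F=\nabla f$: (i) for every $x\in\mathcal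 X\cap\mathbb Q^d$, $F(x)$ is rational and can be evaluated exactly in $\mathrm{poly}(d)$ time, with bit length polynomial in that of $x$; (ii) $\|F(x)-F(x')\|\le L\|x-x'\|$ for all $x,x'\in\mathcal X$, $L\in\mathbb Q_{>0}$; (iii) $\|F(x)\|\le B$ for all $x\in\mathcal X$, $B\in\mathbb Q_{>0}$. The parameters $\lambda,\epsilon,L,B$ are given to the algorithm.
   Formalization: Time bound is poly(d, log(B/ε), log(1/λ), log L) times the bit length of the rationals λ, ε, L, B, as these must be read and their length is not bounded by those logs; separation-oracle answers are assumed to have bit length polynomial in the query's. Negative logs count as 0. *)

(* Defs.v *)
From HB Require Import structures.
From mathcomp Require Import all_boot all_order all_algebra.
From mathcomp Require Import all_classical all_reals all_analysis.

Set Implicit Arguments.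
Unset Strict Implicit.
Unset Printing Implicit Defensive.

Import Order.TTheory GRing.Theory Num.Theory.
Import numFieldNormedType.Exports.

Local Open Scope classical_set_scope.
Local Open Scope ring_scope.

(* [s] is bounded by a polynomial of [r] (for r >= 0) iff it is bounded by
   [poly_bound C r] for some C; a polynomial in several nonnegative quantities
   is likewise bounded by [poly_bound C] of their sum. *)
Definition poly_bound (R : realType) (C : nat) (r : R) : R :=
  C%:R * (1 + r) ^+ C.

(* positive part of the logarithm: B / eps and L may be smaller than 1 *)
Definition logp (R : realType) (q : rat) : R := Num.max 0 (ln (ratr q)).

Section EuclideanSpace.
Variables (R : realType) (d : nat).
Implicit Types (x y : 'rV[R]_d) (X : set 'rV[R]_d) (f : 'rV[R]_d -> R).

(* The library norm `|x| on row vectors is the sup norm. *)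
Definition dot x y : R := \sum_(i < d) x 0 i * y 0 i.
Definition enorm x : R := Num.sqrt (dot x x).
Definition eball (r : R) : set 'rV[R]_d := [set x | enorm x <= r].

Definition gradient f x : 'rV[R]_d := \row_(i < d) 'D_(delta_mx 0 i) f x.

Definition differentiable_on X f :=
  exists U : set 'rV[R]_d,
    [/\ open U, X `<=` U & forall x, U x -> differentiable f x].

Definition minimizer X f x := X x /\ forall y, X y -> f x <= f y.

Definition quasar_convex X (lam : R) f :=
  exists2 x, minimizer X f x &
    forall x', X x' -> f x >= f x' + lam^-1 * dot (gradient f x') (x - x').

End EuclideanSpace.

Section LebesgueMeasure.
Variable R : realType.
Local Notation RM := (measurableTypeR R).

Definition cons_pair n (p : n.-tuple RM * RM) : n.+1.-tuple RM :=
  [tuple of p.2 :: p.1].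

(* n-dimensional Lebesgue measure *)
Fixpoint lebesgue_tuple (n : nat) : set (n.-tuple RM) -> \bar R :=
  if n is m.+1 then
    pushforward (@lebesgue_tuple m \x @lebesgue_measure R)%E (@cons_pair m)
  else \d_([tuple] : 0.-tuple RM).

Let lebesgue_tuple_measure n :
  exists mu : {measure set (n.-tuple RM) -> \bar R}, @lebesgue_tuple n = mu.
Proof.
elim: n => [|n [mu muE]]; first by exists \d_([tuple] : 0.-tuple RM).
have mc : measurable_fun setT (@cons_pair n) by exact: measurable_cons.
exists (measure_function_pushforward__canonical__measure_function_Measure
  (mu \x @lebesgue_measure R)%E mc).
by rewrite /= muE.
Qed.

Let lebesgue_tuple0 n : @lebesgue_tuple n set0 = 0%E.
Proof. by have [mu ->] := lebesgue_tuple_measure n; exact: measure0. Qed.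

Let lebesgue_tuple_ge0 n A : (0 <= @lebesgue_tuple n A)%E.
Proof. by have [mu ->] := lebesgue_tuple_measure n; exact: measure_ge0. Qed.

Let lebesgue_tuple_sigma_additive n : semi_sigma_additive (@lebesgue_tuple n).
Proof.
by have [mu ->] := lebesgue_tuple_measure n; exact: measure_semi_sigma_additive.
Qed.

HB.instance Definition _ n := isMeasure.Build _ _ _ (@lebesgue_tuple n)
  (@lebesgue_tuple0 n) (@lebesgue_tuple_ge0 n)
  (@lebesgue_tuple_sigma_additive n).

End LebesgueMeasure.

Section Isotropic.
Variables (R : realType) (d : nat) (X : set 'rV[R]_d).

Definition tuple_preimage : set (d.-tuple (measurableTypeR R)) :=
  [set t | X (\row_(i < d) tnth t i)].

(* expectation of [g x] for [x] uniformly distributed on [X] *)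
Definition uniform_mean (g : 'rV[R]_d -> R) : R :=
  (fine (lebesgue_tuple tuple_preimage))^-1 *
  (\int[@lebesgue_tuple R d]_(t in tuple_preimage)
     g (\row_(i < d) (tnth t i : R)))%R.

Definition isotropic :=
  (forall i, uniform_mean (fun x => x 0 i) = 0) /\
  (forall i j, uniform_mean (fun x => x 0 i * x 0 j) = (i == j)%:R).

End Isotropic.

(* Model of computation: programs are finite terms that transform binary-integer
   trees, with access to the two oracles.  Every elementary step is charged the
   number of bits of the data it reads, copies and writes, so the cost is
   polynomially related to the running time of an oracle Turing machine. *)
Inductive data := Int of int | Pair of data & data.

Fixpoint data_size (v : data) : nat :=
  match v with
  | Int z => (trunc_log 2 `|z|%N).+2
  | Pair v1 v2 => (data_size v1 + data_size v2).+1
  end.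

Definition data_of_fractions (s : seq (int * int)) : data :=
  foldr (fun p v => Pair (Pair (Int p.1) (Int p.2)) v) (Int 0) s.

Definition data_of_rats (s : seq rat) : data :=
  data_of_fractions [seq (numq q, denq q) | q <- s].

Definition data_of_vec d (x : 'rV[rat]_d) : data :=
  data_of_rats [seq x 0 i | i <- enum 'I_d].

(* Fractions supplied by a program need not be in lowest terms. *)
Definition represents d (v : data) (x : 'rV[rat]_d) :=
  exists s : seq (int * int),
    [/\ v = data_of_fractions s, all (fun p => 0 < p.2) s
      & [seq x 0 i | i <- enum 'I_d] = [seq p.1%:~R / p.2%:~R | p <- s]].

Inductive prog :=
  | Skip | Const of int
  | Fst | Snd | Fork of prog & prog | IsPair
  | Add | Sub | Mul | Div
  | Seq of prog & prog
  | If of prog & prog & prog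
  | While of prog & prog
  | AskSep | AskGrad.

Record oracles (d : nat) := Oracles {
  (* [None] asserts membership in the set *)
  sep : 'rV[rat]_d -> option 'rV[rat]_d;
  grad : 'rV[rat]_d -> 'rV[rat]_d;
  (* time taken by the evaluation of [grad] *)
  grad_time : 'rV[rat]_d -> nat
}.

Definition data_of_answer d (a : option 'rV[rat]_d) : data :=
  if a is Some c then Pair (Int 0) (data_of_vec c) else Pair (Int 1) (Int 0).

(* effect of the elementary instructions; [None] is a run-time error *)
Definition prim (p : prog) (v : data) : option data :=
  match p, v with
  | Skip, _ => Some v
  | Const z, _ => Some (Int z)
  | Fst, Pair v1 _ => Some v1
  | Snd, Pair _ v2 => Some v2
  | IsPair, Pair _ _ => Some (Int 1)
  | IsPair, Int _ => Some (Int 0)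
  | Add, Pair (Int a) (Int b) => Some (Int (a + b))
  | Sub, Pair (Int a) (Int b) => Some (Int (a - b))
  | Mul, Pair (Int a) (Int b) => Some (Int (a * b))
  | Div, Pair (Int a) (Int b) => Some (Int (a %/ b)%Z)
  | _, _ => None
  end.

(* [run O p v w t]: started on [v], [p] halts with result [w] after time [t];
   a test succeeds when its value is a positive integer. *)
Inductive run d (O : oracles d) : prog -> data -> data -> nat -> Prop :=
  | run_prim p v w : prim p v = Some w ->
      run O p v w (data_size v + data_size w)
  | run_fork p q v w1 w2 t1 t2 :
      run O p v w1 t1 -> run O q v w2 t2 ->
      run O (Fork p q) v (Pair w1 w2) (t1 + t2 + data_size v + data_size (Pair w1 w2))
  | run_seq p q v w u t1 t2 :
      run O p v w t1 -> run O q w u t2 -> run O (Seq p q) v u (t1 + t2)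
  | run_if c p q v z w t1 t2 :
      run O c v (Int z) t1 -> run O (if 0 < z then p else q) v w t2 ->
      run O (If c p q) v w (t1 + t2 + data_size v)
  | run_while_stop c p v z t : run O c v (Int z) t -> z <= 0 ->
      run O (While c p) v v (t + data_size v)
  | run_while_step c p v z w u t1 t2 t3 :
      run O c v (Int z) t1 -> 0 < z ->
      run O p v w t2 -> run O (While c p) w u t3 ->
      run O (While c p) v u (t1 + t2 + t3 + data_size v)
  | run_sep v x : represents v x ->
      run O AskSep v (data_of_answer (sep O x))
        (data_size v + data_size (data_of_answer (sep O x)))
  | run_grad v x : represents v x ->
      run O AskGrad v (data_of_vec (grad O x))
        (data_size v + grad_time O x + data_size (data_of_vec (grad O x))).

Lemma data_of_fractions_inj : injective data_of_fractions.
Proof. by elim=> [|[a b] s IH] [|[a' b'] s'] //= [-> -> /IH->]. Qed.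

Lemma represents_inj d v (x y : 'rV[rat]_d) :
  represents v x -> represents v y -> x = y.
Proof.
move=> [s [-> _ xs]] [s' [/data_of_fractions_inj<- _ ys]].
apply/rowP => i; have /eq_in_map : [seq x 0 i | i <- enum 'I_d] = [seq y 0 i | i <- enum 'I_d].
  by rewrite xs ys.
by apply; rewrite mem_enum.
Qed.

Lemma run_det d (O : oracles d) p v w w' t t' :
  run O p v w t -> run O p v w' t' -> w = w' /\ t = t'.
Proof.
move=> r; elim: r w' t' => {p v w t}.
all: intros; lazymatch goal with |- _ = ?a /\ _ = ?b =>
  lazymatch goal with H : run _ _ _ a b |- _ => inversion H; subst end end.
all: try by [].
all: repeat match goal with
  | IH : _, H : run _ _ _ _ _ |- _ =>
      let E := fresh in destruct (IH _ _ H) as [E ?];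
      clear H; try injection E as ?; subst
  | H : prim ?p ?v = Some _, H' : prim ?p ?v = Some _ |- _ =>
      rewrite H in H'; injection H' as ?; subst
  | H : represents ?v _, H' : represents ?v _ |- _ =>
      have ? := represents_inj H H'; clear H; subst
  end.
all: try by [].
all: by match goal with H : is_true (0 < ?z), H' : is_true (?z <= 0) |- _ =>
  rewrite leNgt H in H' end.
Qed.

Section Hypotheses.
Variables (R : realType) (d : nat).
Implicit Types (X : set 'rV[R]_d) (O : oracles d) (f : 'rV[R]_d -> R).

Definition rvec (x : 'rV[rat]_d) : 'rV[R]_d := map_mx ratr x.

Definition separation_oracle X (C : nat) O :=
  forall x,
    (data_size (data_of_answer (sep O x)))%:R
      <= poly_bound C (data_size (data_of_vec x))%:R :> R /\
    match sep O x with
    | None => X (rvec x)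
    | Some c => `|c| = 1 /\
        forall x', X x' -> dot (rvec c) x' < dot (rvec c) (rvec x)
    end.

Definition gradient_oracle X f (C : nat) O :=
  forall x, X (rvec x) ->
    [/\ rvec (grad O x) = gradient f (rvec x),
        (data_size (data_of_vec (grad O x)))%:R
          <= poly_bound C (data_size (data_of_vec x))%:R :> R
      & (grad_time O x)%:R
          <= poly_bound C (d + data_size (data_of_vec x))%:R :> R].

Definition isotropic_position X (C : nat) :=
  isotropic X /\
  exists r : R,
    [/\ r <= poly_bound C d%:R, eball 1 `<=` X & X `<=` eball r].

End Hypotheses.

Definition algorithm_input (d : nat) (lam eps L B : rat) : data :=
  Pair (Int d) (data_of_rats [:: lam; eps; L; B]).

(* Main.v *)
Require Import Defs.
From mathcomp Require Import all_boot all_order all_algebra.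
From mathcomp Require Import all_classical all_reals all_analysis.
From mathcomp Require Import zify ring lra.
Set Implicit Arguments.
Unset Strict Implicit.
Unset Printing Implicit Defensive.
Import Order.TTheory GRing.Theory Num.Theory.
Import numFieldNormedType.Exports.
Local Open Scope classical_set_scope.
Local Open Scope ring_scope.

(* The ellipsoid method. Keep an ellipsoid that contains a small ball lying inside
   the domain next to a minimizer. When its centre [a] is outside the domain, cut
   with the separating direction. When [a] is inside and the ellipsoid has width at
   most [lam * eps / 2] along [g], the gradient at [a], then quasar-convexity gives
   [lam * (f a - min f) <= <g, a - xs> <= lam * eps], so [a] can be returned.
   Otherwise [<g, z - a> <= 0] holds at the minimizer, and on the ball up to a small
   fraction of the width, so that cutting with [g] at a slightly shifted depth keeps
   the ball. Each cut divides the determinant by a factor [1 + c / d], while the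
   ball bounds it from below.

   Ellipsoids are described by their support function, [<y, z - a>^2 <= y P y^T] for
   all [y]. In this form the rounding errors of fixed-point arithmetic are absorbed
   by adding a multiple of the identity to [P], and the ball alone gives
   [r^2 |y|^2 <= y P y^T], which makes that multiple harmless for the determinant. *)

(** * Running times of programs *)

(** Two obstacles shape the proof. First, one cut has to tolerate several errors at once: a square
    root known up to a factor 2, rounding in every entry, and a ball that sits next to the minimizer
    instead of around it, which pushes a gradient cut slightly past the centre. The relative step
    [k = 1 / (16 (d + 1))] leaves room for all of them: the cut gains [1 - k / 2] in one direction,
    while the inflation is of order [k ^ 2] in each of [d] directions, hence of order [d k * k] in
    total, and [d k <= 1 / 16]. Second, the running time may depend only linearly on the bit length
    of the parameters, and this length is not controlled by the logarithms of their values: a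
    fraction close to 1 can be long. So the parameters shape the ellipsoids only through the integer
    [condition], whose length is logarithmic. Their numerators and denominators survive only in
    [tol_num] and [tol_den], which are carried along unchanged and enter nothing but the acceptance
    test. *)

Lemma data_size_ge2 v : (2 <= data_size v)%N.
Proof. by elim: v => //= v1 h1 v2 h2; lia. Qed.

Lemma data_size_int z k : (data_size (Int z) <= k.+2)%N = (`|z| < 2 ^ k.+1)%N.
Proof.
rewrite /= !ltnS; apply/idP/idP => h.
  have h2 : (2 ^ (trunc_log 2 `|z|).+1 <= 2 ^ k.+1)%N by rewrite leq_exp2l.
  exact: leq_trans (trunc_log_ltn _ _) h2.
have [->|z0] := posnP `|z|%N; first by rewrite trunc_log0.
by have := leq_ltn_trans (trunc_logP (p := 2) isT z0) h; rewrite ltn_exp2l.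
Qed.

Lemma absz_lt_data_size z : (`|z| < 2 ^ (data_size (Int z)).-1)%N.
Proof. by rewrite /= trunc_log_ltn. Qed.

Lemma leq_data_size_int a b :
  (`|a| <= `|b|)%N -> (data_size (Int a) <= data_size (Int b))%N.
Proof. by move=> h; rewrite /= !ltnS leq_trunc_log. Qed.

Lemma data_size_intD a b :
  (data_size (Int (a + b)) <= data_size (Int a) + data_size (Int b))%N.
Proof.
have ha := absz_lt_data_size a; have hb := absz_lt_data_size b.
move: ha hb (data_size_ge2 (Int a)) (data_size_ge2 (Int b)).
case: (data_size (Int a)) => [|[|p]] //; case: (data_size (Int b)) => [|[|q]] //.
rewrite /= => ha hb _ _.
have -> : (p.+2 + q.+2 = (p + q).+2.+2)%N by lia.
rewrite data_size_int.
apply: leq_ltn_trans (_ : _ <= `|a| + `|b|)%N _; first by lia.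
have h1 : (2 ^ p.+1 <= 2 ^ (p + q).+2)%N by rewrite leq_exp2l //; lia.
have h2 : (2 ^ q.+1 <= 2 ^ (p + q).+2)%N by rewrite leq_exp2l //; lia.
rewrite [(2 ^ (p + q).+3)%N]expnS; lia.
Qed.

Lemma data_size_intN a : data_size (Int (- a)) = data_size (Int a).
Proof. by rewrite /= abszN. Qed.

Lemma data_size_intM a b :
  (data_size (Int (a * b)) <= data_size (Int a) + data_size (Int b))%N.
Proof.
have ha := absz_lt_data_size a; have hb := absz_lt_data_size b.
move: ha hb (data_size_ge2 (Int a)) (data_size_ge2 (Int b)).
case: (data_size (Int a)) => [|[|p]] //; case: (data_size (Int b)) => [|[|q]] //.
rewrite /= => ha hb _ _.
have -> : (p.+2 + q.+2 = (p + q).+2.+2)%N by lia.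
rewrite data_size_int abszM.
have -> : ((p + q).+3 = (p.+1 + q.+1).+1)%N by lia.
rewrite expnS expnD mul2n -addnn; apply: ltn_addr.
by case: (`|b|%N) hb => [|m] hb; [rewrite muln0; lia|exact: ltn_mul].
Qed.

Lemma data_size_int_div a b :
  (data_size (Int (a %/ b)%Z) <= data_size (Int a))%N.
Proof. by apply: leq_data_size_int; exact: lez_div. Qed.

Definition Runs d (O : oracles d) p v w T := exists2 t, run O p v w t & (t <= T)%N.

Lemma Runs_le d (O : oracles d) p v w T T' :
  (T <= T')%N -> Runs O p v w T -> Runs O p v w T'.
Proof. by move=> h [t r ht]; exists t => //; apply: leq_trans h. Qed.

(* Every instruction is charged at least the bits that it writes, so a bound on
   the running time is also a bound on the size of the result. *)
Lemma run_size d (O : oracles d) p v w t : run O p v w t -> (data_size w <= t)%N.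
Proof.
elim=> {p v w t} //=; intros; lia.
Qed.

Lemma Runs_size d (O : oracles d) p v w T : Runs O p v w T -> (data_size w <= T)%N.
Proof. by case=> t /run_size h1 h2; apply: leq_trans h2. Qed.

Lemma Runs_seq d (O : oracles d) p q v w u T1 T2 :
  Runs O p v w T1 -> Runs O q w u T2 -> Runs O (Seq p q) v u (T1 + T2).
Proof.
move=> [t1 r1 h1] [t2 r2 h2]; exists (t1 + t2)%N; last by rewrite leq_add.
exact: run_seq r1 r2.
Qed.

Lemma Runs_fork d (O : oracles d) p q v w u T1 T2 :
  Runs O p v w T1 -> Runs O q v u T2 ->
  Runs O (Fork p q) v (Pair w u) ((T1 + T2).*2 + data_size v + 1).
Proof.
move=> [t1 r1 h1] [t2 r2 h2].
eexists; first exact: run_fork r1 r2.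
have := run_size r1; have := run_size r2 => /=; lia.
Qed.

Lemma Runs_if d (O : oracles d) c p q v z w T1 T2 :
  Runs O c v (Int z) T1 -> Runs O (if 0 < z then p else q) v w T2 ->
  Runs O (If c p q) v w (T1 + T2 + data_size v).
Proof.
move=> [t1 r1 h1] [t2 r2 h2].
eexists; first exact: run_if r1 r2.
lia.
Qed.

Lemma Runs_while_stop d (O : oracles d) c p v z T :
  Runs O c v (Int z) T -> z <= 0 -> Runs O (While c p) v v (T + data_size v).
Proof.
move=> [t1 r1 h1] z0.
eexists; first exact: run_while_stop r1 z0.
lia.
Qed.

Lemma Runs_while_step d (O : oracles d) c p v z w u T1 T2 T3 :
  Runs O c v (Int z) T1 -> 0 < z -> Runs O p v w T2 -> Runs O (While c p) w u T3 ->
  Runs O (While c p) v u (T1 + T2 + data_size v + T3).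
Proof.
move=> [t1 r1 h1] z0 [t2 r2 h2] [t3 r3 h3].
eexists; first exact: run_while_step r1 z0 r2 r3.
lia.
Qed.

(** Covers programs without loops and oracle calls; on the others [None] makes no claim. On concrete
    programs [eval] computes, so that many specifications below hold by reflexivity. *)
Fixpoint eval (p : prog) (v : data) : option data :=
  match p with
  | Fork p q =>
      if eval p v is Some a then
        if eval q v is Some b then Some (Pair a b) else None
      else None
  | Seq p q => if eval p v is Some a then eval q a else None
  | If c p q =>
      if eval c v is Some (Int z) then if 0 < z then eval p v else eval q v
      else None
  | While _ _ | AskSep | AskGrad => None
  | _ => prim p v
  end.

Lemma prim_size p :
  exists C, forall v w, prim p v = Some w -> (data_size w <= C * data_size v)%N.
Proof.
exists (if p is Const z then data_size (Int z) else 2) => v w.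
have g1 := data_size_ge2 v.
case: p v g1 => /=.
all: try by [].
all: try by move=> v g1 [<-] /=; lia.
- by move=> z v g1 [<-] /=; nia.
- by case=> //= v1 v2 _ [<-]; lia.
- by case=> //= v1 v2 _ [<-]; lia.
- by case=> [z|v1 v2] g1 [<-] /=; rewrite ?trunc_log0 ?trunc_log1; move: g1 => /=; lia.
- by case=> // -[] // a [] // b _ [<-]; have := data_size_intD a b; move=> /=; lia.
- case=> // -[] // a [] // b _ [<-]; have := data_size_intD a (- b).
  by rewrite data_size_intN /=; lia.
- by case=> // -[] // a [] // b _ [<-]; have := data_size_intM a b; move=> /=; lia.
- by case=> // -[] // a [] // b _ [<-]; have := data_size_int_div a b; move=> /=; lia.
Qed.

Lemma prim_linear p :
  exists C, forall d (O : oracles d) v w, prim p v = Some w ->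
    Runs O p v w (C * data_size v).
Proof.
have [C hC] := prim_size p; exists C.+1 => d O v w e.
eexists; first exact: run_prim e.
by have := hC _ _ e; lia.
Qed.

(** Multiplication adds bit lengths, so each instruction enlarges the data at most by a constant
    factor. The program is fixed and has no loops, hence these factors multiply to a constant. *)
Lemma eval_linear p :
  exists C, forall d (O : oracles d) v w, eval p v = Some w ->
    Runs O p v w (C * data_size v).
Proof.
elim: p => [|z|||p [C IHp] q [C' IHq]|||||
  |p [C IHp] q [C' IHq]|c [C0 IHc] p [C IHp] q [C' IHq]|p _ q _||].
all: try by apply: prim_linear.
all: try by exists 0%N.
- exists (2 * (C + C') + 2)%N => d O v w /=.
  case e1: (eval p v) => [a|] //; case e2: (eval q v) => [b|] // [<-].
  apply: Runs_le (Runs_fork (IHp _ _ _ _ e1) (IHq _ _ _ _ e2)).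
  have := data_size_ge2 v; rewrite -!muln2 -!mulnDl => h.
  rewrite !mulnDl -mulnA [(2 * _)%N]mulnC -mulnDl; lia.
- exists (C + C' * C)%N => d O v w /=.
  case e1: (eval p v) => [a|] // e2.
  apply: Runs_le (Runs_seq (IHp _ _ _ _ e1) (IHq _ O _ _ e2)).
  by have := Runs_size (IHp _ O _ _ e1); nia.
- exists (C0 + C + C' + 1)%N => d O v w /=.
  case e0: (eval c v) => [[z|//]|] // e1.
  apply: (Runs_le _ (Runs_if (T2 := ((C + C') * data_size v)%N) (IHc _ O _ _ e0) _)).
    by nia.
  case: (0 < z) e1 => e1.
    by apply: Runs_le (IHp _ _ _ _ e1); nia.
  by apply: Runs_le (IHq _ _ _ _ e1); nia.
Qed.

Definition dlist (s : seq data) : data := foldr Pair (Int 0) s.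

Definition dfun d (F : 'I_d -> data) : data := dlist [seq F i | i <- enum 'I_d].

Lemma data_size_dlist s : data_size (dlist s) = (sumn [seq (data_size x).+1 | x <- s] + 2)%N.
Proof. by elim: s => //= x s ->; lia. Qed.

(** The loop state consists of the rest of the list, the accumulator and an environment; [body]
    receives the head in place of the rest and returns the new accumulator. *)
Definition FoldP body :=
  Seq (While (Seq Fst IsPair)
    (Fork (Seq Fst Snd) (Fork (Seq (Fork (Seq Fst Fst) Snd) body) (Seq Snd Snd))))
    (Seq Snd Fst).

Lemma eval_linear_prop p : exists C, forall d (O : oracles d) v w m, eval p v = Some w ->
    (data_size v <= m)%N -> Runs O p v w (C * m).
Proof.
have [C h] := eval_linear p; exists C => d O v w m e hm.
by apply: Runs_le (h _ _ _ _ e); rewrite leq_mul2l hm orbT.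
Qed.

(** The accumulators are prescribed as a sequence [a], so that clients argue about single turns of
    [body] and never about the loop. *)
Lemma FoldP_runs body : exists C, forall d (O : oracles d) env tau m
  (s : seq data) (a : nat -> data),
  (forall i, (i < size s)%N ->
     Runs O body (Pair (nth (Int 0) s i) (Pair (a i) env)) (a i.+1) tau) ->
  (forall i, (i <= size s)%N -> (data_size (a i) <= m)%N) ->
  Runs O (FoldP body) (Pair (dlist s) (Pair (a 0%N) env)) (a (size s))
    (C * ((size s).+1 * (tau + m + data_size (dlist s) + data_size env))).
Proof.
have [C0 h0] := eval_linear_prop (Seq Fst IsPair).
have [C1 h1] := eval_linear_prop (Seq Fst Snd).
have [C2 h2] := eval_linear_prop (Fork (Seq Fst Fst) Snd).
have [C3 h3] := eval_linear_prop (Seq Snd Snd).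
have [C4 h4] := eval_linear_prop (Seq Snd Fst).
exists ((C0 + C1 * 2 + C2 * 4 + C3 * 4 + 10) * 2 + (C4 * 2))%N => d O env tau m s a hb hm.
(* [W] is fixed before the induction, so that every turn costs the same although the list gets
   shorter. *)
have key W : forall s (a : nat -> data),
    (forall i, (i < size s)%N ->
      Runs O body (Pair (nth (Int 0) s i) (Pair (a i) env)) (a i.+1) tau) ->
    (forall i, (i <= size s)%N -> (data_size (a i) <= m)%N) ->
    (data_size (dlist s) + m + tau + data_size env <= W)%N ->
    exists2 T, Runs O (While (Seq Fst IsPair)
      (Fork (Seq Fst Snd) (Fork (Seq (Fork (Seq Fst Fst) Snd) body) (Seq Snd Snd))))
      (Pair (dlist s) (Pair (a 0%N) env)) (Pair (Int 0) (Pair (a (size s)) env)) T &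
      (T <= (size s).+1 * ((C0 + C1 * 2 + C2 * 4 + C3 * 4 + 10) * (W + 2)))%N.
  elim=> [|x s' IH] a' hb' hm' hW.
    have am := hm' 0%N isT.
    have e0 : Runs O (Seq Fst IsPair) (Pair (dlist [::]) (Pair (a' 0%N) env)) (Int 0) (C0 * (W + 2)).
      by apply: h0 => //=; move: hW => /=; rewrite ?trunc_log0; lia.
    exists (C0 * (W + 2) + data_size (Pair (dlist [::]) (Pair (a' 0%N) env)))%N.
      exact: Runs_while_stop e0 _.
    by move: hW => /=; nia.
  have hr := hb' 0%N isT.
  have am := hm' 0%N isT; have am' := hm' 1%N isT.
  have /= hW' := hW.
  have [|||T hT hT'] := IH (fun i => a' i.+1).
  - by move=> i hi; exact: (hb' i.+1).
  - by move=> i hi; exact: (hm' i.+1).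
  - by lia.
  set v := Pair (dlist (x :: s')) (Pair (a' 0%N) env).
  have e0 : Runs O (Seq Fst IsPair) v (Int 1) (C0 * (W + 2)) by apply: h0 => //=; lia.
  have e1 : Runs O (Seq Fst Snd) v (dlist s') (C1 * (W + 2)) by apply: h1 => //=; lia.
  have e2 : Runs O (Fork (Seq Fst Fst) Snd) v (Pair x (Pair (a' 0%N) env)) (C2 * (W + 2)).
    by apply: h2 => //=; lia.
  have e3 : Runs O (Seq Snd Snd) v env (C3 * (W + 2)) by apply: h3 => //=; lia.
  eexists; first exact: (Runs_while_step e0 _ (Runs_fork e1 (Runs_fork (Runs_seq e2 hr) e3)) hT).
  have hv : (data_size v <= W + 2)%N by rewrite /v /=; lia.
  rewrite /= mulSn -!muln2 addnC [X in (_ <= X)%N]addnC; apply: leq_add hT' _.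
  have htau : (tau <= W + 2)%N by lia.
  move: hv htau; rewrite -/v /=; move: (W + 2)%N => B hv htau.
  have -> : ((C0 + C1 * 2 + C2 * 4 + C3 * 4 + 10) * B =
    C0 * B + C1 * B * 2 + C2 * B * 4 + C3 * B * 4 + 10 * B)%N by ring.
  lia.
set W := (tau + m + data_size (dlist s) + data_size env)%N.
have W2 : (4 <= W)%N by have := data_size_ge2 (dlist s); have := data_size_ge2 env; lia.
have [|T hT hT'] := key W s a hb hm; first by rewrite /W; lia.
apply: (Runs_le _ (Runs_seq hT (h4 _ _ _ _ (W + 3)%N _ _))) => //=.
  rewrite -/W.
  rewrite mulnDl; apply: leq_add; first apply: leq_trans hT' _.
    rewrite [X in (_ <= X)%N]mulnCA leq_mul2l /= -mulnA leq_mul2l; lia.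
  apply: leq_trans (_ : _ <= C4 * 2 * W)%N _; last by rewrite leq_mul2l leq_pmull // orbT.
  by rewrite -mulnA leq_mul2l; lia.
by have := hm _ (leqnn (size s)); have := data_size_ge2 (dlist s); rewrite trunc_log0 /W; lia.
Qed.

Definition RevP := Seq (Fork Skip (Fork (Const 0) (Const 0))) (FoldP (Fork Fst (Seq Snd Fst))).

Lemma data_size_dlist_rev s : data_size (dlist (rev s)) = data_size (dlist s).
Proof.
by rewrite !data_size_dlist map_rev !sumnE (perm_big _ (permEl (perm_rev _))).
Qed.

Lemma data_size_dlist_take k s : (data_size (dlist (take k s)) <= data_size (dlist s))%N.
Proof.
rewrite !data_size_dlist leq_add2r -{2}(cat_take_drop k s) map_cat sumn_cat; lia.
Qed.

Lemma dlist_rev_take s k : (k < size s)%N ->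
  dlist (rev (take k.+1 s)) = Pair (nth (Int 0) s k) (dlist (rev (take k s))).
Proof. by move=> hk; rewrite (take_nth (Int 0)) // rev_rcons. Qed.

Lemma RevP_runs : exists C, forall d (O : oracles d) s,
  Runs O RevP (dlist s) (dlist (rev s)) (C * ((size s).+1 * data_size (dlist s))).
Proof.
have [C0 h0] := eval_linear_prop (Fork Skip (Fork (Const 0) (Const 0))).
have [C1 h1] := eval_linear_prop (Fork Fst (Seq Snd Fst)).
have [C2 h2] := FoldP_runs (Fork Fst (Seq Snd Fst)).
exists (C0 + C2 * (C1 * 3 + 3))%N => d O s.
have hs := data_size_ge2 (dlist s).
have e0 : Runs O (Fork Skip (Fork (Const 0) (Const 0))) (dlist s)
    (Pair (dlist s) (Pair (dlist (rev (take 0 s))) (Int 0))) (C0 * data_size (dlist s)).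
  by apply: h0; rewrite ?take0.
have e1 : Runs O (FoldP (Fork Fst (Seq Snd Fst)))
    (Pair (dlist s) (Pair (dlist (rev (take 0 s))) (Int 0))) (dlist (rev (take (size s) s)))
    (C2 * ((size s).+1 * (C1 * (data_size (dlist s) * 3) + data_size (dlist s) + data_size (dlist s)
           + data_size (Int 0)))).
  apply: (h2 _ _ _ _ _ _ (fun k => dlist (rev (take k s)))) => i hi.
    rewrite dlist_rev_take //; apply: h1 => //.
    have := data_size_dlist_take i.+1 s; rewrite -data_size_dlist_rev dlist_rev_take //=.
    by rewrite trunc_log0; lia.
  by rewrite data_size_dlist_rev data_size_dlist_take.
rewrite take_size in e1.
apply: Runs_le (Runs_seq e0 e1).
rewrite mulnDl; apply: leq_add; first by rewrite leq_mul2l leq_pmull ?orbT.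
rewrite -mulnA leq_mul2l; apply/orP; right.
rewrite [X in (_ <= X)%N]mulnCA leq_mul2l /= mulnDl trunc_log0; lia.
Qed.

Section Computes.
Variables (T : nat -> Type) (ok : forall d, oracles d -> T d -> nat -> Prop).

(* [n] bounds the quantities in which the running time may be polynomial, while
   the dependence on the size of the input is linear. *)
Definition computes (p : prog) (inp out : forall d, T d -> data) :=
  exists C, forall d (O : oracles d) (x : T d) n, (d.+2 <= n)%N -> ok O x n ->
    Runs O p (inp d x) (out d x) (n ^ C * data_size (inp d x)).

Implicit Types inp mid out : forall d, T d -> data.

(** As [n >= 2], a constant [C] is at most [n ^ C]; all constants are absorbed into exponents in
    this way. *)
Lemma computes_eval p inp out :
  (forall d (x : T d), eval p (inp d x) = Some (out d x)) -> computes p inp out.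
Proof.
have [C hC] := eval_linear p; move=> h; exists C => d O x n hn _.
apply: Runs_le (hC _ O _ _ (h d x)).
by rewrite leq_mul2r ltnW ?orbT // ltn_expl; lia.
Qed.

Lemma computes_eq p inp inp' out out' :
  (forall d (O : oracles d) (x : T d) n, ok O x n -> inp d x = inp' d x) ->
  (forall d (O : oracles d) (x : T d) n, ok O x n -> out d x = out' d x) ->
  computes p inp out -> computes p inp' out'.
Proof.
move=> h h' [C hC]; exists C => d O x n hn hx.
by rewrite -(h d O x n hx) -(h' d O x n hx); exact: hC.
Qed.

Lemma leq_pow_pow n a b : (1 < n)%N -> (a <= b)%N -> (n ^ a <= n ^ b)%N.
Proof. by move=> n1 ab; rewrite leq_exp2l. Qed.

Lemma leq_two_pow_mul n a k : (1 < n)%N -> (2 ^ k * n ^ a <= n ^ (a + k))%N.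
Proof.
move=> n1; rewrite (expnD n a k) mulnC leq_mul2l; apply/orP; right.
by case: k => // k; rewrite leq_exp2r.
Qed.

Lemma computes_seq p q inp mid out :
  computes p inp mid -> computes q mid out -> computes (Seq p q) inp out.
Proof.
move=> [C hp] [C' hq]; exists (C + C').+1 => d O x n hn hx.
have hp' := hp _ O _ _ hn hx.
apply: Runs_le (Runs_seq hp' (hq _ _ _ _ hn hx)).
have := Runs_size hp'; set s := data_size (inp d x); set s' := data_size _ => h.
apply: leq_trans (_ : _ <= n ^ C * s + n ^ C' * (n ^ C * s))%N _.
  by rewrite leq_add2l leq_mul2l h orbT.
rewrite mulnA -expnD -mulnDl leq_mul2r; apply/orP; right.
have h1 : (n ^ C <= n ^ (C + C'))%N by apply: leq_pow_pow; lia.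
rewrite [(C' + C)%N]addnC expnS; nia.
Qed.

Lemma computes_fork p q inp out1 out2 :
  computes p inp out1 -> computes q inp out2 ->
  computes (Fork p q) inp (fun d x => Pair (out1 d x) (out2 d x)).
Proof.
move=> [C hp] [C' hq]; exists (C + C').+3 => d O x n hn hx.
apply: Runs_le (Runs_fork (hp _ O _ _ hn hx) (hq _ O _ _ hn hx)).
have := data_size_ge2 (inp d x); set s := data_size (inp d x) => hs.
have n1 : (1 < n)%N by lia.
have h1 : (n ^ C <= n ^ (C + C'))%N by apply: leq_pow_pow; lia.
have h2 : (n ^ C' <= n ^ (C + C'))%N by apply: leq_pow_pow; lia.
have h3 : (0 < n ^ C')%N by rewrite expn_gt0; lia.
have h4 : (8 * n ^ (C + C') <= n ^ (C + C').+3)%N.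
  by rewrite -[(C + C').+3]addn3; exact: (@leq_two_pow_mul n (C + C') 3).
apply: leq_trans (_ : _ <= 8 * n ^ (C + C') * s)%N _; last by rewrite leq_mul2r h4 orbT.
nia.
Qed.

End Computes.

Lemma computes_comp (T1 T2 : nat -> Type) (ok1 : forall d, oracles d -> T1 d -> nat -> Prop)
  (ok2 : forall d, oracles d -> T2 d -> nat -> Prop) (h : forall d, T1 d -> T2 d) p inp out :
  (forall d (O : oracles d) x n, ok1 d O x n -> ok2 d O (h d x) n) ->
  computes ok2 p inp out ->
  computes ok1 p (fun d x => inp d (h d x)) (fun d x => out d (h d x)).
Proof. by move=> hok [C hC]; exists C => d O x n hn hx; apply: hC => //; exact: hok. Qed.

(** Each branch gets the outcome of the test as a precondition, which allows both branches to share
    the description [out] of the result. *)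
Lemma computes_if (T : nat -> Type) (ok : forall d, oracles d -> T d -> nat -> Prop) c p q
  inp (z : forall d, T d -> int) out :
  computes ok c inp (fun d x => Int (z d x)) ->
  computes (fun d O x n => ok d O x n /\ 0 < z d x) p inp out ->
  computes (fun d O x n => ok d O x n /\ z d x <= 0) q inp out ->
  computes ok (If c p q) inp out.
Proof.
move=> [C0 hc] [C hp] [C' hq]; exists (C0 + C + C').+2 => d O x n hn hx.
have n1 : (1 < n)%N by lia.
have h1 : (n ^ C <= n ^ (C0 + C + C'))%N by apply: leq_pow_pow; lia.
have h2 : (n ^ C' <= n ^ (C0 + C + C'))%N by apply: leq_pow_pow; lia.
have h0 : (n ^ C0 <= n ^ (C0 + C + C'))%N by apply: leq_pow_pow; lia.
have h3 : (0 < n ^ C0)%N by rewrite expn_gt0; lia.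
have h4 : (4 * n ^ (C0 + C + C') <= n ^ (C0 + C + C').+2)%N.
  by rewrite -[(C0 + C + C').+2]addn2; exact: (@leq_two_pow_mul n (C0 + C + C') 2).
apply: (Runs_le _ (Runs_if (T2 := (n ^ (C0 + C + C') * data_size (inp d x))%N) (hc _ O _ _ hn hx) _)).
  have := data_size_ge2 (inp d x); set s := data_size (inp d x) => hs.
  apply: leq_trans (_ : _ <= 4 * n ^ (C0 + C + C') * s)%N _; last by rewrite leq_mul2r h4 orbT.
  nia.
case: ltP => hz.
  by apply: Runs_le (hp _ O _ _ hn (conj hx hz)); rewrite leq_mul2r h1 orbT.
by apply: Runs_le (hq _ O _ _ hn (conj hx hz)); rewrite leq_mul2r h2 orbT.
Qed.

(** * Programs on lists *)

Lemma nth_dfun d (F : 'I_d -> data) (i : 'I_d) :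
  nth (Int 0) [seq F j | j <- enum 'I_d] i = F i.
Proof. by rewrite (nth_map i) ?size_enum_ord // nth_ord_enum. Qed.

Lemma size_dfun d (F : 'I_d -> data) : size [seq F j | j <- enum 'I_d] = d.
Proof. by rewrite size_map size_enum_ord. Qed.

Lemma data_size_dfun d (F : 'I_d -> data) :
  data_size (dfun F) = (\sum_i (data_size (F i)).+1 + 2)%N.
Proof. by rewrite data_size_dlist -map_comp sumnE big_map big_enum. Qed.

Lemma data_size_dfun_nth d (F : 'I_d -> data) i : (data_size (F i) < data_size (dfun F))%N.
Proof. by rewrite data_size_dfun (bigD1 i) //=; lia. Qed.

Lemma data_size_dfun_le d (F : 'I_d -> data) m : (forall i, (data_size (F i) <= m)%N) ->
  (data_size (dfun F) <= d * m.+1 + 2)%N.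
Proof.
move=> h; rewrite data_size_dfun leq_add2r.
apply: leq_trans (_ : _ <= \sum_(i < d) m.+1)%N _; first by apply: leq_sum => i _; rewrite ltnS.
by rewrite sum_nat_const card_ord.
Qed.

Section Lists.
Variables (T : nat -> Type) (ok : forall d, oracles d -> T d -> nat -> Prop).

Definition ok_ord d (O : oracles d) (x : T d * 'I_d) n := ok O x.1 n.

(** Chaining the cost of [body] would multiply the size by a power of [n] at every turn and end with
    [n ^ (C * d)]. The sizes of all accumulators are therefore bounded by a separate hypothesis. *)
Lemma computes_fold body (F : forall d, T d -> 'I_d -> data)
  (a : forall d, T d -> nat -> data) (env : forall d, T d -> data) :
  computes ok_ord body
    (fun d x => Pair (F d x.1 x.2) (Pair (a d x.1 x.2) (env d x.1)))
    (fun d x => a d x.1 (val x.2).+1) ->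
  (exists C, forall d (O : oracles d) (x : T d) n k, (d.+2 <= n)%N -> ok O x n -> (k <= d)%N ->
     (data_size (a d x k) <=
        n ^ C * data_size (Pair (dfun (F d x)) (Pair (a d x 0%N) (env d x))))%N) ->
  computes ok (FoldP body)
    (fun d x => Pair (dfun (F d x)) (Pair (a d x 0%N) (env d x))) (fun d x => a d x d).
Proof.
have [C0 h0] := FoldP_runs body.
move=> [C1 h1] [C2 h2]; exists (C0 + 1 + (C1 + C2 + 3))%N => d O x n hn hx.
set S := data_size _.
have := @h0 d O (env d x) (n ^ C1 * (2 * n ^ C2 * S))%N (n ^ C2 * S)%N
  [seq F d x j | j <- enum 'I_d] (a d x).
rewrite size_dfun => h.
have n1 : (1 < n)%N by lia.
have n2 : (0 < n ^ C2)%N by rewrite expn_gt0; lia.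
have n3 : (0 < n ^ C1)%N by rewrite expn_gt0; lia.
have hS : (data_size (dfun (F d x)) + data_size (env d x) + data_size (a d x 0%N) < S)%N by rewrite /S /=; lia.
apply: Runs_le (h _ _) => {h}.
- apply: leq_trans (_ : _ <= n ^ C0 * (n * (2 ^ 3 * n ^ (C1 + C2)) * S))%N _; last first.
    rewrite mulnA leq_mul2r; apply/orP; right.
    by rewrite !expnD expn1 -mulnA leq_mul2l (leq_mul (leqnn n)) ?orbT // -!expnD leq_two_pow_mul.
  apply: leq_mul; first by rewrite ltnW // ltn_expl.
  rewrite -(mulnA n); apply: leq_mul; first lia.
  have n4 : (n ^ C1 * n ^ C2 = n ^ (C1 + C2))%N by rewrite expnD.
  have n5 : (n ^ C2 <= n ^ (C1 + C2))%N by apply: leq_pow_pow; lia.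
  have -> : (n ^ C1 * (2 * n ^ C2 * S) = 2 * n ^ (C1 + C2) * S)%N by rewrite -n4; ring.
  rewrite -/(dfun _).
  have -> : (2 ^ 3 = 8)%N by [].
  nia.
- move=> i hi; have := h1 d O (x, Ordinal hi) n hn hx => /=.
  rewrite -[nth _ _ _]/(nth (Int 0) [seq F d x j | j <- enum 'I_d] (Ordinal hi)) nth_dfun.
  apply: Runs_le; rewrite leq_mul2l; apply/orP; right.
  have := data_size_dfun_nth (F d x) (Ordinal hi).
  have := h2 d O x n i hn hx (ltnW hi); rewrite -/S; nia.
- by move=> i hi; exact: (h2 d O).
Qed.

Lemma computes_rev (o : forall d, T d -> 'I_d -> data) :
  computes ok RevP (fun d x => dlist (rev [seq o d x j | j <- enum 'I_d])) (fun d x => dfun (o d x)).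
Proof.
have [C h] := RevP_runs; exists C.+1 => d O x n hn _.
rewrite /dfun -{2}[map _ _]revK; apply: Runs_le (h _ O _).
rewrite size_rev size_dfun mulnA leq_mul2r; apply/orP; right.
rewrite expnSr; apply: leq_mul; last lia.
by rewrite ltnW // ltn_expl; lia.
Qed.

(** The fold conses its results and so produces the list backwards. *)
Definition MapP body :=
  Seq (Fork Fst (Fork (Const 0) Snd))
    (Seq (FoldP (Fork (Seq (Fork Fst (Seq Snd Snd)) body) (Seq Snd Fst))) RevP).

Lemma computes_map body (F : forall d, T d -> 'I_d -> data) (env : forall d, T d -> data)
  (r : forall d, T d -> 'I_d -> data) :
  computes ok_ord body (fun d x => Pair (F d x.1 x.2) (env d x.1)) (fun d x => r d x.1 x.2) ->
  computes ok (MapP body) (fun d x => Pair (dfun (F d x)) (env d x)) (fun d x => dfun (r d x)).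
Proof.
move=> hb.
pose a d (x : T d) k := dlist (rev (take k [seq r d x j | j <- enum 'I_d])).
have aS d (x : T d) (i : 'I_d) : a d x i.+1 = Pair (r d x i) (a d x i).
  by rewrite /a dlist_rev_take ?size_dfun // nth_dfun.
apply: (@computes_seq _ _ _ _ _ (fun d x => Pair (dfun (F d x)) (Pair (a d x 0%N) (env d x)))).
  by apply: computes_eval => d x; rewrite /a take0.
apply: (@computes_seq _ _ _ _ _ (fun d x => a d x d)); last first.
  apply: computes_eq (computes_rev r) => d O x n _ //.
  by rewrite /a take_oversize // size_dfun.
apply: (computes_fold (a := a)).
  apply: (computes_eq (inp := fun d x => Pair (F d x.1 x.2) (Pair (a d x.1 x.2) (env d x.1)))
    (out := fun d x => Pair (r d x.1 x.2) (a d x.1 x.2))) => // [d O x n _|]; first by rewrite aS.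
  apply: computes_fork; last exact: computes_eval.
  by apply: (computes_seq _ hb); apply: computes_eval.
(* The results do not feed into each other: each is bounded by the cost of a single run, and the
   accumulator by [d] such bounds. *)
case: hb => C hC; exists (C + 2)%N => d O x n k hn hx hk.
set S := data_size (Pair _ _).
rewrite /a data_size_dlist_rev; apply: leq_trans (data_size_dlist_take _ _) _.
rewrite -/(dfun _).
apply: leq_trans (data_size_dfun_le (m := (n ^ C * S)%N) _) _ => [i|].
  apply: leq_trans (Runs_size (hC d O (x, i) n hn hx)) _.
  rewrite leq_mul2l; apply/orP; right; rewrite /S /=.
  by have := data_size_dfun_nth (F d x) i; lia.
have n1 : (0 < n ^ C)%N by rewrite expn_gt0; lia.
have S2 : (2 <= S)%N by exact: data_size_ge2.
have -> : (n ^ (C + 2) * S = n * (n * (n ^ C * S)))%N by rewrite expnD; ring.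
have : (2 <= n ^ C * S)%N by nia.
move: (n ^ C * S)%N => Y hY; have : (2 * Y <= n * Y)%N by rewrite leq_mul2r; lia.
nia.
Qed.

(** The fold runs over the first list and keeps the rest of the second one in the accumulator, next
    to the reversed result. *)
Definition ZipP :=
  Seq (Fork Fst (Fork (Fork Snd (Const 0)) (Const 0)))
    (Seq (FoldP (Fork (Seq Snd (Seq Fst (Seq Fst Snd)))
       (Fork (Fork Fst (Seq Snd (Seq Fst (Seq Fst Fst)))) (Seq Snd (Seq Fst Snd)))))
    (Seq Snd RevP)).

Lemma computes_zip (F G : forall d, T d -> 'I_d -> data) :
  computes ok ZipP (fun d x => Pair (dfun (F d x)) (dfun (G d x)))
    (fun d x => dfun (fun i => Pair (F d x i) (G d x i))).
Proof.
pose r d (x : T d) i := Pair (F d x i) (G d x i).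
pose a d (x : T d) k := Pair (dlist (drop k [seq G d x j | j <- enum 'I_d]))
  (dlist (rev (take k [seq r d x j | j <- enum 'I_d]))).
apply: (@computes_seq _ _ _ _ _ (fun d x => Pair (dfun (F d x)) (Pair (a d x 0%N) (Int 0)))).
  by apply: computes_eval => d x; rewrite /a take0 drop0.
apply: (@computes_seq _ _ _ _ _ (fun d x => a d x d)); last first.
  apply: (@computes_seq _ _ _ _ _ (fun d x => dlist (rev [seq r d x j | j <- enum 'I_d]))).
    by apply: computes_eval => d x; rewrite /a take_oversize ?size_dfun.
  exact: computes_rev.
apply: (computes_fold (a := a) (env := fun _ _ => Int 0)).
  apply: computes_eval => d [x i].
  have hi : (i < size [seq G d x j | j <- enum 'I_d])%N by rewrite size_dfun.
  rewrite /a (drop_nth (Int 0) hi) nth_dfun /=.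
  by rewrite dlist_rev_take ?size_dfun // nth_dfun.
exists 1%N => d O x n k hn hx hk; rewrite expn1.
rewrite /= data_size_dlist_rev drop0.
have h1 : (data_size (dlist (drop k [seq G d x j | j <- enum 'I_d])) <= data_size (dfun (G d x)))%N.
  rewrite /dfun !data_size_dlist leq_add2r -{2}(cat_take_drop k [seq G d x j | j <- enum 'I_d]) map_cat sumn_cat; lia.
have h2 := data_size_dlist_take k [seq r d x j | j <- enum 'I_d].
have h3 : (data_size (dfun (r d x)) <= data_size (dfun (F d x)) + data_size (dfun (G d x)))%N.
  rewrite !data_size_dfun /= addnACA -big_split /=; apply: leq_add => //.
  by apply: leq_sum => i _; lia.
rewrite -/(dfun (G d x)) -/(dfun (r d x)) in h1 h2 h3 *.
have n2 : (2 <= n)%N by lia.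
apply: leq_trans (leq_mul n2 (leqnn _)); lia.
Qed.

Definition BigP idx P := Seq (Fork Skip (Fork (Const idx) (Const 0)))
  (FoldP (Seq (Fork Fst (Seq Snd Fst)) P)).

(** Since the size is subadditive under [op], partial sums and products are no longer than the whole
    list, up to the neutral element, and the accumulator stays linear in the input. *)
Lemma computes_big (idx : int) (op : Monoid.com_law idx) P (f : forall d, T d -> 'I_d -> int) :
  (forall a b, eval P (Pair (Int a) (Int b)) = Some (Int (op a b))) ->
  (forall a b, (data_size (Int (op a b)) <= data_size (Int a) + data_size (Int b))%N) ->
  computes ok (BigP idx P) (fun d x => dfun (fun i => Int (f d x i)))
    (fun d x => Int (\big[op/idx]_i f d x i)).
Proof.
move=> hP hs.
pose a d (x : T d) k := Int (\big[op/idx]_(j <- take k (enum 'I_d)) f d x j).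
apply: (@computes_seq _ _ _ _ _
  (fun d x => Pair (dfun (fun i => Int (f d x i))) (Pair (a d x 0%N) (Int 0)))).
  by apply: computes_eval => d x; rewrite /a take0 big_nil.
apply: (@computes_eq _ _ _ (fun d x => Pair (dfun (fun i => Int (f d x i))) (Pair (a d x 0%N) (Int 0)))
  _ (fun d x => a d x d)) => // [d O x n _|].
  by rewrite /a take_oversize ?size_enum_ord // big_enum.
apply: (computes_fold (a := a) (env := fun _ _ => Int 0)).
  apply: computes_eval => d [x i] /=.
  rewrite hP /a (take_nth i) ?size_enum_ord // nth_ord_enum big_rcons /=.
  by rewrite Monoid.mulmC.
exists (data_size (Int idx)).+1 => d O x n k hn hx hk.
have hb : forall s : seq 'I_d, (data_size (Int (\big[op/idx]_(j <- s) f d x j)) <=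
    data_size (Int idx) + \sum_(j <- s) (data_size (Int (f d x j))).+1)%N.
  elim=> [|i s IH]; first by rewrite !big_nil addn0.
  by rewrite !big_cons; apply: leq_trans (hs _ _) _; move: IH => /=; lia.
apply: leq_trans (hb _) _.
have := data_size_dfun (fun i => Int (f d x i)).
have -> : (\sum_i (data_size (Int (f d x i))).+1 =
   \sum_(j <- take k (enum 'I_d)) (data_size (Int (f d x j))).+1 +
   \sum_(j <- drop k (enum 'I_d)) (data_size (Int (f d x j))).+1)%N.
  by rewrite -big_cat cat_take_drop big_enum.
set S := data_size (Pair _ _) => hS.
have hS' : (data_size (dfun (fun i => Int (f d x i))) < S)%N by rewrite /S /=; lia.
have hn2 : (data_size (Int idx) < n ^ (data_size (Int idx)))%N by rewrite ltn_expl; lia.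
have := data_size_ge2 (Int idx).
rewrite expnS; move: (data_size (Int idx)) hn2 hS => c hn2 hS c2.
have : (2 * c.+1 <= n * n ^ c)%N by apply: leq_mul; lia.
move=> hc; apply: leq_trans (_ : _ <= 2 * c.+1 * S)%N _; last by rewrite leq_mul2r hc orbT.
move: hS; set A := (\sum_(j <- take k _) _)%N; set B := (\sum_(j <- drop k _) _)%N => hS.
have hA : (A <= S)%N by lia.
rewrite -mulnA mulSn; nia.
Qed.
Lemma computes_prod (f : forall d, T d -> 'I_d -> int) :
  computes ok (BigP 1 Mul) (fun d x => dfun (fun i => Int (f d x i)))
    (fun d x => Int (\prod_i f d x i)).
Proof. by apply: computes_big => // a b; exact: data_size_intM. Qed.

Lemma computes_sum (f : forall d, T d -> 'I_d -> int) :
  computes ok (BigP 0 Add) (fun d x => dfun (fun i => Int (f d x i)))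
    (fun d x => Int (\sum_i f d x i)).
Proof. by apply: computes_big => // a b; exact: data_size_intD. Qed.
End Lists.

Lemma Runs_while d (O : oracles d) c p k : forall (a : nat -> data) (z : nat -> int) tau,
  (forall i, (i <= k)%N -> Runs O c (a i) (Int (z i)) tau) ->
  (forall i, (i < k)%N -> 0 < z i) -> z k <= 0 ->
  (forall i, (i < k)%N -> Runs O p (a i) (a i.+1) tau) ->
  (forall i, (i <= k)%N -> (data_size (a i) <= tau)%N) ->
  Runs O (While c p) (a 0%N) (a k) (k.+1 * (3 * tau)).
Proof.
elim: k => [|k IH] a z tau hc hz hzk hp hs.
  apply: Runs_le (Runs_while_stop p (hc 0%N isT) hzk).
  by have := hs 0%N isT; lia.
have := IH (fun i => a i.+1) (fun i => z i.+1) tau (fun i => hc i.+1) (fun i => hz i.+1) hzk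
  (fun i => hp i.+1) (fun i => hs i.+1) => h.
apply: Runs_le (Runs_while_step (hc 0%N isT) (hz 0%N isT) (hp 0%N isT) h).
by have := hs 0%N isT; lia.
Qed.

(** * Loops with a counter: the list of indices and the approximate square root *)

Section Counters.
Variables (T : nat -> Type) (ok : forall d, oracles d -> T d -> nat -> Prop).

(** Counting down from [d] while consing yields the indices in increasing order. *)
Definition IotaP := Seq (Fork Skip (Const 0))
  (Seq (While Fst (Fork (Seq (Fork Fst (Const 1)) Defs.Sub)
     (Fork (Seq (Fork Fst (Const 1)) Defs.Sub) Snd))) Snd).

Lemma computes_iota :
  computes ok IotaP (fun d x => Int d) (fun d x => dfun (fun i : 'I_d => Int i)).
Proof.
pose l d := [seq Int (nat_of_ord j) | j <- enum 'I_d].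
pose a d i := Pair (Int (d - i)%N) (dlist (drop (d - i) (l d))).
apply: (@computes_seq _ _ _ _ _ (fun d x => a d 0%N)).
  by apply: computes_eval => d x; rewrite /a subn0 drop_oversize // size_dfun.
apply: (@computes_seq _ _ _ _ _ (fun d x => a d d)); last first.
  by apply: computes_eval => d x; rewrite /a subnn drop0.
have [C1 h1] := eval_linear_prop Fst.
have [C2 h2] := eval_linear_prop (Fork (Seq (Fork Fst (Const 1)) Defs.Sub)
     (Fork (Seq (Fork Fst (Const 1)) Defs.Sub) Snd)).
exists (C1 + C2 + 7)%N => d O x n hn _.
set S := data_size _.
have S2 : (2 <= data_size (Int d))%N := data_size_ge2 _.
have hS : (data_size (Int d) < S)%N by rewrite /S /a subn0 /=; lia.
have hl : (data_size (dlist (l d)) <= d * (data_size (Int d)).+1 + 2)%N.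
  by apply: data_size_dfun_le => i; apply: leq_data_size_int; rewrite /= ltnW.
have ha i : (data_size (a d i) <= 2 * n * S)%N.
  have h3 : (data_size (Int (d - i)%N) <= data_size (Int d))%N.
    by apply: leq_data_size_int; lia.
  have h4 : (data_size (dlist (drop (d - i) (l d))) <= data_size (dlist (l d)))%N.
    rewrite !data_size_dlist leq_add2r -{2}(cat_take_drop (d - i) (l d)) map_cat sumn_cat; lia.
  rewrite [data_size (a d i)]/=; rewrite -/(data_size (Int (d - i)%N)).
  apply: leq_trans (_ : _ <= (data_size (Int d) + (d * (data_size (Int d)).+1 + 2)).+1)%N _; first lia.
  nia.
pose tau := ((C1 + C2 + 1) * (2 * n * S))%N.
have := @Runs_while d O Fst (Fork (Seq (Fork Fst (Const 1)) Defs.Sub)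
     (Fork (Seq (Fork Fst (Const 1)) Defs.Sub) Snd)) d (a d) (fun i => (d - i)%N) tau => h.
apply: Runs_le (h _ _ _ _ _).
- rewrite /tau.
  have -> : (d.+1 * (3 * ((C1 + C2 + 1) * (2 * n * S))) = (6 * d.+1 * n) * (C1 + C2 + 1) * S)%N by ring.
  rewrite leq_mul2r; apply/orP; right.
  have -> : (C1 + C2 + 7 = 6 + (C1 + C2 + 1))%N by lia.
  rewrite expnD; apply: leq_mul; last by rewrite ltnW // ltn_expl; lia.
  have -> : (n ^ 6 = n ^ 4 * n * n)%N by rewrite !expnS; ring.
  rewrite leq_mul2r; apply/orP; right; apply: leq_mul; last lia.
  by apply: leq_trans (_ : _ <= 2 ^ 4)%N _ => //; rewrite leq_exp2r //; lia.
- move=> i hi; apply: (@Runs_le _ _ _ _ _ (C1 * (2 * n * S))%N); first by rewrite /tau leq_mul2r; lia.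
  exact: h1.
- by move=> i hi; lia.
- by lia.
- move=> i hi; apply: (@Runs_le _ _ _ _ _ (C2 * (2 * n * S))%N); first by rewrite /tau leq_mul2r; lia.
  apply: h2 (ha i).
  have hd : (d - i.+1 < d)%N by lia.
  rewrite /a /= (drop_nth (Int 0) (n := d - i.+1)) ?size_dfun //.
  rewrite -[nth _ _ _]/(nth (Int 0) [seq Int (nat_of_ord j) | j <- enum 'I_d] (Ordinal hd)).
  rewrite (nth_dfun (fun j : 'I_d => Int (nat_of_ord j))) /=.
  have -> : (Posz (d - i)%N - 1 = Posz (d - i.+1)%N) by lia.
  by have -> : (d - i.+1).+1 = (d - i)%N by lia.
- by move=> i hi; apply: leq_trans (ha i) _; rewrite /tau leq_pmull //; lia.
Qed.

(** The least power of two whose square is at least [X]. It is found by doubling, in a number of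
    turns linear in the bit length; on negative arguments the loop stops at once, whence the value
    1. *)
Definition sqrt_pow2 (X : int) : int :=
  if X is Posz m then (2 ^ up_log 4 m)%N%:Z else 1.

Definition SqrtP := Seq (Fork Skip (Const 1))
  (Seq (While (Seq (Fork Fst (Seq (Fork Snd Snd) Mul)) Defs.Sub)
     (Fork Fst (Seq (Fork Snd Snd) Add))) Snd).

(** The number of turns is proportional to the bit length of [X], so the cost would be quadratic in
    the input size; the bound by [n] restores linearity. *)
Lemma computes_sqrt (X : forall d, T d -> int) :
  (forall d (O : oracles d) (x : T d) n, ok O x n -> (data_size (Int (X d x)) <= n)%N) ->
  computes ok SqrtP (fun d x => Int (X d x)) (fun d x => Int (sqrt_pow2 (X d x))).
Proof.
move=> hX.
pose a d (x : T d) i := Pair (Int (X d x)) (Int (2 ^ i)%N%:Z).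
pose k d (x : T d) := if X d x is Posz m then up_log 4 m else 0%N.
apply: (@computes_seq _ _ _ _ _ (fun d x => a d x 0%N)).
  exact: computes_eval.
apply: (@computes_seq _ _ _ _ _ (fun d x => a d x (k d x))); last first.
  by apply: computes_eval => d x; rewrite /a /k /sqrt_pow2 /=; case: (X d x).
have [C1 h1] := eval_linear_prop (Seq (Fork Fst (Seq (Fork Snd Snd) Mul)) Defs.Sub).
have [C2 h2] := eval_linear_prop (Fork Fst (Seq (Fork Snd Snd) Add)).
exists (C1 + C2 + 8)%N => d O x n hn hx.
have hXn := hX _ _ _ _ hx.
set S := data_size _.
have hS : (4 <= S)%N by rewrite /S /=; lia.
have hk : (k d x <= n)%N.
  rewrite /k; case: (X d x) hXn => [m|//] hm.
  apply: up_log_min => //.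
  have := absz_lt_data_size m; rewrite absz_nat => hm'.
  apply: leq_trans (ltnW hm') _.
  apply: leq_trans (_ : _ <= 2 ^ n)%N _; first by rewrite leq_exp2l //; lia.
  by rewrite leq_exp2r //; lia.
have ha i : (i <= k d x)%N -> (data_size (a d x i) <= 2 * n * S)%N.
  move=> hi; have : (data_size (Int (2 ^ i)%N%:Z) <= n.+2)%N.
    by rewrite data_size_int absz_nat ltn_exp2l //; lia.
  rewrite /a; change (data_size (Pair ?u ?v)) with (data_size u + data_size v).+1.
  nia.
pose tau := ((C1 + C2 + 1) * (2 * n * S))%N.
have := @Runs_while d O (Seq (Fork Fst (Seq (Fork Snd Snd) Mul)) Defs.Sub)
  (Fork Fst (Seq (Fork Snd Snd) Add)) (k d x) (a d x)
  (fun i => X d x - (2 ^ i)%N%:Z * (2 ^ i)%N%:Z) tau => h.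
have h4 i : (2 ^ i * 2 ^ i = 4 ^ i)%N by rewrite -expnMn.
apply: Runs_le (h _ _ _ _ _).
- rewrite /tau.
  have -> : ((k d x).+1 * (3 * ((C1 + C2 + 1) * (2 * n * S))) = (6 * (k d x).+1 * n) * (C1 + C2 + 1) * S)%N by ring.
  rewrite leq_mul2r; apply/orP; right.
  have -> : (C1 + C2 + 8 = 7 + (C1 + C2 + 1))%N by lia.
  rewrite expnD; apply: leq_mul; last by rewrite ltnW // ltn_expl; lia.
  have -> : (n ^ 7 = n ^ 4 * (n * n) * n)%N by rewrite !expnS; ring.
  rewrite leq_mul2r; apply/orP; right; apply: leq_mul; last nia.
  by apply: leq_trans (_ : _ <= 2 ^ 4)%N _ => //; rewrite leq_exp2r //; lia.
- move=> i hi; apply: (@Runs_le _ _ _ _ _ (C1 * (2 * n * S))%N); first by rewrite /tau leq_mul2r; lia.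
  by apply: h1 (ha i hi).
- move=> i; rewrite -PoszM h4 /k; case: (X d x) => [m|//] hi.
  rewrite subr_gt0 ltz_nat ltnNge; apply/negP => hm.
  by have := up_log_min (p := 4) isT hm; lia.
- rewrite -PoszM h4 /k; case: (X d x) => [m|m] //.
  by rewrite subr_le0 lez_nat up_logP.
- move=> i hi; apply: (@Runs_le _ _ _ _ _ (C2 * (2 * n * S))%N); first by rewrite /tau leq_mul2r; lia.
  apply: h2 (ha i (ltnW hi)).
  by rewrite /a /= -PoszD addnn -mul2n -expnS.
- by move=> i hi; apply: leq_trans (ha i hi) _; rewrite /tau leq_pmull //; lia.
Qed.
End Counters.

(** * Ellipsoids and cuts *)

Lemma discriminant_le (R : realFieldType) (a b c : R) :
  (forall t, 0 <= a + 2 * b * t + c * t ^+ 2) -> b ^+ 2 <= a * c.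
Proof.
move=> h.
have c0 : 0 <= c.
  rewrite leNgt; apply/negP => c0.
  have a0 := h 0; rewrite mulr0 expr0n /= mulr0 !addr0 in a0.
  (* Adding the hypothesis at [t] and [- t] removes the linear term, and this choice makes
     [a + c * t ^ 2] at most [c], which is negative. *)
  pose t := 1 - a / c; have ct : c * t = c - a by rewrite /t; field; rewrite lt_eqF.
  have t1 : 1 <= t by rewrite lerBrDl gerDr mulr_ge0_le0 // invr_le0 ltW.
  have : c * t ^+ 2 <= c * t by rewrite ler_nM2l // expr2; nra.
  have := h t; have := h (- t); rewrite sqrrN; nra.
have [c00|cn0] := eqVneq c 0.
  have [->|b0] := eqVneq b 0; first by rewrite c00 expr0n mulr0.
  have := h (- (a + 1) / (2 * b)); rewrite c00 mul0r addr0.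
  have -> : 2 * b * (- (a + 1) / (2 * b)) = - (a + 1) by field.
  lra.
have := h (- b / c).
have -> : a + 2 * b * (- b / c) + c * (- b / c) ^+ 2 = (a * c - b ^+ 2) / c by field.
by rewrite pmulr_lge0 ?invr_gt0 ?lt_neqAle 1?eq_sym ?cn0 // subr_ge0.
Qed.

(** Cauchy-Schwarz in the plane: [x ^ 2 z ^ 2 <= (a q) (b p)], so the cross term [2 x z] is at most
    [a q + b p]. *)
Lemma sqr_addr_le (R : realDomainType) (x z a b p q : R) :
  0 <= a -> 0 <= b -> 0 <= p -> 0 <= q -> x ^+ 2 <= a * p -> z ^+ 2 <= b * q ->
  (x + z) ^+ 2 <= (a + b) * (p + q).
Proof.
move=> a0 b0 p0 q0 hx hz.
have h : x * z *+ 2 <= a * q + b * p.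
  have h1 : (x * z *+ 2) ^+ 2 <= (a * q + b * p) ^+ 2.
    have : (x * z) ^+ 2 <= (a * p) * (b * q) by rewrite exprMn ler_pM ?sqr_ge0.
    have := sqr_ge0 (a * q - b * p); nra.
  have h2 : 0 <= a * q + b * p by rewrite addr_ge0 ?mulr_ge0.
  rewrite leNgt; apply/negP => h3.
  have : (a * q + b * p) ^+ 2 < (x * z *+ 2) ^+ 2 by rewrite ltr_sqr ?nnegrE // ltW // (le_lt_trans h2).
  by rewrite ltNge h1.
by rewrite sqrrD; lra.
Qed.

(** In units of the ellipsoid, [t] is the depth of a kept point along the cut and [k'] the shift of
    the centre. Once the denominator is cleared, [1 - k / 2] cancels. Then
    [(t + k / 4) (t - 1) <= 0] bounds [k / 2 * t ^ 2] by an affine term, which together with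
    [- 2 k' t] decreases in [t]; the worst case [t = - k / 4] leaves only terms of order [k ^ 2]. *)
Lemma ellipsoid_shift_le (R : realFieldType) (k k' t : R) :
  0 < k -> k <= 1 / 4 -> k / 2 <= k' -> k' <= k -> - (k / 4) <= t -> t <= 1 ->
  (1 - t ^+ 2) + (k' - t) ^+ 2 / (1 - k / 2) <= 1 + 2 * k ^+ 2.
Proof.
move=> k0 k4 hk hk' t0 t1.
have d0 : 0 < 1 - k / 2 by lra.
rewrite -(ler_pM2r d0) mulrDl divfK ?gt_eqF //.
have h1 : (t + k / 4) * (t - 1) <= 0 by nra.
have h2 : k / 2 * ((t + k / 4) * (t - 1)) <= 0 by nra.
have h3 : k' ^+ 2 <= k ^+ 2 by rewrite ler_sqr ?nnegrE; lra.
have h4 : k ^+ 3 <= k ^+ 2 / 4 by rewrite exprS; nra.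
nra.
Qed.

Section Dot.
Variables (R : realType) (d : nat).
Implicit Types (x y z u a g : 'rV[R]_d) (P : 'M[R]_d).

Lemma dotE x y : dot x y = (x *m y^T) 0 0.
Proof. by rewrite mxE; apply: eq_bigr => i _; rewrite mxE. Qed.

Lemma dotC x y : dot x y = dot y x.
Proof. by apply: eq_bigr => i _; rewrite mulrC. Qed.

Lemma dotDl x y z : dot (x + y) z = dot x z + dot y z.
Proof. by rewrite !dotE mulmxDl mxE. Qed.

Lemma dotDr x y z : dot z (x + y) = dot z x + dot z y.
Proof. by rewrite dotC dotDl !(dotC z). Qed.

Lemma dotZl c x y : dot (c *: x) y = c * dot x y.
Proof. by rewrite !dotE -scalemxAl mxE. Qed.

Lemma dotZr c x y : dot x (c *: y) = c * dot x y.
Proof. by rewrite dotC dotZl dotC. Qed.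

Lemma dotNl x y : dot (- x) y = - dot x y.
Proof. by rewrite -scaleN1r dotZl mulN1r. Qed.

Lemma dotNr x y : dot x (- y) = - dot x y.
Proof. by rewrite dotC dotNl dotC. Qed.

Lemma dotBl x y z : dot (x - y) z = dot x z - dot y z.
Proof. by rewrite dotDl dotNl. Qed.

Lemma dotBr x y z : dot z (x - y) = dot z x - dot z y.
Proof. by rewrite dotDr dotNr. Qed.

Lemma dot_ge0 x : 0 <= dot x x.
Proof. by apply: sumr_ge0 => i _; rewrite -expr2 sqr_ge0. Qed.

Lemma dot_eq0 x : (dot x x == 0) = (x == 0).
Proof.
apply/idP/eqP => [|->]; last by rewrite -(scale0r (0 : 'rV_d)) dotZl mul0r.
rewrite psumr_eq0 => [|i _]; last by rewrite -expr2 sqr_ge0.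
move=> /allP h; apply/rowP => i; rewrite mxE.
by have := h i (mem_index_enum i); rewrite -expr2 sqrf_eq0 => /eqP.
Qed.

Lemma dot_gt0 x : x != 0 -> 0 < dot x x.
Proof. by move=> x0; rewrite lt_neqAle dot_ge0 eq_sym dot_eq0 x0. Qed.

Lemma dot_mulmx x y P : dot (x *m P) y = dot x (y *m P^T).
Proof. by rewrite !dotE trmx_mul trmxK mulmxA. Qed.

Lemma enorm_ge0 x : 0 <= enorm x. Proof. exact: sqrtr_ge0. Qed.

Lemma enorm_sqr x : enorm x ^+ 2 = dot x x.
Proof. by rewrite sqr_sqrtr // dot_ge0. Qed.

Lemma enormZ c x : enorm (c *: x) = `|c| * enorm x.
Proof. by rewrite /enorm dotZl dotZr mulrA -expr2 sqrtrM ?sqr_ge0 // sqrtr_sqr. Qed.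

Definition qf P y := dot (y *m P) y.

Definition in_ellipsoid P a z := forall y, dot y (z - a) ^+ 2 <= qf P y.

Lemma qfD P x y : P^T = P ->
  qf P (x + y) = qf P x + 2 * dot (x *m P) y + qf P y.
Proof.
move=> sP; rewrite /qf mulmxDl !dotDl !dotDr.
by rewrite [dot (y *m P) x]dot_mulmx sP [dot y _]dotC; ring.
Qed.

Lemma qfZ P c y : qf P (c *: y) = c ^+ 2 * qf P y.
Proof. by rewrite /qf -scalemxAl dotZl dotZr expr2 mulrA. Qed.

Lemma qf_cauchy P x y : P^T = P -> (forall z, 0 <= qf P z) ->
  dot (x *m P) y ^+ 2 <= qf P x * qf P y.
Proof.
move=> sP hP; apply: discriminant_le => t.
have := hP (x + t *: y); rewrite qfD // qfZ dotZr.
by rewrite [_ ^+ 2 * _]mulrC mulrA [_ * t]mulrC !mulrA [2 * t]mulrC.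
Qed.

Lemma qf1 y : qf 1%:M y = dot y y. Proof. by rewrite /qf mulmx1. Qed.

Lemma dot_cauchy x y : dot x y ^+ 2 <= dot x x * dot y y.
Proof.
rewrite -!qf1 -{1}(mulmx1 x); apply: qf_cauchy; first exact: trmx1.
by move=> z; rewrite qf1 dot_ge0.
Qed.

Lemma dot_le_enorm x y : dot x y <= enorm x * enorm y.
Proof.
have h0 : 0 <= enorm x * enorm y by rewrite mulr_ge0 ?enorm_ge0.
rewrite leNgt; apply/negP => h.
have : (enorm x * enorm y) ^+ 2 < dot x y ^+ 2.
  by rewrite ltr_sqr ?nnegrE // ltW // (le_lt_trans h0).
by rewrite exprMn !enorm_sqr ltNge dot_cauchy.
Qed.

Lemma enorm_le_sqr x c : 0 <= c -> (enorm x <= c) = (dot x x <= c ^+ 2).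
Proof. by move=> c0; rewrite -enorm_sqr ler_sqr ?nnegrE ?enorm_ge0. Qed.

Lemma enormD x y : enorm (x + y) <= enorm x + enorm y.
Proof.
rewrite enorm_le_sqr ?addr_ge0 ?enorm_ge0 //.
rewrite dotDl !dotDr sqrrD !enorm_sqr (dotC y x).
by have := dot_le_enorm x y; lra.
Qed.

Lemma qf_scale c P y : qf (c *: P) y = c * qf P y.
Proof. by rewrite /qf -scalemxAr dotZl. Qed.

(* The cut by [g] shrinks the quadratic form only in the direction conjugate to
   [g]; the factor [b] is the relative decrease there. *)
Definition shrink (b : R) P g : 'M[R]_d :=
  P - (b / qf P g) *: ((g *m P)^T *m (g *m P)).

Lemma shrink_sym b P g : P^T = P -> (shrink b P g)^T = shrink b P g.
Proof.
by move=> sP; rewrite /shrink linearB /= linearZ /= sP trmx_mul trmxK.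
Qed.

Lemma qf_shrink b P g y : P^T = P ->
  qf (shrink b P g) y = qf P y - b / qf P g * dot (y *m P) g ^+ 2.
Proof.
move=> sP; rewrite /qf /shrink mulmxBr dotBl; congr (_ - _).
rewrite -scalemxAr dotZl; congr (_ * _).
rewrite (mulmxA y (g *m P)^T).
have -> : y *m (g *m P)^T = (dot y (g *m P))%:M.
  by rewrite dotE; exact: mx11_scalar.
rewrite mul_scalar_mx dotZl expr2 [dot (y *m P) g]dot_mulmx sP.
by rewrite [dot (g *m P) y]dotC.
Qed.

Lemma shrink_ge (P : 'M[R]_d) b g y : P^T = P -> (forall z, 0 <= qf P z) -> 0 < qf P g ->
  0 <= b -> (1 - b) * qf P y <= qf (shrink b P g) y.
Proof.
move=> sP hP g0 b0; rewrite qf_shrink // mulrBl mul1r lerD2l lerN2.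
have := qf_cauchy y g sP hP; rewrite -ler_pdivrMr // => h.
by rewrite -mulrA ler_wpM2l // mulrC.
Qed.

Lemma shrink_le (P : 'M[R]_d) b g y : P^T = P -> 0 < qf P g -> 0 <= b ->
  qf (shrink b P g) y <= qf P y.
Proof.
move=> sP g0 b0; rewrite qf_shrink // gerBl mulr_ge0 ?sqr_ge0 //.
by rewrite divr_ge0 // ltW.
Qed.

(** Split [y] into a multiple of [g] and a part [y0] conjugate to [g]. The coordinates of the point,
    [x] along [y0] and [t] along [g], lie in a plane ellipse, so the claim becomes two-dimensional.
    The shift [k'] ranges over an interval to allow for an inexact square root. *)
Lemma in_ellipsoid_cut P a z g (k k' : R) : P^T = P -> 0 < qf P g -> in_ellipsoid P a z ->
  0 < k -> k <= 1 / 4 -> k / 2 <= k' -> k' <= k ->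
  dot g (z - a) <= k / 4 * Num.sqrt (qf P g) ->
  in_ellipsoid ((1 + 2 * k ^+ 2) *: shrink (k / 2) P g)
    (a - (k' / Num.sqrt (qf P g)) *: (g *m P)) z.
Proof.
move=> sP g0 hz k0 k4 hk hk' hcut y.
set w := Num.sqrt (qf P g) in hcut *.
have w0 : 0 < w by rewrite sqrtr_gt0.
have w2 : w ^+ 2 = qf P g by rewrite sqr_sqrtr // ltW.
pose s := dot (y *m P) g / qf P g.
pose y0 := y - s *: g.
pose t := - dot g (z - a) / w.
have gt : dot g (z - a) = - t * w by rewrite /t; field; rewrite gt_eqF.
have y0g : dot (y0 *m P) g = 0.
  by rewrite /y0 mulmxBl dotBl -scalemxAl dotZl -/(qf P g) /s divfK ?subrr // gt_eqF.
have yE : y = y0 + s *: g by rewrite /y0 subrK.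
have qy0 r : qf P (y0 + r *: g) = qf P y0 + r ^+ 2 * w ^+ 2.
  by rewrite qfD // dotZr y0g mulr0 mulr0 addr0 qfZ w2.
set x := dot y0 (z - a).
have hx : x ^+ 2 <= qf P y0 * (1 - t ^+ 2).
  (* The bounds at [y0 + (r / w) g] for all [r] form one quadratic in [r]; this is its discriminant
     inequality. *)
  have : (x * t) ^+ 2 <= (qf P y0 - x ^+ 2) * (1 - t ^+ 2).
    apply: discriminant_le => r.
    have := hz (y0 + (r / w) *: g).
    rewrite qy0 dotDl dotZl gt -/x.
    have -> : r / w * (- t * w) = - (t * r) by field; rewrite gt_eqF.
    have -> : (r / w) ^+ 2 * w ^+ 2 = r ^+ 2 by field; rewrite gt_eqF.
    by rewrite -subr_ge0; congr (_ <= _); ring.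
  by rewrite exprMn; lra.
have t2 : t ^+ 2 <= 1.
  have := hz g; rewrite gt -w2 mulNr sqrrN exprMn ger_pMl // exprn_gt0 //.
have t1 : t <= 1 by nra.
have tk : - (k / 4) <= t.
  by move: hcut; rewrite gt ler_pM2r // lerNl.
have num := ellipsoid_shift_le k0 k4 hk hk' tk t1.
have qy00 : 0 <= qf P y0 by apply: le_trans (hz y0); rewrite sqr_ge0.
have b0 : 0 < 1 - k / 2 by lra.
rewrite qf_scale qf_shrink //.
have -> : dot y (z - (a - (k' / w) *: (g *m P))) = x + s * w * (k' - t).
  have yu : dot y (z - a) = x + s * (- t * w) by rewrite {1}yE dotDl dotZl gt.
  rewrite opprB addrCA dotDr dotZr yu.
  have -> : dot y (g *m P) = s * w ^+ 2.
    by rewrite dotC dot_mulmx sP dotC /s w2 divfK // gt_eqF.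
  by field; rewrite gt_eqF.
have -> : qf P y - k / 2 / qf P g * dot (y *m P) g ^+ 2 =
  qf P y0 + (1 - k / 2) * (s * w) ^+ 2.
  rewrite {1}yE qy0 -w2 /s -w2; field; rewrite gt_eqF //.
rewrite [X in _ <= X]mulrC.
have hs : 0 <= (1 - k / 2) * (s * w) ^+ 2 by rewrite mulr_ge0 ?sqr_ge0 // ltW.
(* Cauchy-Schwarz separates [y], which yields the shrunk form, from [t], to which
   [ellipsoid_shift_le] applies. *)
apply: le_trans (_ : (qf P y0 + (1 - k / 2) * (s * w) ^+ 2) *
   ((1 - t ^+ 2) + (k' - t) ^+ 2 / (1 - k / 2)) <= _).
  apply: sqr_addr_le => //.
  - by rewrite subr_ge0.
  - by rewrite divr_ge0 ?sqr_ge0 // ltW.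
  - have e : (s * w * (k' - t)) ^+ 2 =
      (1 - k / 2) * (s * w) ^+ 2 * ((k' - t) ^+ 2 / (1 - k / 2)).
      by field; apply: lt0r_neq0; lra.
    by rewrite e lexx.
by rewrite ler_wpM2l // addr_ge0.
Qed.

(* Moving the centre by [e] is paid for by inflating the ellipsoid. *)
Lemma in_ellipsoid_round P a z e P' eta c : 0 < eta ->
  (forall y, (1 + eta) * qf P y + c * dot y y <= qf P' y) ->
  (1 + eta^-1) * dot e e <= c ->
  in_ellipsoid P a z -> in_ellipsoid P' (a + e) z.
Proof.
move=> e0 hP hc hz y; apply: le_trans (hP y).
have -> : z - (a + e) = (z - a) - e by rewrite opprD addrA.
rewrite dotBr; set u := dot y (z - a); set v := dot y e.
apply: le_trans (_ : (1 + eta) * u ^+ 2 + (1 + eta^-1) * v ^+ 2 <= _).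
  rewrite -subr_ge0.
  have -> : (1 + eta) * u ^+ 2 + (1 + eta^-1) * v ^+ 2 - (u - v) ^+ 2 = (eta * u + v) ^+ 2 / eta.
    by field; rewrite gt_eqF.
  by rewrite divr_ge0 ?sqr_ge0 // ltW.
apply: lerD; first by rewrite ler_wpM2l ?hz // addr_ge0 // ltW.
apply: le_trans (_ : (1 + eta^-1) * dot e e * dot y y <= _); last first.
  by rewrite ler_wpM2r // dot_ge0.
rewrite -mulrA [dot e e * _]mulrC; apply: ler_wpM2l; last exact: dot_cauchy.
by rewrite addr_ge0 ?invr_ge0 ?ltW.
Qed.

(** Adding the inequalities at the two points of the ball that are extremal for [y] cancels the
    cross term with the unknown offset [dot y (c - a)]. *)
Lemma in_ellipsoid_ball P a c r : 0 <= r ->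
  (forall z, enorm (z - c) <= r -> in_ellipsoid P a z) ->
  forall y, r ^+ 2 * dot y y <= qf P y.
Proof.
move=> r0 h y.
have [->|y0] := eqVneq y 0.
  by rewrite /qf mul0mx -(scale0r (0 : 'rV_d)) !dotZl !mul0r mulr0.
have ny : 0 < enorm y by rewrite sqrtr_gt0 dot_gt0.
have key s : `|s| = 1 -> (dot y (c - a) + s * r * enorm y) ^+ 2 <= qf P y.
  move=> s1.
  have := h (c + (s * r / enorm y) *: y) _ y.
  rewrite addrAC subrr add0r enormZ normrM normrM s1 mul1r normfV.
  rewrite (ger0_norm r0) (ger0_norm (enorm_ge0 _)) divfK ?gt_eqF // lexx => /(_ isT).
  rewrite addrAC dotDr dotZr -enorm_sqr.
  by rewrite [s * r / _ * _](_ : _ = s * r * enorm y) //; field; rewrite gt_eqF.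
have h1 := key 1 (normr1 _); have h2 := key (-1) (normrN1 _).
rewrite -enorm_sqr -exprMn.
have := sqr_ge0 (dot y (c - a)).
move: h1 h2; rewrite mul1r mulN1r mulNr !sqrrD sqrrN.
lra.
Qed.
End Dot.

(** * Determinants of quadratic forms *)

Lemma det_one_sub (R : comPzRingType) n (u : 'cV[R]_n) (w : 'rV[R]_n) :
  \det (1%:M - u *m w) = 1 - (w *m u) 0 0.
Proof.
(* Eliminating the lower left block of [M], or the upper right one, gives two triangular
   factorizations, whose determinants are the two sides. *)
pose M := block_mx (1%:M : 'M[R]_1) w u (1%:M : 'M[R]_n).
have h1 : \det M = \det (1%:M - u *m w).
  have -> : M = block_mx 1%:M 0 u 1%:M *m block_mx 1%:M w 0 (1%:M - u *m w).
    rewrite mulmx_block !mul1mx !mul0mx ?mulmx0 !mulmx1 !addr0.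
    by rewrite addrC subrK.
  by rewrite det_mulmx det_lblock det_ublock !det1 !mul1r.
rewrite -h1.
have -> : M = block_mx 1%:M w 0 1%:M *m block_mx (1%:M - w *m u) 0 u 1%:M.
  rewrite mulmx_block !mul1mx !mul0mx !mulmx1 ?mulmx0 ?add0r ?addr0.
  by rewrite subrK.
rewrite det_mulmx det_lblock det_ublock !det1 !mul1r !mulr1.
by rewrite det_mx11 !mxE eqxx.
Qed.

Section Det.
Variable R : realType.

(** The shrunk matrix is [P] times a rank-one perturbation of the identity, of trace [- b]. *)
Lemma det_shrink d (P : 'M[R]_d) b g : P^T = P -> qf P g != 0 ->
  \det (shrink b P g) = \det P * (1 - b).
Proof.
move=> sP g0; rewrite /shrink.
set c := b / _.
have -> : P - c *: ((g *m P)^T *m (g *m P)) = P *m (1%:M - g^T *m (c *: (g *m P))).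
  by rewrite mulmxBr mulmx1 -!scalemxAr trmx_mul sP !mulmxA.
rewrite det_mulmx det_one_sub -scalemxAl mxE -dotE -/(qf P g).
by rewrite /c divfK.
Qed.

Lemma dot_row_mx m n (x1 y1 : 'rV[R]_m) (x2 y2 : 'rV[R]_n) :
  dot (row_mx x1 x2) (row_mx y1 y2) = dot x1 y1 + dot x2 y2.
Proof. by rewrite !dotE tr_row_mx mul_row_col mxE. Qed.

Definition schur n (a : R) (b : 'rV[R]_n) (D : 'M[R]_n) := D - a^-1 *: (b^T *m b).

Lemma qf_block n (a : R) (b : 'rV[R]_n) (D : 'M[R]_n) t v : a != 0 ->
  qf (block_mx a%:M b b^T D) (row_mx t%:M v) =
  a * (t + dot b v / a) ^+ 2 + qf (schur a b D) v.
Proof.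
move=> a0; rewrite /qf mul_row_block dot_row_mx.
have -> : v *m b^T = (dot b v)%:M by rewrite dotC dotE; exact: mx11_scalar.
rewrite -scalar_mxM -raddfD /= mul_scalar_mx dotDl dotZl.
have -> : dot (t * a + dot b v)%:M (t%:M : 'rV[R]_1) = (t * a + dot b v) * t.
  by rewrite /dot big_ord1 !mxE eqxx !mulr1n.
rewrite /schur mulmxBr dotBl -scalemxAr dotZl (mulmxA v).
have -> : v *m b^T = (dot b v)%:M by rewrite dotC dotE; exact: mx11_scalar.
rewrite mul_scalar_mx dotZl; field.
by [].
Qed.

Lemma det_block_schur n (a : R) (b : 'rV[R]_n) (D : 'M[R]_n) : a != 0 ->
  \det (block_mx a%:M b b^T D) = a * \det (schur a b D).
Proof.
move=> a0.
have -> : block_mx a%:M b b^T D =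
    block_mx 1%:M 0 (a^-1 *: b^T) 1%:M *m block_mx a%:M b 0 (schur a b D).
  rewrite mulmx_block !mul1mx !mul0mx ?mulmx0 !addr0 -!scalemxAl.
  rewrite mul_mx_scalar scalerA mulVf // scale1r.
  by rewrite /schur addrC subrK.
by rewrite det_mulmx det_lblock det_ublock !det1 !mul1r det_scalar1.
Qed.

Lemma sym_block n (A : 'M[R]_(1 + n)) : A^T = A ->
  exists a b (D : 'M[R]_n), A = block_mx a%:M b b^T D /\ D^T = D.
Proof.
move=> sA; exists (A 0 0), (ursubmx A), (drsubmx A); split; last first.
  by rewrite -{2}sA; apply/matrixP => i j; rewrite !mxE.
rewrite -{1}(submxK A); congr block_mx.
  by apply/matrixP => i j; rewrite !ord1 !mxE eqxx mulr1n; congr (A _ _); apply/val_inj.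
by rewrite -{1}sA; apply/matrixP => i j; rewrite !mxE.
Qed.

Lemma schur_sym n (a : R) (b : 'rV[R]_n) (D : 'M[R]_n) : D^T = D ->
  (schur a b D)^T = schur a b D.
Proof. by move=> sD; rewrite /schur linearB /= linearZ /= sD trmx_mul trmxK. Qed.

(* By induction on the dimension: the Schur complement of the first diagonal
   entry is the partial minimum of the quadratic form, hence is monotone too. *)
Lemma det_mono n (A B : 'M[R]_n) : A^T = A -> B^T = B ->
  (forall y, y != 0 -> 0 < qf A y) -> (forall y, qf A y <= qf B y) ->
  0 < \det A /\ \det A <= \det B.
Proof.
elim: n A B => [|n IH] A B sA sB pA hAB; first by rewrite !det_mx00.
have [a [b [D [eA sD]]]] := sym_block sA.
have [a' [b' [D' [eB sD']]]] := sym_block sB.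
have row0 : row_mx (1%:M : 'rV[R]_1) (0 : 'rV[R]_n) != 0.
  apply/eqP => /rowP/(_ 0); rewrite !mxE; case: splitP => // j _; rewrite !mxE !ord1 /= => /eqP.
  by rewrite oner_eq0.
have qrow (a0 : R) b0 (D0 : 'M[R]_n) :
    qf (block_mx a0%:M b0 b0^T D0) (row_mx (1%:M : 'rV[R]_1) 0) = a0.
  rewrite /qf mul_row_block dot_row_mx !mul0mx !addr0 mul1mx.
  rewrite [X in _ + X](_ : _ = 0); last by rewrite /dot big1 // => i _; rewrite !mxE mulr0.
  by rewrite /dot big_ord1 !mxE eqxx !mulr1n mulr1 addr0.
have a_gt0 : 0 < a by have := pA _ row0; rewrite eA qrow.
have aa' : a <= a' by have := hAB (row_mx 1%:M 0); rewrite eA eB !qrow.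
have a'_gt0 : 0 < a' := lt_le_trans a_gt0 aa'.
have an0 : a != 0 by rewrite gt_eqF.
have an0' : a' != 0 by rewrite gt_eqF.
have [] := IH (schur a b D) (schur a' b' D') (schur_sym _ _ sD) (schur_sym _ _ sD').
- move=> v v0.
  have := pA (row_mx (- (dot b v / a))%:M v).
  rewrite eA qf_block // addNr expr0n mulr0 add0r; apply.
  apply: contraNneq v0 => h; apply/eqP/rowP => i.
  by have := congr1 (fun M : 'rV[R]_(1 + n) => M 0 (rshift 1 i)) h; rewrite row_mxEr !mxE.
- move=> v.
  have := hAB (row_mx (- (dot b' v / a'))%:M v).
  rewrite eA eB !qf_block // addNr expr0n mulr0 add0r; apply: le_trans.
  by rewrite lerDr mulr_ge0 ?sqr_ge0 // ltW.
rewrite eA eB !det_block_schur // => h1 h2; split; first exact: mulr_gt0.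
by rewrite ler_pM // ltW.
Qed.
End Det.

(** * One step in fixed-point arithmetic *)

Definition mulv d (M : 'I_d -> 'I_d -> int) (G : 'I_d -> int) (i : 'I_d) : int :=
  \sum_j M i j * G j.

Definition curv d (M : 'I_d -> 'I_d -> int) (G : 'I_d -> int) : int :=
  \sum_i mulv M G i * G i.

(* The power of two from [sqrt_pow2] stands for a square root: a step of the centre
   that is correct up to a factor 2 is good enough. *)
Definition new_center d (s : int) (A : 'I_d -> int) M (G : 'I_d -> int) (i : 'I_d) : int :=
  A i - ((s * mulv M G i) %/ (16 * d.+1%:Z * sqrt_pow2 (curv M G * s)))%Z.

(* With [k = 1 / (16 (d + 1))], this is [(1 + 3 k^2) (M - (k / 2) V V^T / curv)],
   rounded down; the term on the diagonal makes up for the rounding. *)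
Definition new_shape d M (G : 'I_d -> int) (i j : 'I_d) : int :=
  (((256 * d.+1%:Z ^+ 2 + 3) *
      (32 * d.+1%:Z * curv M G * M i j - mulv M G i * mulv M G j))
    %/ (256 * d.+1%:Z ^+ 2 * (32 * d.+1%:Z * curv M G)))%Z
  + (if i == j then 2 * d.+1%:Z else 0).

Definition cut_width (R : realType) (d : nat) : R := 1 / (16 * d.+1%:R).

Section Step.
Variable R : realType.

Lemma divz_round (a b : int) : 0 < b ->
  0 <= (a%:~R / b%:~R - (a %/ b)%Z%:~R : R) <= 1.
Proof.
move=> b0.
have b0' : 0 < b%:~R :> R by rewrite ltr0z.
have e : a%:~R = (a %/ b)%Z%:~R * b%:~R + (a %% b)%Z%:~R :> R.
  by rewrite {1}(divz_eq a b) rmorphD rmorphM.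
have -> : a%:~R / b%:~R - (a %/ b)%Z%:~R = (a %% b)%Z%:~R / b%:~R :> R.
  by rewrite e; field; rewrite gt_eqF.
have r0 : 0 <= (a %% b)%Z%:~R :> R by rewrite ler0z modz_ge0 // gt_eqF.
apply/andP; split; first by apply: divr_ge0 => //; exact: ltW.
rewrite ler_pdivrMr // mul1r ler_int ltW //.
exact: ltz_pmod.
Qed.

Lemma sqrt_pow2_bounds (X : int) : 0 < X ->
  0 < sqrt_pow2 X /\ X <= sqrt_pow2 X ^+ 2 <= 4 * X.
Proof.
case: X => // m m0; rewrite /sqrt_pow2; split; first by rewrite ltz_nat expn_gt0.
rewrite expr2 -!PoszM !lez_nat -expnMn (_ : (2 * 2 = 4)%N) //.
rewrite up_logP //=.
(* For [m <= 1] the logarithm is 0 and has no predecessor; otherwise the preceding power of 4 is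
   still below [m]. *)
have [m1|m1] := leqP m 1.
  have -> : m = 1%N by lia.
  by rewrite up_log1.
have := up_log_gtn (p := 4) isT m1.
have : (0 < up_log 4 m)%N by rewrite up_log_gt0.
by case: (up_log 4 m) => // k _ /=; rewrite expnS leq_mul2l /= => /ltnW.
Qed.

Variable d : nat.
Implicit Types (A G : 'I_d -> int) (M : 'I_d -> 'I_d -> int) (s : nat).
Local Notation N := (d.+1%:R : R).
Local Notation kap := (cut_width R d).

Definition rcenter s A : 'rV[R]_d := \row_i ((A i)%:~R / s%:R).
Definition rshape s M : 'M[R]_d := \matrix_(i, j) ((M i j)%:~R / s%:R).
Definition rdir G : 'rV[R]_d := \row_i (G i)%:~R.

Lemma rshape_sym s M : (forall i j, M i j = M j i) -> (rshape s M)^T = rshape s M.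
Proof. by move=> h; apply/matrixP => i j; rewrite !mxE h. Qed.

Lemma rdir_shape s M G i : (forall i j, M i j = M j i) ->
  (rdir G *m rshape s M) 0 i = (mulv M G i)%:~R / s%:R.
Proof.
move=> h; rewrite mxE /mulv rmorph_sum /= mulr_suml; apply: eq_bigr => j _.
by rewrite !mxE rmorphM /= h; ring.
Qed.

Lemma qf_rdir s M G : (forall i j, M i j = M j i) ->
  qf (rshape s M) (rdir G) = (curv M G)%:~R / s%:R.
Proof.
move=> h; rewrite /qf /dot /curv rmorph_sum /= mulr_suml; apply: eq_bigr => j _.
by rewrite rdir_shape // !mxE rmorphM /= mulrAC.
Qed.

Lemma new_shape_sym M G : (forall i j, M i j = M j i) ->
  forall i j, new_shape M G i j = new_shape M G j i.
Proof. by move=> h i j; rewrite /new_shape h eq_sym (mulrC (mulv M G i)). Qed.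

(** From [2 |y_i y_j| <= y_i ^ 2 + y_j ^ 2], summed over both indices. It is meant for the matrix of
    rounding errors, whose entries lie in the unit interval. *)
Lemma qf_bounded (E : 'M[R]_d) y : (forall i j, 0 <= E i j <= 1) ->
  `|qf E y| <= d%:R * dot y y.
Proof.
move=> hE; rewrite /qf {1}/dot.
under eq_bigr => i _ do rewrite mxE mulr_suml.
apply: le_trans (ler_norm_sum _ _ _) _.
apply: le_trans (_ : \sum_i \sum_j (y 0 i ^+ 2 + y 0 j ^+ 2) / 2 <= _).
  apply: ler_sum => i _; apply: le_trans (ler_norm_sum _ _ _) _.
  apply: ler_sum => j _.
  have /andP[e0 e1] := hE j i.
  rewrite !normrM (ger0_norm e0).
  have := sqr_ge0 (`|y 0 i| - `|y 0 j|); have := normr_ge0 (y 0 i); have := normr_ge0 (y 0 j).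
  rewrite -(real_normK (num_real (y 0 i))) -(real_normK (num_real (y 0 j))).
  move: (`|y 0 i|) (`|y 0 j|) (E j i) e0 e1 => u v w e0 e1 v0 u0 h.
  have : v * w * u <= v * u by rewrite mulrAC ler_piMr // mulr_ge0.
  lra.
have eS : \sum_(i < d) y 0 i ^+ 2 = dot y y by apply: eq_bigr => i _; rewrite expr2.
under eq_bigr => i _ do rewrite -mulr_suml big_split /= sumr_const card_ord eS.
rewrite -mulr_suml big_split /= sumr_const card_ord sumrMnl eS -mulr_natl; lra.
Qed.

Lemma rshape_new s M G : (0 < s)%N -> (forall i j, M i j = M j i) -> 0 < curv M G ->
  exists2 E : 'M[R]_d, (forall i j, 0 <= E i j <= 1) &
    rshape s (new_shape M G) =
      (1 + 3 * kap ^+ 2) *: shrink (kap / 2) (rshape s M) (rdir G)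
      + s%:R^-1 *: ((2 * N)%:M - E).
Proof.
move=> s0 h c0.
have [a [b [b0 aE bE abE]]] : exists (a : 'I_d -> 'I_d -> int) (b : int),
    [/\ 0 < b,
      forall i j, (a i j)%:~R = (256 * N ^+ 2 + 3) *
        (32 * N * (curv M G)%:~R * (M i j)%:~R - (mulv M G i)%:~R * (mulv M G j)%:~R),
      b%:~R = 256 * N ^+ 2 * (32 * N * (curv M G)%:~R) :> R
    & forall i j, new_shape M G i j =
       (a i j %/ b)%Z + (if i == j then 2 * d.+1%:Z else 0)].
  eexists; eexists; split; last by [].
  - by rewrite !mulr_gt0 ?exprn_gt0 ?ltr0n.
  - move=> i j.
    by rewrite !(rmorphM, rmorphD, rmorphN, rmorphXn, rmorph_nat).
  - by rewrite !(rmorphM, rmorphXn, rmorph_nat).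
exists (\matrix_(i, j) ((a i j)%:~R / b%:~R - (a i j %/ b)%Z%:~R)) => [i j|].
  by rewrite mxE divz_round.
have sR : s%:R != 0 :> R by rewrite pnatr_eq0 -lt0n.
have cR : (curv M G)%:~R != 0 :> R by rewrite intr_eq0 gt_eqF.
have NR : N != 0 by rewrite pnatr_eq0.
apply/matrixP => i j; rewrite !mxE abE big_ord1 !mxE.
have -> : \sum_k rdir G 0 k * rshape s M k i = (mulv M G i)%:~R / s%:R.
  by rewrite -rdir_shape // mxE.
have -> : \sum_k rdir G 0 k * rshape s M k j = (mulv M G j)%:~R / s%:R.
  by rewrite -rdir_shape // mxE.
rewrite qf_rdir // [in LHS]rmorphD /= aE bE.
have -> : (if i == j then 2 * d.+1%:Z else 0)%:~R = (2 * N) *+ (i == j) :> R.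
  by case: eqP => _; rewrite ?rmorph0 ?mulr0n // mulr1n rmorphM.
rewrite /cut_width; move: NR; move: (d.+1%:R : R) => n n0; field; rewrite ?cR ?sR ?n0 //.
Qed.

Lemma rcenter_new s A M G : (0 < s)%N -> (forall i j, M i j = M j i) -> 0 < curv M G ->
  exists (k' : R) (e : 'rV[R]_d), [/\ kap / 2 <= k', k' <= kap, dot e e <= d%:R / s%:R ^+ 2 &
    rcenter s (new_center s A M G) =
      rcenter s A - (k' / Num.sqrt (qf (rshape s M) (rdir G))) *: (rdir G *m rshape s M) + e].
Proof.
move=> s0 h c0.
have sR : 0 < s%:R :> R by rewrite ltr0n.
have cR : 0 < (curv M G)%:~R :> R by rewrite ltr0z.
have NR : 0 < N by rewrite ltr0n.
have X0 : 0 < curv M G * s by rewrite mulr_gt0.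
have [H0 /andP[H1 H2]] := sqrt_pow2_bounds X0.
rewrite /new_center; move: (sqrt_pow2 _) H0 H1 H2 => H H0 H1 H2.
have HR : 0 < H%:~R :> R by rewrite ltr0z.
set w := Num.sqrt _.
have qE : qf (rshape s M) (rdir G) = (curv M G)%:~R / s%:R by rewrite qf_rdir.
have w0 : 0 < w by rewrite sqrtr_gt0 qE divr_gt0.
have w2 : w ^+ 2 = (curv M G)%:~R / s%:R by rewrite sqr_sqrtr qE // ltW // divr_gt0.
have sw0 : 0 < s%:R * w by rewrite mulr_gt0.
have sw2 : (s%:R * w) ^+ 2 = (curv M G)%:~R * s%:R by rewrite exprMn w2; field; rewrite gt_eqF.
have h1 : s%:R * w <= H%:~R.
  rewrite -ler_sqr ?nnegrE ?(ltW sw0) ?(ltW HR) // sw2.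
  have h3 : (curv M G * s)%:~R <= (H ^+ 2)%:~R :> R by rewrite ler_int.
  by rewrite rmorphM rmorphXn in h3.
have h2 : H%:~R / 2 <= s%:R * w.
  rewrite ler_pdivrMr // -ler_sqr ?nnegrE ?(ltW HR) ?mulr_ge0 ?(ltW sw0) ?(ltW w0) // exprMn sw2.
  have : (H ^+ 2)%:~R <= (4 * (curv M G * s))%:~R :> R; first by rewrite ler_int.
  rewrite !(rmorphM, rmorph_nat) /= => h3; rewrite -[(s%:Z)%:~R]/(s%:R : R) in h3.
  lra.
pose b := 16 * d.+1%:Z * H.
have b0 : 0 < b by apply: mulr_gt0 H0; apply: mulr_gt0; rewrite ?ltr0n ?ltz_nat.
have bE : b%:~R = 16 * N * H%:~R :> R by rewrite /b !(rmorphM, rmorph_nat).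
(* [H] stands for the exact root [s w] and lies between [s w] and [2 s w], so the step taken is
   between half the intended one and all of it. *)
exists (kap * (s%:R * w) / H%:~R).
exists (\row_i (((s%:Z * mulv M G i)%:~R / b%:~R - (s%:Z * mulv M G i %/ b)%Z%:~R) / s%:R)).
have k0 : 0 < kap by rewrite /cut_width divr_gt0 ?mulr_gt0.
split.
- have h4 : 2^-1 <= s%:R * w / H%:~R by rewrite ler_pdivlMr //; lra.
  by have := ler_wpM2l (ltW k0) h4; rewrite mulrA.
- have h4 : s%:R * w / H%:~R <= 1 by rewrite ler_pdivrMr // mul1r.
  by have := ler_wpM2l (ltW k0) h4; rewrite mulrA mulr1.
- rewrite /dot; apply: le_trans (_ : \sum_(i < d) (s%:R ^+ 2)^-1 <= _); last first.
    by rewrite sumr_const card_ord mulr_natl.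
  apply: ler_sum => i _; rewrite !mxE.
  have /andP[e0 e1] := divz_round (s%:Z * mulv M G i) b0.
  rewrite -expr2 exprMn exprVn; apply: ler_piMl; first by rewrite invr_ge0 exprn_ge0 ?ler0n.
  by rewrite expr_le1.
- apply/rowP => i; rewrite mxE [RHS]mxE [X in _ = X + _]mxE [X in _ = _ + X + _]mxE.
  rewrite [X in _ = _ - X + _]mxE rdir_shape // !mxE -/b rmorphB /= bE rmorphM /=.
  move: ((s%:Z * mulv M G i %/ b)%Z%:~R : R) => q.
  rewrite -[(s%:Z)%:~R]/(s%:R).
  rewrite /cut_width; field; rewrite ?(gt_eqF, sR, NR, HR, w0) //.
Qed.
End Step.

Section Step.
Variables (R : realType) (d : nat).
Implicit Types (A G : 'I_d -> int) (M : 'I_d -> 'I_d -> int) (s : nat).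
Local Notation N := (d.+1%:R : R).
Local Notation kap := (cut_width R d).

Lemma qf_addm (P Q : 'M[R]_d) y : qf (P + Q) y = qf P y + qf Q y.
Proof. by rewrite /qf mulmxDr dotDl. Qed.

(** The diagonal term is [2 N] and the rounding errors change the form by at most [d <= N]; what
    remains is between [N] and [3 N], in units of the grid. *)
Lemma qf_new_shape s M G y : (0 < s)%N -> (forall i j, M i j = M j i) -> 0 < curv M G ->
  (1 + 3 * kap ^+ 2) * qf (shrink (kap / 2) (rshape R s M) (rdir R G)) y + N / s%:R * dot y y <= qf (rshape R s (new_shape M G)) y
  <= (1 + 3 * kap ^+ 2) * qf (shrink (kap / 2) (rshape R s M) (rdir R G)) y
     + 3 * N / s%:R * dot y y.
Proof.
move=> s0 h c0.
have [E hE ->] := rshape_new R s0 h c0.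
rewrite (qf_addm (_ *: _)) (qf_scale (1 + _)) (qf_scale s%:R^-1).
have -> : qf ((2 * N)%:M - E) y = 2 * N * dot y y - qf E y.
  by rewrite /qf mulmxBr dotBl mul_mx_scalar dotZl.
have hq := qf_bounded y hE; rewrite ler_norml in hq.
have sR : 0 < s%:R^-1 :> R by rewrite invr_gt0 ltr0n.
have y0 := dot_ge0 y.
have dN : d%:R * dot y y <= N * dot y y by rewrite ler_wpM2r // ler_nat.
move: (qf (shrink _ _ _) y) => q.
have -> : N / s%:R * dot y y = s%:R^-1 * (N * dot y y) by ring.
have -> : 3 * N / s%:R * dot y y = s%:R^-1 * (3 * (N * dot y y)) by ring.
case/andP: hq => hq1 hq2.
by rewrite !lerD2l; apply/andP; split; rewrite ler_pM2l //; move: dN hq1 hq2 y0;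
  rewrite -[2 * N * dot y y]mulrA; lra.
Qed.

Lemma kap_gt0 : 0 < kap. Proof. by rewrite /cut_width divr_gt0 ?mulr_gt0. Qed.

Lemma kap_le : kap <= 1 / 16.
Proof.
have NR : 1 <= N by rewrite ler1n.
by rewrite /cut_width ler_pdivrMr ?mulr_gt0 ?(lt_le_trans ltr01 NR) //; lra.
Qed.

Lemma kapN : kap * N = 1 / 16.
Proof.
have : N != 0 by rewrite pnatr_eq0.
by rewrite /cut_width; move: (d.+1%:R : R) => n n0; field.
Qed.

Lemma in_ellipsoid_new s A M G z : (512 * d.+1 ^ 2 + 1 <= s)%N ->
  (forall i j, M i j = M j i) -> 0 < curv M G ->
  in_ellipsoid (rshape R s M) (rcenter R s A) z ->
  dot (rdir R G) (z - rcenter R s A) <= kap / 4 * Num.sqrt (qf (rshape R s M) (rdir R G)) ->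
  in_ellipsoid (rshape R s (new_shape M G)) (rcenter R s (new_center s A M G)) z.
Proof.
move=> hs h c0 hz hcut.
have s0 : (0 < s)%N by lia.
have sR : 0 < s%:R :> R by rewrite ltr0n.
have cR : 0 < (curv M G)%:~R :> R by rewrite ltr0z.
have sP := rshape_sym R s h.
have hP y : 0 <= qf (rshape R s M) y by apply: le_trans (hz y); rewrite sqr_ge0.
have g0 : 0 < qf (rshape R s M) (rdir R G) by rewrite qf_rdir // divr_gt0.
have k0 := kap_gt0; have k1 := kap_le; have kN := kapN.
have [k' [e [hk1 hk2 he ->]]] := rcenter_new R A s0 h c0.
have k4 : kap <= 1 / 4 by lra.
have h1 := in_ellipsoid_cut sP g0 hz k0 k4 hk1 hk2 hcut.
(* The factor [1 + kap ^ 2 / 2] fits between the inflations [1 + 2 kap ^ 2] of the exact cut and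
   [1 + 3 kap ^ 2] of the program, and [1 + 1 / eta] is exactly the lower bound required of [s]. *)
apply: (in_ellipsoid_round (eta := kap ^+ 2 / 2) (c := N / s%:R)) h1.
- by rewrite divr_gt0 ?exprn_gt0.
- move=> y; have /andP[h2 _] := qf_new_shape y s0 h c0.
  apply: le_trans h2; rewrite lerD2r qf_scale mulrA ler_wpM2r //.
    apply: le_trans (shrink_ge _ sP hP g0 _); last by lra.
    by rewrite mulr_ge0 ?hP //; lra.
  move: kap k0 k1 => k k0 k1.
  have : k ^+ 2 <= 1 / 16 by nra.
  have := sqr_ge0 k; move: (k ^+ 2) => x; nra.
- have e1 : (1 + (kap ^+ 2 / 2)^-1) = (512 * d.+1 ^ 2 + 1)%:R :> R.
    rewrite /cut_width natrD natrM natrX; have : N != 0 by rewrite pnatr_eq0.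
    by move: (d.+1%:R : R) => n n0; field.
  rewrite e1.
  apply: le_trans (_ : s%:R * (d%:R / s%:R ^+ 2) <= _).
    by apply: ler_pM; [exact: ler0n|exact: dot_ge0|rewrite ler_nat|exact: he].
  have -> : s%:R * (d%:R / s%:R ^+ 2) = d%:R / s%:R :> R by field; rewrite gt_eqF.
  by rewrite ler_pM2r ?invr_gt0 // ler_nat.
Qed.

(** By Bernoulli and [d * kap <= 1 / 16], [1 - kap / 4 <= (1 - 4 kap ^ 2) ^ d], whose product with
    [(1 + 4 kap ^ 2) ^ d] is at most 1. So the inflation costs at most one of the two factors in
    [1 - kap / 2 <= (1 - kap / 4) ^ 2]. *)
Lemma pow_kap_le : (1 + 4 * kap ^+ 2) ^+ d * (1 - kap / 2) <= 1 - kap / 4.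
Proof.
have k0 := kap_gt0; have k1 := kap_le; have kN := kapN.
have hd : d%:R * kap <= 1 / 16.
  by rewrite -kN mulrC ler_pM2l // ler_nat.
move: kap k0 k1 hd {kN} => k k0 k1 hd.
have x1 : 4 * k ^+ 2 <= 1 / 64 by nra.
have bern (x : R) n : 0 <= x -> x <= 1 -> 1 - n%:R * x <= (1 - x) ^+ n.
  move=> x0 xl; elim: n => [|n IH]; first by rewrite mul0r subr0 expr0.
  have x2 : 0 <= 1 - x by lra.
  rewrite exprS -natr1; apply: le_trans _ (ler_wpM2l x2 IH).
  have : 0 <= n%:R * x * x by rewrite !mulr_ge0.
  lra.
have h1 : (1 + 4 * k ^+ 2) ^+ d * (1 - 4 * k ^+ 2) ^+ d <= 1.
  have x0 : 0 <= 4 * k ^+ 2 by rewrite mulr_ge0 ?sqr_ge0.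
  rewrite -exprMn; move: (4 * k ^+ 2) x0 x1 => x x0 x1.
  by apply: exprn_ile1; nra.
have h2 : 1 - d%:R * (4 * k ^+ 2) <= (1 - 4 * k ^+ 2) ^+ d by apply: bern; nra.
have h3 : 1 - k / 4 <= 1 - d%:R * (4 * k ^+ 2).
  have -> : d%:R * (4 * k ^+ 2) = 4 * (d%:R * k) * k by ring.
  nra.
have h4 : 0 <= (1 + 4 * k ^+ 2) ^+ d by rewrite exprn_ge0 //; nra.
have h5 : (1 + 4 * k ^+ 2) ^+ d * (1 - k / 4) <= 1.
  apply: le_trans h1; rewrite ler_wpM2l //; lra.
have h6 : 1 - k / 2 <= (1 - k / 4) * (1 - k / 4) by have := sqr_ge0 k; lra.
apply: le_trans (ler_wpM2l h4 h6) _.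
rewrite mulrA -[X in _ <= X]mul1r ler_wpM2r //; lra.
Qed.

Lemma det_new s M G r : (0 < s)%N -> 0 < r -> (16 * N) ^+ 3 <= s%:R * r ^+ 2 ->
  (forall i j, M i j = M j i) -> 0 < curv M G ->
  (forall y, r ^+ 2 * dot y y <= qf (rshape R s M) y) ->
  (forall y, qf (rshape R s (new_shape M G)) y <= 2 * qf (rshape R s M) y) /\
  \det (rshape R s (new_shape M G)) <= (1 - kap / 4) * \det (rshape R s M).
Proof.
move=> s0 r0 hs h c0 hr.
have sR : 0 < s%:R :> R by rewrite ltr0n.
have cR : 0 < (curv M G)%:~R :> R by rewrite ltr0z.
have NR : 0 < N by rewrite ltr0n.
have sP := rshape_sym R s h.
have hP y : 0 <= qf (rshape R s M) y.
  by apply: le_trans (hr y); rewrite mulr_ge0 ?sqr_ge0 ?dot_ge0.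
have pP y : y != 0 -> 0 < qf (rshape R s M) y.
  by move=> y0; apply: lt_le_trans (hr y); rewrite mulr_gt0 ?exprn_gt0 ?dot_gt0.
have g0 : 0 < qf (rshape R s M) (rdir R G) by rewrite qf_rdir // divr_gt0.
have k0 := kap_gt0; have k1 := kap_le.
set S := shrink (kap / 2) (rshape R s M) (rdir R G).
have b0 : 0 <= kap / 2 by lra.
have hS y : 1 / 2 * qf (rshape R s M) y <= qf S y.
  apply: le_trans (shrink_ge y sP hP g0 b0); rewrite ler_wpM2r //; lra.
have hS' y : qf S y <= qf (rshape R s M) y by apply: shrink_le.
have S0 y : 0 <= qf S y by apply: le_trans (hS y); rewrite mulr_ge0.
have hn y := qf_new_shape y s0 h c0.
(* The diagonal correction [3 N / s] is absorbed by one more [kap ^ 2]: the ball gives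
   [r ^ 2 |y| ^ 2 <= qf P y <= 2 qf S y], and the grid is fine enough for
   [3 N / s <= kap ^ 2 r ^ 2 / 2]. *)
have up y : qf (rshape R s (new_shape M G)) y <= (1 + 4 * kap ^+ 2) * qf S y.
  have /andP[_ h2] := hn y; apply: le_trans h2 _; rewrite -/S.
  have h3 : 3 * N / s%:R * dot y y <= kap ^+ 2 * qf S y.
    apply: le_trans (_ : kap ^+ 2 * (1 / 2 * (r ^+ 2 * dot y y)) <= _); last first.
      rewrite ler_wpM2l ?sqr_ge0 //; apply: le_trans (hS y).
      by rewrite ler_wpM2l.
    have key : 3 * N / s%:R <= kap ^+ 2 * (1 / 2) * r ^+ 2.
      rewrite ler_pdivrMr //.
      have -> : kap ^+ 2 * (1 / 2) * r ^+ 2 * s%:R = s%:R * r ^+ 2 / (512 * N ^+ 2).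
        have : N != 0 by rewrite gt_eqF.
        by rewrite /cut_width; move: (d.+1%:R : R) => n n0; field.
      have n0 : 0 < 512 * N ^+ 2 by apply: mulr_gt0; [rewrite ltr0n|exact: exprn_gt0].
      rewrite (ler_pdivlMr _ _ n0); apply: le_trans hs.
      have -> : 3 * N * (512 * N ^+ 2) = 1536 * N ^+ 3 by ring.
      have : 0 <= N ^+ 3 by rewrite exprn_ge0 // ltW.
      rewrite exprMn; lra.
    by have := ler_wpM2r (dot_ge0 y) key; rewrite !mulrA.
  have := S0 y; lra.
have pn y : y != 0 -> 0 < qf (rshape R s (new_shape M G)) y.
  move=> y0; have /andP[h2 _] := hn y; apply: lt_le_trans h2.
  apply: ltr_wpDl; last by rewrite mulr_gt0 ?divr_gt0 ?dot_gt0.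
  by rewrite mulr_ge0 ?S0 // addr_ge0 // mulr_ge0 ?sqr_ge0.
split.
  move=> y; apply: le_trans (up y) _; apply: ler_pM; rewrite ?S0 ?hS' //; nra.
have sN := rshape_sym R s (new_shape_sym G h).
have sS : ((1 + 4 * kap ^+ 2) *: S)^T = (1 + 4 * kap ^+ 2) *: S.
  by rewrite linearZ /= shrink_sym.
have upS y : qf (rshape R s (new_shape M G)) y <= qf ((1 + 4 * kap ^+ 2) *: S) y.
  by rewrite (qf_scale _ S).
have [_ hdet] := det_mono sN sS pn upS.
apply: le_trans hdet _; rewrite detZ det_shrink ?gt_eqF //.
have [detP _] := det_mono sP sP pP (fun y => lexx _).
rewrite mulrCA mulrC ler_wpM2r ?(ltW detP) //.
exact: pow_kap_le.
Qed.

Lemma det_ball_ge (P : 'M[R]_d) r : 0 < r -> P^T = P ->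
  (forall y, r ^+ 2 * dot y y <= qf P y) -> (r ^+ 2) ^+ d <= \det P.
Proof.
move=> r0 sP hP.
have q y : qf (r ^+ 2)%:M y = r ^+ 2 * dot y y by rewrite /qf mul_mx_scalar dotZl.
have [] // := @det_mono R d (r ^+ 2)%:M P (tr_scalar_mx _ _) sP.
- by move=> y y0; rewrite q mulr_gt0 ?exprn_gt0 ?dot_gt0.
- by move=> y; rewrite q.
by rewrite det_scalar.
Qed.
End Step.

(** * The program *)

Local Notation "p ;; q" := (Seq p q) (at level 55, right associativity).

(* The integers [centre] and [quad] are the centre and the matrix of the
   ellipsoid multiplied by [grid]. *)
Record state (d : nat) := State {
  centre : 'I_d -> int;
  quad : 'I_d -> 'I_d -> int;
  grid : int;
  tol_num : int;
  tol_den : int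
}.

Definition dvec d (v : 'I_d -> int) := dfun (fun i => Int (v i)).
Definition dmat d (M : 'I_d -> 'I_d -> int) := dfun (fun i => dvec (M i)).
Definition dfrac d (c : 'I_d -> int * int) := dfun (fun i => Pair (Int (c i).1) (Int (c i).2)).

Definition dconst d (x : state d) :=
  Pair (dfun (fun i : 'I_d => Int i))
    (Pair (Int d.+1) (Pair (Int (grid x)) (Pair (Int (tol_num x)) (Int (tol_den x))))).

Definition dstate d (x : state d) :=
  Pair (dvec (centre x)) (Pair (dmat (quad x)) (dconst x)).

Definition common_den d (c : 'I_d -> int * int) : int := \prod_i (c i).2.

(** A cut depends on its normal only up to a positive factor, so the answers of the oracles are
    scaled to integer vectors by the product of their denominators. *)
Definition direction d (c : 'I_d -> int * int) (i : 'I_d) : int :=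
  (c i).1 * (common_den c %/ (c i).2)%Z.

Lemma computes_fork_zip (T : nat -> Type) (ok : forall d, oracles d -> T d -> nat -> Prop) p q
    (inp : forall d, T d -> data) (F H : forall d, T d -> 'I_d -> data) :
  computes ok p inp (fun d x => dfun (F d x)) -> computes ok q inp (fun d x => dfun (H d x)) ->
  computes ok (Fork p q ;; ZipP) inp (fun d x => dfun (fun i => Pair (F d x i) (H d x i))).
Proof.
move=> hp hq.
apply: (@computes_seq _ _ _ _ _ (fun d x => Pair (dfun (F d x)) (dfun (H d x)))).
  exact: computes_fork.
exact: computes_zip.
Qed.

Section Cut.
Definition cut_type d : Type := state d * ('I_d -> int * int).
(** Bounds the argument of [SqrtP], whose number of turns is governed by its bit length. *)
Definition cut_ok d (O : oracles d) (x : cut_type d) (n : nat) :=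
  (data_size (Int (curv (quad x.1) (direction x.2) * grid x.1)%R) <= n)%N.

Let G d (x : cut_type d) := direction x.2.
Let V d (x : cut_type d) := mulv (quad x.1) (G x).
Let Gam d (x : cut_type d) := curv (quad x.1) (G x).
Let D d (x : cut_type d) := common_den x.2.

Definition DenP := Fork Skip (Const 0) ;; MapP (Fst ;; Snd) ;; BigP 1 Mul.

Lemma computes_den (T : nat -> Type) (ok : forall d, oracles d -> T d -> nat -> Prop)
  (c : forall d, T d -> 'I_d -> int * int) :
  computes ok DenP (fun d x => dfrac (c d x)) (fun d x => Int (common_den (c d x))).
Proof.
apply: (@computes_seq _ _ _ _ _ (fun d x => Pair (dfrac (c d x)) (Int 0))).
  exact: computes_eval.
apply: (@computes_seq _ _ _ _ _ (fun d x => dvec (fun i => (c d x i).2))).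
  by apply: (computes_map (env := fun _ _ => Int 0)); apply: computes_eval.
exact: computes_prod.
Qed.

Definition RowDotP := ZipP ;; Fork Skip (Const 0) ;; MapP (Fst ;; Mul) ;; BigP 0 Add.

Lemma computes_rowdot (T : nat -> Type) (ok : forall d, oracles d -> T d -> nat -> Prop)
  (u v : forall d, T d -> 'I_d -> int) :
  computes ok RowDotP (fun d x => Pair (dvec (u d x)) (dvec (v d x)))
    (fun d x => Int (\sum_i u d x i * v d x i)).
Proof.
pose z d (x : T d) i := Pair (Int (u d x i)) (Int (v d x i)).
apply: (@computes_seq _ _ _ _ _ (fun d x => dfun (z d x))).
  exact: computes_zip.
apply: (@computes_seq _ _ _ _ _ (fun d x => Pair (dfun (z d x)) (Int 0))).
  exact: computes_eval.
apply: (@computes_seq _ _ _ _ _ (fun d x => dvec (fun i => u d x i * v d x i))).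
  by apply: (computes_map (env := fun _ _ => Int 0)); apply: computes_eval.
exact: computes_sum.
Qed.

Definition DirectionP :=
  Fork Skip DenP ;; MapP (Fork (Fst ;; Fst) (Fork Snd (Fst ;; Snd) ;; Div) ;; Mul).

Lemma computes_direction (T : nat -> Type) (ok : forall d, oracles d -> T d -> nat -> Prop)
  (c : forall d, T d -> 'I_d -> int * int) :
  computes ok DirectionP (fun d x => dfrac (c d x)) (fun d x => dvec (direction (c d x))).
Proof.
apply: (@computes_seq _ _ _ _ _ (fun d x => Pair (dfrac (c d x)) (Int (common_den (c d x))))).
  by apply: computes_fork (computes_den _ _); apply: computes_eval.
by apply: computes_map; apply: computes_eval.
Qed.

(* from [(cut, state)] to [(curvature, (V, (D, state)))] *)
Definition PrepareP :=
  Fork (Fst ;; DirectionP) (Fork (Fst ;; DenP) Snd) ;;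
  Fork (Fork (Snd ;; Snd ;; Snd ;; Fst) Fst ;; MapP RowDotP) Skip ;;
  Fork (Fork Fst (Snd ;; Fst) ;; RowDotP) (Fork Fst (Snd ;; Snd)).

Lemma computes_prepare : computes cut_ok PrepareP
  (fun d x => Pair (dfrac x.2) (dstate x.1))
  (fun d x => Pair (Int (Gam x)) (Pair (dvec (V x)) (Pair (Int (D x)) (dstate x.1)))).
Proof.
apply: (@computes_seq _ _ _ _ _
  (fun d x => Pair (dvec (G x)) (Pair (Int (D x)) (dstate x.1)))).
  apply: computes_fork; last apply: computes_fork.
  - apply: (@computes_seq _ _ _ _ _ (fun d x => dfrac x.2)); first exact: computes_eval.
    exact: computes_direction.
  - apply: (@computes_seq _ _ _ _ _ (fun d x => dfrac x.2)); first exact: computes_eval.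
    exact: computes_den.
  - exact: computes_eval.
apply: (@computes_seq _ _ _ _ _
  (fun d x => Pair (dvec (V x)) (Pair (dvec (G x)) (Pair (Int (D x)) (dstate x.1))))).
  apply: computes_fork; last exact: computes_eval.
  apply: (@computes_seq _ _ _ _ _ (fun d x => Pair (dmat (quad x.1)) (dvec (G x)))).
    exact: computes_eval.
  apply: computes_map.
  exact: (computes_rowdot _ (fun d x => quad x.1.1 x.2) (fun d x => G x.1)).
apply: computes_fork; last exact: computes_eval.
apply: (@computes_seq _ _ _ _ _ (fun d x => Pair (dvec (V x)) (dvec (G x)))).
  exact: computes_eval.
exact: computes_rowdot.
Qed.

(* from [((a, v), (s, q))] to [a - (s * v) %/ q] *)
Definition CenterEntryP :=
  Fork (Fst ;; Fst) (Fork (Fork (Snd ;; Fst) (Fst ;; Snd) ;; Mul) (Snd ;; Snd) ;; Div) ;; Defs.Sub.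

(* from [((m, (j, vj)), ((i, vi), (N, gam)))] to the new entry of the matrix *)
Definition ShapeEntryP :=
  let m := Fst ;; Fst in let j := Fst ;; Snd ;; Fst in let vj := Fst ;; Snd ;; Snd in
  let i := Snd ;; Fst ;; Fst in let vi := Snd ;; Fst ;; Snd in
  let N := Snd ;; Snd ;; Fst in let gam := Snd ;; Snd ;; Snd in
  let mul p q := Fork p q ;; Mul in
  let NN := mul (Const 256) (mul N N) in
  let Ng := mul (mul (Const 32) N) gam in
  Fork
    (Fork (mul (Fork NN (Const 3) ;; Add) (Fork (mul Ng m) (mul vi vj) ;; Defs.Sub)) (mul NN Ng) ;; Div)
    (If (Fork i j ;; Defs.Sub) (Const 0)
       (If (Fork j i ;; Defs.Sub) (Const 0) (mul (Const 2) N))) ;; Add.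

Definition next_state d (x : cut_type d) : state d :=
  State (new_center (grid x.1) (centre x.1) (quad x.1) (G x)) (new_shape (quad x.1) (G x))
    (grid x.1) (tol_num x.1) (tol_den x.1).

(* from [(curvature, (V, (D, (A, (M, (ix, (N, (s, tol)))))))] to [(1, next state)] *)
Definition UpdateP :=
  let gam := Fst in let V := Snd ;; Fst in let st := Snd ;; Snd ;; Snd in
  let A := st ;; Fst in let M := st ;; Snd ;; Fst in let cst := st ;; Snd ;; Snd in
  let ix := cst ;; Fst in let N := cst ;; Snd ;; Fst in let s := cst ;; Snd ;; Snd ;; Fst in
  let mul p q := Fork p q ;; Mul in
  Fork (Const 1)
    (Fork
      (Fork (Fork A V ;; ZipP) (Fork s (mul (mul (Const 16) N) (mul gam s ;; SqrtP)))
         ;; MapP CenterEntryP)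
      (Fork
        (Fork (Fork M (Fork ix V ;; ZipP) ;; ZipP) (Fork (Fork ix V ;; ZipP) (Fork N gam)) ;;
         MapP (Fork (Fork (Fst ;; Fst) (Snd ;; Fst) ;; ZipP) (Fork (Fst ;; Snd) (Snd ;; Snd))
           ;; MapP ShapeEntryP))
        cst)).

Lemma eval_center_entry a v s q :
  eval CenterEntryP (Pair (Pair (Int a) (Int v)) (Pair (Int s) (Int q))) =
  Some (Int (a - (s * v %/ q)%Z)).
Proof. by []. Qed.

(** [If] tests positivity only, so the diagonal is recognized by neither of the differences [i - j]
    and [j - i] being positive. *)
Lemma eval_shape_entry d m vi vj gam (i j : 'I_d) :
  eval ShapeEntryP (Pair (Pair (Int m) (Pair (Int j) (Int vj)))
    (Pair (Pair (Int i) (Int vi)) (Pair (Int d.+1) (Int gam)))) =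
  Some (Int ((((256 * (d.+1%:Z * d.+1%:Z) + 3) * (32 * d.+1%:Z * gam * m - vi * vj))
     %/ (256 * (d.+1%:Z * d.+1%:Z) * (32 * d.+1%:Z * gam)))%Z +
     (if i == j then 2 * d.+1%:Z else 0))).
Proof.
rewrite /=; have [->|ij] := eqVneq i j; first by rewrite !subrr.
have : (i != j :> nat) by [].
by rewrite !subr_gt0 !ltz_nat; case: ltngtP.
Qed.

Lemma computes_update : computes cut_ok UpdateP
  (fun d x => Pair (Int (Gam x)) (Pair (dvec (V x)) (Pair (Int (D x)) (dstate x.1))))
  (fun d x => Pair (Int 1) (dstate (next_state x))).
Proof.
apply: computes_fork; first exact: computes_eval.
apply: computes_fork; last apply: computes_fork; last exact: computes_eval.
- apply: (@computes_seq _ _ _ _ _ (fun d x =>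
    Pair (dfun (fun i => Pair (Int (centre x.1 i)) (Int (V x i))))
      (Pair (Int (grid x.1)) (Int (16 * d.+1%:Z * sqrt_pow2 (Gam x * grid x.1)))))).
    apply: computes_fork.
      by apply: computes_fork_zip; apply: computes_eval.
    apply: computes_fork; first exact: computes_eval.
    apply: (@computes_seq _ _ _ _ _
      (fun d x => Pair (Int (16 * d.+1%:Z)) (Int (sqrt_pow2 (Gam x * grid x.1))))).
      apply: computes_fork; first exact: computes_eval.
      apply: (@computes_seq _ _ _ _ _ (fun d x => Int (Gam x * grid x.1))).
        exact: computes_eval.
      exact: computes_sqrt.
    exact: computes_eval.
  apply: (@computes_eq _ _ _ _ _ (fun d x => dfun (fun i => Int (new_center (grid x.1) (centre x.1) (quad x.1) (G x) i)))) => //.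
  apply: computes_map; apply: computes_eval => d x; exact: eval_center_entry.
- apply: (@computes_seq _ _ _ _ _ (fun d x =>
    Pair (dfun (fun i => Pair (dvec (quad x.1 i)) (Pair (Int i) (Int (V x i)))))
      (Pair (dfun (fun i => Pair (Int i) (Int (V x i)))) (Pair (Int d.+1) (Int (Gam x)))))).
    apply: computes_fork.
      apply: computes_fork_zip; first exact: computes_eval.
      by apply: computes_fork_zip; apply: computes_eval.
    apply: computes_fork; last exact: computes_eval.
    by apply: computes_fork_zip; apply: computes_eval.
  apply: computes_map.
  apply: (@computes_seq _ _ _ _ _ (fun d x =>
    Pair (dfun (fun j => Pair (Int (quad x.1.1 x.2 j)) (Pair (Int j) (Int (V x.1 j)))))
      (Pair (Pair (Int x.2) (Int (V x.1 x.2))) (Pair (Int d.+1) (Int (Gam x.1)))))).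
    apply: computes_fork; last exact: computes_eval.
    by apply: computes_fork_zip; apply: computes_eval.
  apply: computes_map; apply: computes_eval => d x.
  exact: eval_shape_entry.
Qed.
End Cut.

Definition query d (x : state d) : 'rV[rat]_d := \row_i ((centre x i)%:~R / (grid x)%:~R).

(** The fractions share the denominator [grid x] and are left unreduced, which spares the program a
    gcd. *)
Definition dquery d (x : state d) := dfrac (fun i => (centre x i, grid x)).

Definition fractions d (c : 'rV[rat]_d) (i : 'I_d) := (numq (c 0 i), denq (c 0 i)).

Lemma data_of_fractionsE s :
  data_of_fractions s = dlist [seq Pair (Int p.1) (Int p.2) | p <- s].
Proof. by elim: s => //= p s ->. Qed.

Lemma data_of_vecE d (c : 'rV[rat]_d) : data_of_vec c = dfrac (fractions c).
Proof.
rewrite /data_of_vec /data_of_rats data_of_fractionsE -2!map_comp /dfrac /dfun.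
by congr dlist; apply: eq_map.
Qed.

Lemma represents_query d (x : state d) : 0 < grid x -> represents (dquery x) (query x).
Proof.
move=> s0; exists [seq (centre x i, grid x) | i <- enum 'I_d]; split.
- by rewrite data_of_fractionsE -map_comp.
- by rewrite all_map; apply/allP.
- by rewrite -map_comp; apply: eq_map => i; rewrite mxE.
Qed.

(** [MapP Skip] pairs each entry with the environment, here the grid. *)
Definition QueryP := Fork Fst (Snd ;; Snd ;; Snd ;; Snd ;; Fst) ;; MapP Skip.

Lemma computes_query (T : nat -> Type) (ok : forall d, oracles d -> T d -> nat -> Prop)
  (x : forall d, T d -> state d) :
  computes ok QueryP (fun d t => dstate (x d t)) (fun d t => dquery (x d t)).
Proof.
apply: (@computes_seq _ _ _ _ _
  (fun d t => Pair (dvec (centre (x d t))) (Int (grid (x d t))))).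
  exact: computes_eval.
by apply: computes_map; apply: computes_eval.
Qed.

(* The centre is accepted when this is nonpositive, that is, when the squared width
   of the ellipsoid along the gradient is at most [tol_num / tol_den]. *)
Definition gap d (x : cut_type d) : int :=
  curv (quad x.1) (direction x.2) * tol_den x.1
  - grid x.1 * (common_den x.2 * common_den x.2) * tol_num x.1.

Definition prepared d (x : cut_type d) : data :=
  Pair (Int (curv (quad x.1) (direction x.2)))
    (Pair (dvec (mulv (quad x.1) (direction x.2)))
      (Pair (Int (common_den x.2)) (dstate x.1))).

Definition GapP :=
  let gam := Fst in let D := Snd ;; Snd ;; Fst in
  let cst := Snd ;; Snd ;; Snd ;; Snd ;; Snd in
  let s := cst ;; Snd ;; Snd ;; Fst in let tol := cst ;; Snd ;; Snd ;; Snd in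
  let mul p q := Fork p q ;; Mul in
  Fork (mul gam (tol ;; Snd)) (mul (mul s (mul D D)) (tol ;; Fst)) ;; Defs.Sub.

(** The first component of an answer of [AskSep] is 1 for membership and 0 otherwise, so it serves
    as the test. The flag in the result drives the outer loop: 1 after a cut, 0 when the centre is
    accepted and the state kept. *)
Definition IterateP :=
  Fork (QueryP ;; AskSep) Skip ;;
  If (Fst ;; Fst)
    (Fork (Snd ;; QueryP ;; AskGrad) Snd ;; PrepareP ;;
       If GapP UpdateP (Fork (Const 0) (Snd ;; Snd ;; Snd)))
    (Fork (Fst ;; Snd) Snd ;; PrepareP ;; UpdateP).

Definition iterate d (O : oracles d) (x : state d) : int * state d :=
  if sep O (query x) is Some c then (1, next_state (x, fractions c))
  else let y := (x, fractions (grad O (query x))) in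
    if 0 < gap y then (1, next_state y) else (0, x).

Definition run_type d : Type := oracles d * state d.

(* The oracles appear among the data [x] so that the results of a program may
   depend on them. *)
Definition iterate_ok d (O : oracles d) (x : run_type d) (n : nat) :=
  [/\ x.1 = O, 0 < grid x.2, (data_size (dquery x.2) <= n)%N,
      (data_size (data_of_answer (sep O (query x.2))) <= n)%N &
    if sep O (query x.2) is Some c then cut_ok O (x.2, fractions c) n
    else [/\ cut_ok O (x.2, fractions (grad O (query x.2))) n,
       (data_size (data_of_vec (grad O (query x.2))) <= n)%N &
       (grad_time O (query x.2) <= n)%N]].

Lemma computes_iterate : computes iterate_ok IterateP (fun d x => dstate x.2)
  (fun d x => Pair (Int (iterate x.1 x.2).1) (dstate (iterate x.1 x.2).2)).
Proof.
pose ans d (x : run_type d) := sep x.1 (query x.2).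
pose member d (x : run_type d) : int := if ans d x is Some _ then 0 else 1.
apply: (@computes_seq _ _ _ _ _ (fun d x => Pair (data_of_answer (ans d x)) (dstate x.2))).
  apply: computes_fork; last exact: computes_eval.
  apply: (@computes_seq _ _ _ _ _ (fun d x => dquery x.2)); first exact: computes_query.
  exists 1%N => d O [Q x] n hn [] /= -> s0 hq ha _.
  eexists; first exact: run_sep (represents_query s0).
  by move: ha; rewrite expn1 /ans /=; have := data_size_ge2 (dquery x); nia.
apply: (computes_if (z := member)).
- by apply: computes_eval => d x; rewrite /member; case: (ans d x).
- pose g d (x : run_type d) := fractions (grad x.1 (query x.2)).
  pose y d (x : run_type d) : cut_type d := (x.2, g d x).
  have gok d (O : oracles d) (x : run_type d) n :
      iterate_ok O x n /\ 0 < member d x -> cut_ok O (y d x) n.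
    case: x => Q x [[] /= -> _ _ _]; rewrite /member /ans /=.
    by case: (sep O (query x)) => // -[].
  apply: (@computes_seq _ _ _ _ _ (fun d x => Pair (dfrac (g d x)) (dstate x.2))).
    apply: computes_fork; last exact: computes_eval.
    apply: (@computes_seq _ _ _ _ _ (fun d x => dstate x.2)); first exact: computes_eval.
    apply: (@computes_seq _ _ _ _ _ (fun d x => dquery x.2)); first exact: computes_query.
    exists 2%N => d O [Q x] n hn [[] /= -> s0 hq _]; rewrite /member /ans /=.
    case: (sep O (query x)) => // -[_ hg ht] _.
    rewrite /g -data_of_vecE /=.
    eexists; first exact: run_grad (represents_query s0).
    by have := data_size_ge2 (dquery x); nia.
  apply: (@computes_seq _ _ _ _ _ (fun d x => prepared (y d x))).
    by apply: (computes_comp (h := y) _ computes_prepare) => d O x n /gok.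
  apply: (computes_if (z := fun d x => gap (y d x))).
  - exact: computes_eval.
  - apply: (computes_eq (inp := fun d x => prepared (y d x))
      (out := fun d x => Pair (Int 1) (dstate (next_state (y d x))))) => //.
      move=> d O [Q x] n [[_]]; rewrite /member /iterate /ans /y /g /=.
      by case: (sep Q (query x)) => // _ ->.
    by apply: (computes_comp (h := y) _ computes_update) => d O x n [/gok].
  - apply: (computes_eq (inp := fun d x => prepared (y d x))
      (out := fun d x => Pair (Int 0) (dstate x.2))) => //; last exact: computes_eval.
    move=> d O [Q x] n [[_]]; rewrite /member /iterate /ans /y /g /=.
    by case: (sep Q (query x)) => // _; rewrite ltNge => ->.
(* The default [(0, 0)] only makes [c] total: in this branch the oracle has returned a vector. *)
- pose c d (x : run_type d) := if ans d x is Some c then fractions c else fun=> (0, 0).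
  pose y d (x : run_type d) : cut_type d := (x.2, c d x).
  have cok d (O : oracles d) (x : run_type d) n :
      iterate_ok O x n /\ member d x <= 0 -> cut_ok O (y d x) n.
    case: x => Q x [[] /= -> _ _ _]; rewrite /member /y /c /ans /=.
    by case: (sep O (query x)).
  apply: (@computes_seq _ _ _ _ _ (fun d x => Pair (dfrac (c d x)) (dstate x.2))).
    apply: (computes_eq (inp := fun d x => Pair (Pair (Int 0) (dfrac (c d x))) (dstate x.2))
      (out := fun d x => Pair (dfrac (c d x)) (dstate x.2))) => //; last exact: computes_eval.
    move=> d O [Q x] n [_]; rewrite /member /c /ans /=.
    by case: (sep Q (query x)) => // a; rewrite /= data_of_vecE.
  apply: (@computes_seq _ _ _ _ _ (fun d x => prepared (y d x))).
    by apply: (computes_comp (h := y) _ computes_prepare) => d O x n /cok.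
  apply: (computes_eq (inp := fun d x => prepared (y d x))
      (out := fun d x => Pair (Int 1) (dstate (next_state (y d x))))) => //.
    move=> d O [Q x] n [_]; rewrite /member /iterate /y /c /ans /=.
    by case: (sep Q (query x)).
  by apply: (computes_comp (h := y) _ computes_update) => d O x n /cok.
Qed.

(** * The constants of the method and the initial state *)

Section Init.
Variable k : nat.

(* an upper bound on the radius of the domain *)
Definition dom_radius d : int := k.+1%:Z * d.+1%:Z ^+ k.

(* an integer above [B / (lam * eps)] *)
Definition condition (lam eps B : rat) : int :=
  ((numq B * (denq lam * denq eps)) %/ (denq B * (numq lam * numq eps)))%Z + 1.

(* the inverse of the radius of the ball that no cut removes *)
Definition inv_margin d (lam eps B : rat) : int :=
  256 * d.+1%:Z * (dom_radius d * condition lam eps B).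

(* fine enough for the rounding errors of one step to be small compared with the
   ball that no cut removes *)
Definition init_scale d (lam eps B : rat) : int :=
  (16 * d.+1%:Z) ^+ 3 * inv_margin d lam eps B ^+ 2.

(** The ball of radius [dom_radius] about the origin. The tolerance is stored as the fraction
    [(lam * eps / 2) ^ 2], squared because widths are compared without taking roots. *)
Definition init_state d (p : rat * rat * rat * rat) : state d :=
  let: (lam, eps, L, B) := p in
  State (fun=> 0)
    (fun i j => if i == j then init_scale d lam eps B * dom_radius d ^+ 2 else 0)
    (init_scale d lam eps B) ((numq lam * numq eps) ^+ 2) ((2 * (denq lam * denq eps)) ^+ 2).

Definition MulP p q := Fork p q ;; Mul.

Lemma eval_mul p q v a b : eval p v = Some (Int a) -> eval q v = Some (Int b) ->
  eval (MulP p q) v = Some (Int (a * b)).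
Proof. by move=> /= -> ->. Qed.

Lemma eval_fork p q v a b : eval p v = Some a -> eval q v = Some b ->
  eval (Fork p q) v = Some (Pair a b).
Proof. by move=> /= -> ->. Qed.

Fixpoint PowerP (p : prog) m : prog := if m is m'.+1 then MulP p (PowerP p m') else Const 1.

Lemma eval_power p m v z : eval p v = Some (Int z) -> eval (PowerP p m) v = Some (Int (z ^+ m)).
Proof. by move=> h; elim: m => //= m ->; rewrite h /= exprS. Qed.

Definition NP := Fork Fst (Const 1) ;; Add.
Definition lamP := Snd ;; Fst.
Definition epsP := Snd ;; Snd ;; Fst.
Definition BP := Snd ;; Snd ;; Snd ;; Snd ;; Fst.
Definition numP := MulP (lamP ;; Fst) (epsP ;; Fst).
Definition denP := MulP (lamP ;; Snd) (epsP ;; Snd).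
Definition radiusP := MulP (Const k.+1) (PowerP NP k).
Definition conditionP :=
  Fork (Fork (MulP (BP ;; Fst) denP) (MulP (BP ;; Snd) numP) ;; Div) (Const 1) ;; Add.
Definition inv_marginP := MulP (MulP (Const 256) NP) (MulP radiusP conditionP).
Definition scaleP := MulP (PowerP (MulP (Const 16) NP) 3) (PowerP inv_marginP 2).

Definition ScalarsP :=
  Fork (MulP scaleP (PowerP radiusP 2))
    (Fork NP (Fork scaleP (Fork (PowerP numP 2) (PowerP (MulP (Const 2) denP) 2)))).

Definition InitP :=
  Fork (Fst ;; IotaP) ScalarsP ;;
  Fork (Const 1)
    (Fork (MapP (Const 0))
      (Fork
        (Fork Fst (Fork Fst (Snd ;; Fst)) ;;
         MapP (Fork (Snd ;; Fst) (Fork Fst (Snd ;; Snd)) ;;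
           MapP (If (Fork Fst (Snd ;; Fst) ;; Defs.Sub) (Const 0)
             (If (Fork (Snd ;; Fst) Fst ;; Defs.Sub) (Const 0) (Snd ;; Snd)))))
        (Fork Fst (Snd ;; Snd)))).

Definition init_ok d (O : oracles d) (p : rat * rat * rat * rat) (n : nat) := True.

Lemma eval_scalars d (p : rat * rat * rat * rat) : let: (lam, eps, L, B) := p in
  eval ScalarsP (algorithm_input d lam eps L B) =
  Some (Pair (Int (init_scale d lam eps B * dom_radius d ^+ 2))
    (Pair (Int d.+1) (Pair (Int (init_scale d lam eps B))
      (Pair (Int ((numq lam * numq eps) ^+ 2)) (Int ((2 * (denq lam * denq eps)) ^+ 2)))))).
Proof.
case: p => [[[lam eps] L] B].
set v := algorithm_input _ _ _ _ _.
have eN : eval NP v = Some (Int d.+1%:Z) by rewrite /= -PoszD addn1.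
have er : eval radiusP v = Some (Int (dom_radius d)).
  by apply: eval_mul => //; apply: eval_power.
have en : eval numP v = Some (Int (numq lam * numq eps)) by [].
have ed : eval denP v = Some (Int (denq lam * denq eps)) by [].
have ec : eval conditionP v = Some (Int (condition lam eps B)) by [].
have ei : eval inv_marginP v = Some (Int (inv_margin d lam eps B)).
  by apply: eval_mul; apply: eval_mul.
have es : eval scaleP v = Some (Int (init_scale d lam eps B)).
  apply: eval_mul; apply: eval_power => //.
  exact: eval_mul.
have e1 : eval (MulP scaleP (PowerP radiusP 2)) v =
    Some (Int (init_scale d lam eps B * dom_radius d ^+ 2)).
  by apply: eval_mul => //; apply: eval_power.
have e2 : eval (PowerP numP 2) v = Some (Int ((numq lam * numq eps) ^+ 2)) by apply: eval_power.
have e3 : eval (PowerP (MulP (Const 2) denP) 2) v = Some (Int ((2 * (denq lam * denq eps)) ^+ 2)).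
  by apply: eval_power; apply: eval_mul.
by do 4![apply: eval_fork => //].
Qed.

Lemma computes_init :
  computes init_ok InitP
    (fun d p => let: (lam, eps, L, B) := p in algorithm_input d lam eps L B)
    (fun d p => Pair (Int 1) (dstate (init_state d p))).
Proof.
pose x0 d (p : rat * rat * rat * rat) := init_state d p.
pose diag d (p : rat * rat * rat * rat) : int :=
  let: (lam, eps, L, B) := p in init_scale d lam eps B * dom_radius d ^+ 2.
pose ix d := dfun (fun i : 'I_d => Int i).
pose rest d p := (Pair (Int d.+1) (Pair (Int (grid (x0 d p)))
   (Pair (Int (tol_num (x0 d p))) (Int (tol_den (x0 d p)))))).
apply: (@computes_seq _ _ _ _ _ (fun d p => Pair (ix d) (Pair (Int (diag d p)) (rest d p)))).
  apply: computes_fork.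
    apply: (@computes_seq _ _ _ _ _ (fun d p => Int d)); last exact: computes_iota.
    by apply: computes_eval => d [[[lam eps] L] B].
  by apply: computes_eval => d p; have := eval_scalars d p; case: p => [[[lam eps] L] B].
apply: computes_fork; first exact: computes_eval.
apply: (computes_fork (out2 := fun d p => Pair (dmat (quad (x0 d p))) (dconst (x0 d p)))).
  apply: (computes_eq (inp := fun d p => Pair (ix d) (Pair (Int (diag d p)) (rest d p)))
    (out := fun d p => dfun (fun i : 'I_d => Int 0))) => //.
    by move=> d O [[[lam eps] L] B].
  by apply: computes_map; apply: computes_eval.
apply: computes_fork; last exact: computes_eval.
apply: (@computes_seq _ _ _ _ _ (fun d p => Pair (ix d) (Pair (ix d) (Int (diag d p))))).
  exact: computes_eval.
apply: computes_map.
apply: (@computes_seq _ _ _ _ _ (fun d (p : rat * rat * rat * rat * 'I_d) =>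
    Pair (ix d) (Pair (Int p.2) (Int (diag d p.1))))).
  exact: computes_eval.
apply: computes_map.
apply: computes_eval => d [[p i] j] /=.
have -> : quad (x0 d p) i j = if i == j then diag d p else 0.
  by rewrite /x0 /diag; case: p => [[[lam eps] L] B].
have [->|ij] := eqVneq i j; first by rewrite !subrr.
have : (i != j :> nat) by [].
by rewrite !subr_gt0 !ltz_nat; case: ltngtP.
Qed.
End Init.

(** The exponent [k] of the bound on the radius of the domain is built into the program. *)
Definition EllipsoidP k := InitP k ;; While Fst (Snd ;; IterateP) ;; Snd ;; QueryP.

(** * Correctness of the search *)

Lemma convex_setP (R : realType) d (X : set 'rV[R]_d) (t : R) x y : convex_set X ->
  0 <= t -> t <= 1 -> X x -> X y -> X (t *: x + (1 - t) *: y).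
Proof.
move=> cX t0 t1 xX yX.
have := cX x y (Itv01 t0 t1); rewrite !inE => /(_ xX yX).
by [].
Qed.

Lemma direction_fractions (R : realType) d (c : 'rV[rat]_d) :
  rdir R (direction (fractions c)) = (common_den (fractions c))%:~R *: rvec R c.
Proof.
apply/rowP => i; rewrite !mxE /direction /= /ratr.
set D := common_den _; set q := denq (c 0 i).
have q0 : q != 0 by rewrite denq_eq0.
have dvd : (q %| D)%Z by rewrite /D /common_den (bigD1 i) //=; exact: dvdz_mulr.
have e : D%:~R = (D %/ q)%Z%:~R * q%:~R :> R by rewrite -intrM divzK.
rewrite e rmorphM /=; field.
by rewrite intr_eq0.
Qed.

Lemma common_den_gt0 d (c : 'rV[rat]_d) : 0 < common_den (fractions c).
Proof. by apply: prodr_gt0 => i _; exact: denq_gt0. Qed.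

Lemma rvec_query (R : realType) d (x : state d) s : grid x = s%:Z ->
  rvec R (query x) = rcenter R s (centre x).
Proof.
by move=> sE; apply/rowP => i; rewrite !mxE sE fmorph_div /= !ratr_int.
Qed.

Lemma rvec_eq0 (R : realType) d (c : 'rV[rat]_d) : (rvec R c == 0) = (c == 0).
Proof.
apply/eqP/eqP => [h|->]; last by apply/rowP => i; rewrite !mxE rmorph0.
apply/rowP => i; move/rowP/(_ i): h; rewrite !mxE => /eqP.
by rewrite fmorph_eq0 => /eqP.
Qed.

Lemma dom_radius_ge1 k d : 1 <= dom_radius k d.
Proof.
have h : 1 <= d.+1%:Z ^+ k by rewrite exprn_ege1.
have : 1 <= k.+1%:Z by [].
rewrite /dom_radius; nia.
Qed.

Lemma dom_radius_bound (R : realType) k d : poly_bound k d%:R <= (dom_radius k d)%:~R :> R.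
Proof.
rewrite /poly_bound /dom_radius rmorphM rmorphXn /=.
rewrite -[(k.+1%:Z)%:~R]/(k.+1%:R) -[(d.+1%:Z)%:~R]/(d.+1%:R) nat1r.
by rewrite ler_wpM2r ?exprn_ge0 // ler_nat.
Qed.

Section Condition.
Variables (R : realType) (k d : nat) (lam eps B : rat).
Hypotheses (lam0 : 0 < lam) (eps0 : 0 < eps) (B0 : 0 < B).

Lemma condition_bounds :
  ratr B / (ratr lam * ratr eps) <= ((condition lam eps B)%:~R : R)
    <= ratr B / (ratr lam * ratr eps) + 1.
Proof.
have nl : 0 < (numq lam)%:~R :> R by rewrite ltr0z numq_gt0.
have ne : 0 < (numq eps)%:~R :> R by rewrite ltr0z numq_gt0.
have dl : 0 < (denq lam)%:~R :> R by rewrite ltr0z denq_gt0.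
have de : 0 < (denq eps)%:~R :> R by rewrite ltr0z denq_gt0.
have db : 0 < (denq B)%:~R :> R by rewrite ltr0z denq_gt0.
set a := numq B * (denq lam * denq eps).
set b := denq B * (numq lam * numq eps).
have b0 : 0 < b by rewrite /b !mulr_gt0 ?denq_gt0 ?numq_gt0.
have -> : ratr B / (ratr lam * ratr eps) = a%:~R / b%:~R :> R.
  by rewrite /ratr /a /b !rmorphM /=; field; rewrite ?gt_eqF.
have /andP[h h'] := divz_round R a b0.
by rewrite /condition -/a -/b rmorphD /=; apply/andP; split; lra.
Qed.

Lemma condition_ge1 : 1 <= condition lam eps B.
Proof.
rewrite /condition lerDr divz_ge0 ?mulr_gt0 ?denq_gt0 ?numq_gt0 //.
by rewrite mulr_ge0 ?mulr_ge0 ?denq_ge0 // numq_ge0 ltW.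
Qed.

Lemma inv_margin_ge1 : 256 <= inv_margin k d lam eps B.
Proof.
have := condition_ge1; have := dom_radius_ge1 k d; rewrite /inv_margin => h1 h2.
have : 1 <= d.+1%:Z by [].
have : 1 <= dom_radius k d * condition lam eps B by nia.
move: (dom_radius k d * _) => u; nia.
Qed.

(** The lower bound is the one that [in_ellipsoid_new] asks of the grid. *)
Lemma init_scale_ge : exists2 s : nat, init_scale k d lam eps B = s%:Z &
  (512 * d.+1 ^ 2 + 1 <= s)%N.
Proof.
have h := inv_margin_ge1.
exists ((16 * d.+1) ^ 3 * `|inv_margin k d lam eps B| ^ 2)%N.
  have eX (a n : nat) : (a ^ n)%N%:Z = a%:Z ^+ n by rewrite -!natz natrX.
  rewrite /init_scale PoszM !eX PoszM gez0_abs //; lia.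
have : (256 <= `|inv_margin k d lam eps B|)%N by lia.
move: `|_|%N => q hq.
apply: leq_trans (_ : (16 * d.+1) ^ 3 * 1 <= _)%N; last first.
  by rewrite leq_mul2l expn_gt0; lia.
rewrite muln1 expnMn (_ : (16 ^ 3 = 4096)%N) //.
have : (d.+1 ^ 2 <= d.+1 ^ 3)%N by rewrite leq_pexp2l.
have : (0 < d.+1 ^ 2)%N by rewrite expn_gt0.
lia.
Qed.
End Condition.

(** With [m = 64 (d + 1)], [m] cuts halve the determinant, since [(1 - 1/m) ^ m (1 + 1/m) ^ m <= 1]
    and the second factor is at least 2. The determinants of the balls of radii [rho] and [r] differ
    by at most [2 ^ (2 d K)], so [2 d K + 1] halvings are one too many. *)
Lemma cut_decay (R : realType) d K t (rho r : R) : 0 < r -> 0 <= rho -> rho <= 2 ^+ K * r ->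
  (r ^+ 2) ^+ d <= (1 - cut_width R d / 4) ^+ t * (rho ^+ 2) ^+ d ->
  (t < 64 * d.+1 * (2 * (d * K)).+1)%N.
Proof.
move=> r0 rho0 hK; apply: contraTltn => ht; rewrite -ltNge.
have m0 : (0 < 64 * d.+1)%N by rewrite muln_gt0.
have xE : cut_width R d / 4 = (64 * d.+1)%:R^-1.
  rewrite /cut_width natrM; have : d.+1%:R != 0 :> R by rewrite pnatr_eq0.
  by move: (d.+1%:R : R) => n n0; field.
rewrite {}xE; move: (64 * d.+1)%N m0 ht => m m0 ht.
have mR : 0 < m%:R :> R by rewrite ltr0n.
set x : R := m%:R^-1.
have x0 : 0 < x by rewrite invr_gt0.
have x1 : x <= 1 by rewrite invf_le1 // ler1n.
have half : (1 - x) ^+ m <= 2^-1.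
  have h1 : 2 <= (1 + x) ^+ m.
    have bern n : 1 + n%:R * x <= (1 + x) ^+ n.
      elim: n => [|n IH]; first by rewrite mul0r addr0 expr0.
      have x2 : 0 <= 1 + x by lra.
      rewrite exprS -natr1; apply: le_trans _ (ler_wpM2l x2 IH).
      have : 0 <= n%:R * x * x by rewrite !mulr_ge0 // ltW.
      lra.
    by have := bern m; rewrite /x divff ?gt_eqF.
  have h2 : (1 - x) ^+ m * (1 + x) ^+ m <= 1.
    by rewrite -exprMn; apply: exprn_ile1; nra.
  have h3 : 0 <= (1 - x) ^+ m by rewrite exprn_ge0 // subr_ge0.
  have := ler_wpM2l h3 h1; lra.
have x2 : 0 <= 1 - x by rewrite subr_ge0.
have hp : (1 - x) ^+ t <= 2^-1 ^+ (2 * (d * K)).+1.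
  apply: le_trans (_ : (1 - x) ^+ (m * (2 * (d * K)).+1) <= _).
    by apply: ler_wiXn2l => //; lra.
  by rewrite exprM; apply: lerXn2r; rewrite ?nnegrE ?exprn_ge0 // invr_ge0.
have hrho : (rho ^+ 2) ^+ d <= 2 ^+ (2 * (d * K)) * (r ^+ 2) ^+ d.
  rewrite -!exprM; have -> : (2 * (d * K) = K * (2 * d))%N by lia.
  rewrite (exprM 2 K) -exprMn; apply: lerXn2r; rewrite ?nnegrE ?mulr_ge0 ?exprn_ge0 //.
  exact: ltW.
have rd : 0 < (r ^+ 2) ^+ d by rewrite !exprn_gt0.
apply: le_lt_trans (_ : 2^-1 ^+ (2 * (d * K)).+1 * (2 ^+ (2 * (d * K)) * (r ^+ 2) ^+ d) < _).
  by apply: ler_pM; rewrite ?exprn_ge0 // ?sqr_ge0.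
rewrite exprS -mulrA mulrA [2^-1 * _ * _]mulrA -(mulrA 2^-1) -exprMn mulVf // expr1n mulr1.
by rewrite gtr_pMl // invf_lt1 // ltr1n.
Qed.

Lemma dot_delta (R : realType) d (x : 'rV[R]_d) i : dot x (delta_mx 0 i) = x 0 i.
Proof.
rewrite /dot (bigD1 i) //= big1 ?addr0 => [|j ji]; first by rewrite mxE !eqxx mulr1.
by rewrite mxE eqxx (negbTE ji) mulr0.
Qed.

(** * The invariant of the search and the accuracy of the accepted point *)

Section Search.
Variables (R : realType) (k cO d : nat) (X : set 'rV[R]_d) (f : 'rV[R]_d -> R) (O : oracles d).
Variables (lam eps L B : rat) (xs : 'rV[R]_d).
Hypothesis cX : convex_set X.
Hypothesis ballX : eball 1 `<=` X.
Hypothesis Xball : X `<=` eball ((dom_radius k d)%:~R : R).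
Hypothesis sepX : separation_oracle X cO O.
Hypothesis gradO : gradient_oracle X f cO O.
Hypotheses (lam0 : 0 < lam) (eps0 : 0 < eps) (B0 : 0 < B).
Hypothesis xs_min : minimizer X f xs.
Hypothesis xs_quasar : forall x', X x' ->
  f xs >= f x' + (ratr lam)^-1 * dot (gradient f x') (xs - x').
Hypothesis gradB : forall x, X x -> enorm (gradient f x) <= ratr B.

Let rho : R := (dom_radius k d)%:~R.
Let q : R := (inv_margin k d lam eps B)%:~R.
Let r : R := q^-1.
(* A ball inside the domain and close to the minimizer, which no cut removes. *)
Let c0 : 'rV[R]_d := (1 - r) *: xs.
Let N : R := d.+1%:R.
Let kap := cut_width R d.
Let tol : R := ratr lam * ratr eps.

Let le0 : 0 < tol. Proof. by rewrite mulr_gt0 ?ltr0q. Qed.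
Let rho1 : 1 <= rho.
Proof. by rewrite /rho ler1z dom_radius_ge1. Qed.
Let q1 : 256 <= q.
Proof. by have := inv_margin_ge1 k d lam0 eps0 B0; rewrite /q -(ler_int R) rmorph_nat. Qed.
Let r0 : 0 < r. Proof. by rewrite invr_gt0; have := q1; lra. Qed.
Let r1 : r <= 1 / 256.
Proof. by rewrite /r -div1r ler_pdivrMr; have := q1; lra. Qed.
Let N0 : 0 < N. Proof. by rewrite ltr0n. Qed.

(** Within the ball the linear form of a gradient exceeds its value at the minimizer by at most the
    left side; the right side is the slack of a cut when the width is [tol / 2]. Replacing [B] by
    its upper bound [condition * tol] gives equality, which explains [256 = 2 * 4 * 2 * 16] in
    [inv_margin]. *)
Let margin : 2 * ratr B * r * rho <= kap / 4 * (tol / 2).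
Proof.
have h : ratr B <= (condition lam eps B)%:~R * tol :> R.
  by have /andP[] := @condition_bounds R _ _ B lam0 eps0; rewrite ler_pdivrMr.
have c1 : 0 < (condition lam eps B)%:~R :> R.
  by rewrite ltr0z (lt_le_trans _ (condition_ge1 lam0 eps0 B0)).
have qE : q = 256 * N * (rho * (condition lam eps B)%:~R).
  by rewrite /q /inv_margin 3!intrM rmorph_nat.
have rho0 : 0 < rho by have := rho1; lra.
have -> : kap / 4 * (tol / 2) = 2 * ((condition lam eps B)%:~R * tol) * r * rho.
  rewrite /kap /cut_width /r qE; move: N0; rewrite /N; move: (d.+1%:R : R) => n n0.
  by field; rewrite ?gt_eqF.
by rewrite !ler_pM2r // ler_pM2l.
Qed.

Let gradX x : X (rvec R x) -> rvec R (grad O x) = gradient f (rvec R x).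
Proof. by case/gradO. Qed.

Let xsX : X xs. Proof. by case: xs_min. Qed.

(** The ball is the image of the unit ball under the contraction by [r] towards [xs], so convexity
    keeps it inside the domain. *)
Lemma ball_sub z : enorm (z - c0) <= r -> X z.
Proof.
move=> hz.
have -> : z = r *: (r^-1 *: (z - c0)) + (1 - r) *: xs.
  by rewrite scalerA divff ?gt_eqF // scale1r subrK.
apply: convex_setP => //; [exact: ltW|by have := r1; lra|].
apply: ballX; rewrite /eball /= enormZ ger0_norm; last by rewrite invr_ge0 ltW.
by rewrite mulrC ler_pdivrMr // mul1r.
Qed.

(** The centre [c0] differs from [xs] by [r *: xs], of norm at most [r * rho], and the radius [r] is
    at most [r * rho] too. *)
Lemma ball_near z : enorm (z - c0) <= r -> enorm (z - xs) <= 2 * r * rho.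
Proof.
move=> hz.
have -> : z - xs = (z - c0) + (- r) *: xs.
  by rewrite /c0 scalerBl scale1r scaleNr opprB addrA -addrA [_ - xs]addrC addrA; apply/rowP => i; rewrite !mxE; ring.
apply: le_trans (enormD _ _) _; rewrite enormZ normrN (ger0_norm (ltW r0)).
have h1 : enorm xs <= rho := Xball xsX.
have := ler_wpM2l (ltW r0) h1; have := ler_wpM2l (ltW r0) rho1; lra.
Qed.

(** [t] counts the cuts. [inv_ball] and [inv_det] together limit their number. [inv_up] serves the
    bit lengths: the form at most doubles in a cut, which costs one bit. *)
Record search_inv (t : nat) (x : state d) : Prop := Invariant {
  inv_grid : grid x = init_scale k d lam eps B;
  inv_tol : tol_num x = (numq lam * numq eps) ^+ 2 /\
            tol_den x = (2 * (denq lam * denq eps)) ^+ 2;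
  inv_sym : forall i j, quad x i j = quad x j i;
  inv_ball : forall z, enorm (z - c0) <= r ->
    in_ellipsoid (rshape R `|grid x| (quad x)) (rcenter R `|grid x| (centre x)) z;
  inv_det : \det (rshape R `|grid x| (quad x)) <= (1 - kap / 4) ^+ t * (rho ^+ 2) ^+ d;
  inv_up : forall y, qf (rshape R `|grid x| (quad x)) y <= 2 ^+ t * rho ^+ 2 * dot y y
}.

Lemma invariant0 : search_inv 0 (init_state k d (lam, eps, L, B)).
Proof.
have [s sE hs] := init_scale_ge k d lam0 eps0 B0.
have s0 : s%:R != 0 :> R by rewrite pnatr_eq0 -lt0n (leq_trans _ hs) // addn1.
have eS : rshape R s (fun i j : 'I_d =>
    if i == j then init_scale k d lam eps B * dom_radius k d ^+ 2 else 0) = (rho ^+ 2)%:M.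
  apply/matrixP => i j; rewrite !mxE sE.
  case: eqP => _ /=; last by rewrite mul0r.
  by rewrite mulr1n rmorphM rmorphXn /= -[(s%:Z)%:~R]/(s%:R) mulrC mulKf.
have qE y : qf (rho ^+ 2)%:M y = rho ^+ 2 * dot y y by rewrite /qf mul_mx_scalar dotZl.
split => //=.
- by move=> i j; rewrite eq_sym.
- move=> z hz y; rewrite sE /= -sE eS qE.
  have -> : z - rcenter R s (fun=> 0) = z.
    by apply/rowP => i; rewrite !mxE mul0r subr0.
  apply: le_trans (dot_cauchy _ _) _; rewrite mulrC ler_wpM2r ?dot_ge0 //.
  by rewrite -enorm_le_sqr ?(le_trans ler01) //; apply: Xball; exact: ball_sub.
- by rewrite sE /= -sE eS det_scalar expr0 mul1r.
- by move=> y; rewrite sE /= -sE eS qE expr0 mul1r.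
Qed.

Lemma invariant_psd t x y : search_inv t x ->
  r ^+ 2 * dot y y <= qf (rshape R `|grid x| (quad x)) y.
Proof. by move=> h; apply: in_ellipsoid_ball (ltW r0) (inv_ball h) y. Qed.

(* A cut keeps the invariant as soon as it keeps the ball up to a small depth. *)
Lemma invariant_next t x c : search_inv t x ->
  let g := rdir R (direction c) in
  g != 0 ->
  (forall z, enorm (z - c0) <= r ->
     dot g (z - rcenter R `|grid x| (centre x)) <=
       kap / 4 * Num.sqrt (qf (rshape R `|grid x| (quad x)) g)) ->
  search_inv t.+1 (next_state (x, c)).
Proof.
move=> h g g0 hcut.
have [s sE hs] := init_scale_ge k d lam0 eps0 B0.
have gE := inv_grid h.
have sgE : `|grid x|%N = s by rewrite gE sE.
have := inv_sym h => hsym.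
have gx : grid x = s by rewrite gE sE.
have s0 : (0 < s)%N by rewrite (leq_trans _ hs) // addn1.
have hP y := invariant_psd y h.
have c_gt0 : 0 < curv (quad x) (direction c).
  have := hP g; rewrite sgE /g qf_rdir // => hq.
  have : 0 < (curv (quad x) (direction c))%:~R / s%:R :> R.
    by apply: lt_le_trans hq; rewrite mulr_gt0 ?exprn_gt0 ?dot_gt0.
  by rewrite pmulr_lgt0 ?invr_gt0 ?ltr0n // ltr0z.
rewrite sgE in hP hcut.
(* An equality, as [init_scale] is [(16 N) ^ 3 * q ^ 2] and [r = 1 / q]. *)
have hsr : (16 * N) ^+ 3 <= s%:R * r ^+ 2.
  have -> : s%:R = (init_scale k d lam eps B)%:~R :> R by rewrite sE.
  rewrite /init_scale rmorphM !rmorphXn rmorphM /= -/q exprVn mulfK // expf_neq0 // gt_eqF //.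
  by have := q1; lra.
have [hup hdet] := @det_new R d s (quad x) (direction c) r s0 r0 hsr hsym c_gt0 hP.
have k0 := kap_gt0 R d; have k1 := kap_le R d.
split => /=.
- by rewrite gE.
- exact: inv_tol h.
- exact: new_shape_sym.
- move=> z hz; rewrite gx /=; apply: in_ellipsoid_new => //.
    by have := inv_ball h hz; rewrite sgE.
  exact: hcut.
- rewrite gx /= exprS -mulrA; apply: le_trans hdet _.
  apply: ler_wpM2l; first lra.
  by have := inv_det h; rewrite sgE.
- move=> y; rewrite gx /=; apply: le_trans (hup y) _.
  by have := inv_up h y; rewrite sgE (exprS 2 t); lra.
Qed.

Lemma invariant_rvec t x : search_inv t x ->
  rvec R (query x) = rcenter R `|grid x| (centre x).
Proof.
move=> h; have [s sE _] := init_scale_ge k d lam0 eps0 B0.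
by have gx : grid x = s by [rewrite (inv_grid h)]; rewrite gx (rvec_query _ gx).
Qed.

Lemma gradient_ball a z : X a -> enorm (z - c0) <= r ->
  dot (gradient f a) (z - a) <= ratr B * (2 * r * rho).
Proof.
move=> aX hz.
have -> : z - a = (xs - a) + (z - xs) by rewrite [RHS]addrC addrA subrK.
have lamR : 0 < ratr lam :> R by rewrite ltr0q.
have h1 : dot (gradient f a) (xs - a) <= 0.
  have := xs_quasar aX; have [_ /(_ _ aX)] := xs_min.
  have il : 0 < (ratr lam)^-1 :> R by rewrite invr_gt0.
  move=> h1 h2; rewrite leNgt; apply/negP => h3.
  by have := mulr_gt0 il h3; lra.
have h2 : dot (gradient f a) (z - xs) <= ratr B * (2 * r * rho).
  apply: le_trans (dot_le_enorm _ _) _.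
  by apply: ler_pM; [exact: enorm_ge0|exact: enorm_ge0|exact: gradB|exact: ball_near].
by rewrite dotDr; lra.
Qed.

(** [gap] is the difference of the two sides times the positive number
    [s D ^ 2 (2 denq lam denq eps) ^ 2]. *)
Lemma gap_sign t x : search_inv t x -> let y := (x, fractions (grad O (query x))) in
  (0 < gap y) = ((tol / 2) ^+ 2 <
    qf (rshape R `|grid x| (quad x)) (rvec R (grad O (query x)))).
Proof.
move=> h y.
have [s sE hs] := init_scale_ge k d lam0 eps0 B0.
have gx : grid x = s by rewrite (inv_grid h).
have s0 : (0 < s)%N by rewrite (leq_trans _ hs) // addn1.
have [tn td] := inv_tol h.
set P := rshape _ _ _; set g := rvec _ _.
set D := common_den (fractions (grad O (query x))).
have D0 : 0 < D%:~R :> R by rewrite ltr0z common_den_gt0.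
have sR : 0 < s%:R :> R by rewrite ltr0n.
have qE : (curv (quad x) (direction y.2))%:~R = s%:R * (D%:~R ^+ 2 * qf P g) :> R.
  have := qf_rdir R s (direction y.2) (inv_sym h); rewrite direction_fractions qfZ -/D -/g.
  by rewrite /P gx /= => ->; rewrite mulrC divfK // gt_eqF.
have nl : 0 < (numq lam)%:~R :> R by rewrite ltr0z numq_gt0.
have ne : 0 < (numq eps)%:~R :> R by rewrite ltr0z numq_gt0.
have dl : 0 < (denq lam)%:~R :> R by rewrite ltr0z denq_gt0.
have de : 0 < (denq eps)%:~R :> R by rewrite ltr0z denq_gt0.
have leE : tol / 2 = (numq lam)%:~R * (numq eps)%:~R / (2 * ((denq lam)%:~R * (denq eps)%:~R)).
  by rewrite /tol /ratr; field; rewrite ?gt_eqF.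
have tnE : (tol_num x)%:~R = ((numq lam)%:~R * (numq eps)%:~R) ^+ 2 :> R.
  by rewrite tn rmorphXn /= intrM.
have tdE : (tol_den x)%:~R = (2 * ((denq lam)%:~R * (denq eps)%:~R)) ^+ 2 :> R.
  by rewrite td rmorphXn /= 2!intrM.
rewrite -(ltr0z R) /gap -/D gx intrD mulrNz 4!intrM qE tnE tdE -[(s%:Z)%:~R]/(s%:R).
rewrite leE; move: (qf P g) D0 => u; move: (D%:~R) => D' D0.
move: nl ne dl de; move: ((numq lam)%:~R) ((numq eps)%:~R) ((denq lam)%:~R) ((denq eps)%:~R) => a b c e a0 b0 cc0 e0.
have -> : s%:R * (D' ^+ 2 * u) * (2 * (c * e)) ^+ 2 - s%:R * (D' * D') * (a * b) ^+ 2 =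
   s%:R * D' ^+ 2 * (2 * (c * e)) ^+ 2 * (u - (a * b / (2 * (c * e))) ^+ 2).
  by field; rewrite ?gt_eqF.
by rewrite pmulr_rgt0 ?subr_gt0 // !mulr_gt0 ?exprn_gt0 ?mulr_gt0.
Qed.

Lemma invariant_iterate t x : search_inv t x -> (iterate O x).1 = 1 ->
  search_inv t.+1 (iterate O x).2.
Proof.
move=> h; rewrite /iterate.
have aE := invariant_rvec h.
have [_] := sepX (query x); case: (sep O (query x)) => [c [c1 cX']|aX] /=.
  move=> _; apply: invariant_next h _ _; rewrite direction_fractions.
    rewrite scaler_eq0 negb_or rvec_eq0 intr_eq0 gt_eqF ?common_den_gt0 //=.
    by apply/negP => /eqP c0'; move: c1; rewrite c0' normr0 => /eqP; rewrite eq_sym oner_eq0.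
  move=> z hz; rewrite -aE dotZl.
  apply: le_trans (_ : 0 <= _); last first.
    by rewrite mulr_ge0 ?sqrtr_ge0 // divr_ge0 // ltW // kap_gt0.
  rewrite pmulr_rle0 ?ltr0z ?common_den_gt0 // dotBr subr_le0 ltW //.
  by apply: cX'; exact: ball_sub.
have gE := gap_sign h; rewrite /= in gE; rewrite gE.
case: ifP => //= hgap _.
set g := rvec R (grad O (query x)) in hgap.
have D0 : 0 < (common_den (fractions (grad O (query x))))%:~R :> R by rewrite ltr0z common_den_gt0.
set P := rshape _ _ _ in hgap.
have q0 : 0 < qf P g by apply: le_lt_trans hgap; rewrite sqr_ge0.
have g0 : g != 0.
  by apply: contraTneq q0 => ->; rewrite /qf mul0mx -(scale0r (0 : 'rV_d)) dotZl mul0r ltxx.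
apply: invariant_next h _ _; rewrite direction_fractions -/g.
  by rewrite scaler_eq0 negb_or g0 gt_eqF.
move=> z hz; rewrite -aE dotZl qfZ sqrtrM ?sqr_ge0 // sqrtr_sqr (gtr0_norm D0).
rewrite [X in _ <= X]mulrCA ler_pM2l // -/P.
rewrite /g gradX //; apply: le_trans (gradient_ball aX hz) _.
have le2 : 0 <= tol / 2 by rewrite divr_ge0 // ltW.
have -> : ratr B * (2 * r * rho) = 2 * ratr B * r * rho by ring.
(* Since the centre was not accepted, [tol / 2] is below the width along [g]. *)
apply: le_trans margin _; rewrite ler_pM2l ?divr_gt0 ?kap_gt0 // -gradX // -/g.
rewrite -(ler_pXn2r (n := 2)) ?nnegrE ?sqrtr_ge0 //.
by rewrite sqr_sqrtr ?ltW.
Qed.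

(** The ellipsoid is known to contain [c0] but not [xs], so [<g, a - xs>] is split at [c0]: the
    width along [g] accounts for one half of [tol], and [margin] for the other. *)
Lemma iterate_stop t x xmin : search_inv t x -> (iterate O x).1 != 1 ->
  X (rvec R (query x)) /\ (minimizer X f xmin -> f (rvec R (query x)) <= f xmin + ratr eps).
Proof.
move=> h; rewrite /iterate.
have aE := invariant_rvec h.
have [_] := sepX (query x); case: (sep O (query x)) => [c [c1 cX']|aX] /=; first by [].
have gE := gap_sign h; rewrite /= in gE; rewrite gE.
case: ifP => //= /negbT; rewrite -leNgt => hgap _; split=> // -[xminX xmin_min].
rewrite gradX // in hgap.
set a := rvec R (query x) in aX hgap *.
set g := gradient f a in hgap *.
have lamR : 0 < ratr lam :> R by rewrite ltr0q.
have z0 : enorm (c0 - c0) <= r.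
  by rewrite subrr -(scale0r (0 : 'rV_d)) enormZ normr0 mul0r ltW.
have h1 : dot g (a - c0) <= tol / 2.
  have le2 : 0 <= tol / 2 by rewrite divr_ge0 // ltW.
  rewrite leNgt; apply/negP => h2.
  have := inv_ball h z0 g; rewrite -aE -/a.
  have -> : c0 - a = - (a - c0) by rewrite opprB.
  rewrite dotNr sqrrN => h3.
  have : (tol / 2) ^+ 2 < dot g (a - c0) ^+ 2 by rewrite ltr_pXn2r // nnegrE // ltW // (le_lt_trans le2).
  by rewrite ltNge (le_trans h3).
have h2 : dot g (c0 - xs) <= tol / 2.
  apply: le_trans (dot_le_enorm _ _) _.
  apply: le_trans (_ : ratr B * (2 * r * rho) <= _).
    by apply: ler_pM; [exact: enorm_ge0|exact: enorm_ge0|exact: gradB|exact: ball_near].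
  have -> : ratr B * (2 * r * rho) = 2 * ratr B * r * rho by ring.
  apply: le_trans margin _; rewrite ger_pMl ?divr_gt0 //.
  by have := kap_le R d; rewrite -/kap; lra.
have h3 : dot g (a - xs) <= tol.
  have -> : a - xs = (a - c0) + (c0 - xs) by rewrite addrA subrK.
  by rewrite dotDr; lra.
have fx : f xs <= f xmin by have [_] := xs_min; apply.
have := xs_quasar aX; rewrite -/g -opprB dotNr mulrN => h4.
have h5 : (ratr lam)^-1 * dot g (a - xs) <= ratr eps.
  by rewrite mulrC ler_pdivrMr // mulrC.
lra.
Qed.
Lemma invariant_lt t x K : search_inv t x -> rho * q <= 2 ^+ K ->
  (t < 64 * d.+1 * (2 * (d * K)).+1)%N.
Proof.
move=> h hK; apply: (@cut_decay R d K t rho r) => //.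
- by have := rho1; lra.
- by rewrite -ler_pdivrMr // /r invrK.
- apply: le_trans (inv_det h); apply: det_ball_ge => //; first exact: rshape_sym (inv_sym h).
  by move=> y; exact: invariant_psd h.
Qed.

(** By Cauchy-Schwarz for the form, the entries of the matrix are bounded by its diagonal, hence by
    [inv_up]. The centre is close to [c0], which lies in the bounded domain. *)
Lemma invariant_absz t x K : search_inv t x -> (grid x)%:~R * rho ^+ 2 <= 2 ^+ K :> R ->
  (forall i j, (`|quad x i j| <= 2 ^ (K + t))%N) /\
  (forall i, (`|centre x i| <= 2 ^ (K + t).+1)%N).
Proof.
move=> h hK.
have [s sE hs] := init_scale_ge k d lam0 eps0 B0.
have gx : grid x = s by rewrite (inv_grid h).
have s0 : (0 < s)%N by rewrite (leq_trans _ hs) // addn1.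
have sR : 0 < s%:R :> R by rewrite ltr0n.
set P := rshape R s (quad x).
have hup y : qf P y <= 2 ^+ t * rho ^+ 2 * dot y y by have := inv_up h y; rewrite gx.
have hP y : 0 <= qf P y.
  have := invariant_psd y h; rewrite gx /=; apply: le_trans.
  by rewrite mulr_ge0 ?sqr_ge0 ?dot_ge0.
have sP : P^T = P by apply: rshape_sym (inv_sym h).
set U := 2 ^+ t * rho ^+ 2 in hup.
have U1 : 1 <= U.
  by rewrite /U -[1]mulr1 ler_pM ?exprn_ege1 //; lra.
have dd i : dot (delta_mx 0 i) (delta_mx 0 i) = 1 :> R.
  by rewrite dot_delta mxE !eqxx.
have sU : s%:R * U <= 2 ^+ (K + t) :> R.
  have := ler_wpM2l (_ : 0 <= 2 ^+ t) hK => /(_ _); rewrite gx exprn_ge0 // => /(_ isT).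
  by rewrite -exprD [(t + K)%N]addnC /U mulrCA.
have toN (z : int) n : `|z%:~R : R| <= 2 ^+ n -> (`|z| <= 2 ^ n)%N.
  by rewrite -intr_norm -natrX -(ler_nat R) -abszE natr_absz => h1; rewrite -natr_absz.
split=> [i j|i]; apply: toN.
- have := qf_cauchy (delta_mx 0 i) (delta_mx 0 j) sP hP.
  rewrite dot_delta -rowE !mxE => h1.
  have hi := hup (delta_mx 0 i); have hj := hup (delta_mx 0 j).
  rewrite dd mulr1 in hi; rewrite dd mulr1 in hj.
  have h2 : `|(quad x i j)%:~R / s%:R| <= U :> R.
    rewrite -(ler_pXn2r (n := 2)) ?nnegrE ?normr_ge0 // ?(le_trans ler01 U1) //.
    rewrite real_normK ?num_real //; apply: le_trans h1 _.
    by rewrite expr2; apply: ler_pM.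
  rewrite normrM normfV (gtr0_norm sR) ler_pdivrMr // in h2.
  by apply: le_trans h2 _; rewrite mulrC.
- have z0 : enorm (c0 - c0) <= r.
    by rewrite subrr -(scale0r (0 : 'rV_d)) enormZ normr0 mul0r ltW.
  have := inv_ball h z0 (delta_mx 0 i); rewrite gx /= -/P.
  rewrite dotC dot_delta => h1.
  have hi := hup (delta_mx 0 i); rewrite dd mulr1 in hi.
  have h2 : `|(c0 - rcenter R s (centre x)) 0 i| <= U.
    rewrite -(ler_pXn2r (n := 2)) ?nnegrE ?normr_ge0 // ?(le_trans ler01 U1) //.
    rewrite real_normK ?num_real //; apply: le_trans h1 _; apply: le_trans hi _.
    by rewrite ler_eXnr.
  have h3 : `|c0 0 i| <= U.
    have c0X : X c0 by apply: ball_sub.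
    apply: le_trans (_ : rho <= _); last first.
      rewrite /U; apply: le_trans (_ : rho ^+ 2 <= _); first by rewrite ler_eXnr.
      by rewrite ler_peMl ?sqr_ge0 // exprn_ege1 //; lra.
    have := Xball c0X; rewrite /eball /=; apply: le_trans.
    rewrite -(ler_pXn2r (n := 2)) ?nnegrE ?normr_ge0 ?enorm_ge0 //.
    rewrite real_normK ?num_real // enorm_sqr -dot_delta.
    by apply: le_trans (dot_cauchy _ _) _; rewrite dd mulr1.
  have h4 : `|(centre x i)%:~R / s%:R| <= 2 * U :> R.
    have -> : (centre x i)%:~R / s%:R = c0 0 i - (c0 - rcenter R s (centre x)) 0 i.
      by rewrite !mxE; ring.
    apply: le_trans (ler_normB _ _) _; lra.
  rewrite normrM normfV (gtr0_norm sR) ler_pdivrMr // in h4.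
  by apply: le_trans h4 _; rewrite -mulrA exprS ler_pM2l // mulrC.
Qed.
End Search.

(** * Complexity *)

Lemma iterate_stop_eq d (O : oracles d) x : (iterate O x).1 != 1 -> iterate O x = (0, x).
Proof. by rewrite /iterate; case: (sep O _) => [c|] //=; case: ifP. Qed.

(** [Inv t x] forces [t < T], so the proof is by induction on [T - t]. As in [computes_fold], the
    size of the states needs its own bound [S]. Acceptance leaves the state unchanged, so the final
    state still satisfies [Inv]. *)
Lemma loop_runs : exists C, forall d (O : oracles d) (Inv : nat -> state d -> Prop) T n S,
  (d.+2 <= n)%N ->
  (forall t x, Inv t x -> (t < T)%N) ->
  (forall t x, Inv t x -> iterate_ok O (O, x) n) ->
  (forall t x, Inv t x -> (data_size (dstate x) <= S)%N) ->
  (forall t x, Inv t x -> (iterate O x).1 = 1 -> Inv t.+1 (iterate O x).2) ->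
  forall x0, Inv 0%N x0 -> exists t y, [/\ Inv t y, (iterate O y).1 != 1 &
    Runs O (While Fst (Snd ;; IterateP) ;; Snd ;; QueryP)
      (Pair (Int 1) (dstate x0)) (dquery y) (n ^ C * T.+1 * S)].
Proof.
have [C0 h0] := eval_linear_prop Fst.
have [C1 h1] := eval_linear_prop Snd.
have [C2 h2] := computes_iterate.
have [C3 h3] := @computes_query run_type iterate_ok (fun d x => x.2).
exists (8 * C0 + 8 * C1 + 13 + (C2 + C3))%N => d O Inv T n S hn hT hok hS hstep x0 hx0.
pose U := ((8 * C0 + 4 * C1 + 12) * (n ^ C2 * S))%N.
have n2 : (0 < n ^ C2)%N by rewrite expn_gt0; lia.
have base t x : Inv t x -> (iterate O x).1 = 1 \/ iterate O x = (0, x).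
  by move=> hx; have [->|/iterate_stop_eq ->] := eqVneq (iterate O x).1 1; [left|right].
have step t x : Inv t x ->
    [/\ Runs O Fst (Pair (Int 1) (dstate x)) (Int 1) (C0 * (4 * S)),
        Runs O Fst (Pair (Int 0) (dstate x)) (Int 0) (C0 * (4 * S)) &
        Runs O (Snd ;; IterateP) (Pair (Int 1) (dstate x))
           (Pair (Int (iterate O x).1) (dstate (iterate O x).2)) (C1 * (4 * S) + n ^ C2 * S)].
  move=> hx; have hs := hS _ _ hx.
  have S2 : (2 <= S)%N := leq_trans (data_size_ge2 _) hs.
  have s1 : (data_size (Pair (Int 1) (dstate x)) <= 4 * S)%N.
    by rewrite /= trunc_log1; move: hs; rewrite /dstate /=; lia.
  have s0 : (data_size (Pair (Int 0) (dstate x)) <= 4 * S)%N.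
    by rewrite /= trunc_log0; move: hs; rewrite /dstate /=; lia.
  split; [exact: h0|exact: h0|].
  apply: (Runs_seq (h1 _ _ _ _ _ _ s1)) => //.
  apply: Runs_le (h2 _ O (O, x) n hn (hok _ _ hx)).
  by rewrite leq_mul2l hs orbT.
have key : forall m t x, (m + t)%N = T -> Inv t x -> exists t' y,
    [/\ Inv t' y, (iterate O y).1 != 1 &
      Runs O (While Fst (Snd ;; IterateP)) (Pair (Int 1) (dstate x)) (Pair (Int 0) (dstate y))
        (m * U + U)].
  have hU x t : Inv t x -> (C0 * (4 * S) + (C1 * (4 * S) + n ^ C2 * S) +
      data_size (Pair (Int 1) (dstate x)) + (C0 * (4 * S) + data_size (Pair (Int 0) (dstate x))) <= U)%N.
    move=> hx; have hs := hS _ _ hx.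
    have hy : (S <= n ^ C2 * S)%N by rewrite leq_pmull.
    have S2 : (2 <= S)%N := leq_trans (data_size_ge2 _) hs.
    have -> : U = (C0 * (n ^ C2 * S) * 8 + C1 * (n ^ C2 * S) * 4 + 12 * (n ^ C2 * S))%N.
      by rewrite /U; ring.
    have y0 : (C0 * S <= C0 * (n ^ C2 * S))%N by rewrite leq_mul2l hy orbT.
    have y1 : (C1 * S <= C1 * (n ^ C2 * S))%N by rewrite leq_mul2l hy orbT.
    have -> : (C0 * (4 * S) = C0 * S * 4)%N by ring.
    have -> : (C1 * (4 * S) = C1 * S * 4)%N by ring.
    move: hs; rewrite /= trunc_log1 trunc_log0 /dstate /=; lia.
  elim=> [|m IH] t x hm hx; first by have := hT _ _ hx; lia.
  have [f1 f0 fb] := step _ _ hx.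
  have hUx := hU _ _ hx.
  have [e1|e0] := base _ _ hx.
    have hx' := hstep _ _ hx e1; rewrite e1 in fb.
    have [|t' [y [hy hy' hr]]] := IH t.+1 _ _ hx'; first by lia.
    exists t', y; split => //.
    apply: Runs_le (Runs_while_step f1 _ fb hr) => //.
    rewrite mulSn; lia.
  exists t, x; split => //; first by rewrite e0.
  rewrite e0 in fb.
  have hr := Runs_while_step f1 isT fb (Runs_while_stop (Snd ;; IterateP) f0 (lexx _)).
  by apply: Runs_le hr; apply: leq_trans hUx (leq_addl _ _).
have [t [y [hy hy' hr]]] := key T 0%N x0 (addn0 T) hx0.
exists t, y; split => //.
have hs := hS _ _ hy.
have s0 : (data_size (Pair (Int 0) (dstate y)) <= 4 * S)%N.
  have S2 : (2 <= S)%N := leq_trans (data_size_ge2 _) hs.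
  by rewrite /= trunc_log0; move: hs; rewrite /dstate /=; lia.
have f1 : Runs O Snd (Pair (Int 0) (dstate y)) (dstate y) (C1 * (4 * S)) by apply: h1.
have f2 : Runs O QueryP (dstate y) (dquery y) (n ^ C3 * S).
  apply: Runs_le (h3 _ O (O, y) n hn (hok _ _ hy)).
  by rewrite leq_mul2l hs orbT.
apply: Runs_le (Runs_seq hr (Runs_seq f1 f2)).
have n1 : (1 < n)%N by lia.
have p2 : (n ^ C2 <= n ^ (C2 + C3))%N by apply: leq_pow_pow; lia.
have p3 : (n ^ C3 <= n ^ (C2 + C3))%N by apply: leq_pow_pow; lia.
apply: leq_trans (_ : (8 * C0 + 8 * C1 + 13) * (n ^ (C2 + C3) * (T.+1 * S)) <= _)%N; last first.
  rewrite (expnD n (8 * C0 + 8 * C1 + 13)) -!mulnA leq_mul2r; apply/orP; right.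
  by rewrite ltnW // ltn_expl.
set Y := (n ^ (C2 + C3) * (T.+1 * S))%N.
have -> : (T * U + U = T.+1 * U)%N by rewrite mulSn addnC.
have y1 : (T.+1 * U <= (8 * C0 + 4 * C1 + 12) * Y)%N.
  rewrite /U /Y mulnCA leq_mul2l [X in (X <= _)%N]mulnCA leq_mul2r p2; lia.
have p0 : (0 < n ^ (C2 + C3))%N by rewrite expn_gt0; lia.
have y2 : (S <= Y)%N by rewrite /Y; nia.
have y3 : (n ^ C3 * S <= Y)%N.
  by rewrite /Y; apply: leq_mul => //; rewrite leq_pmull.
have y4 : (C1 * S <= C1 * Y)%N by rewrite leq_mul2l y2 orbT.
have -> : ((8 * C0 + 8 * C1 + 13) * Y = (8 * C0 + 4 * C1 + 12) * Y + C1 * Y * 4 + Y)%N by ring.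
have -> : (C1 * (4 * S) = C1 * S * 4)%N by ring.
lia.
Qed.

Lemma data_size_prod d (F : 'I_d -> int) :
  (data_size (Int (\prod_i F i)) <= 2 + \sum_i data_size (Int (F i)))%N.
Proof.
elim/big_rec2: _ => [|i s z _ IH]; first by rewrite /= trunc_log1.
by apply: leq_trans (data_size_intM _ _) _; lia.
Qed.

Lemma data_size_sum d (F : 'I_d -> int) :
  (data_size (Int (\sum_i F i)%R) <= 2 + \sum_i data_size (Int (F i)))%N.
Proof.
elim/big_rec2: _ => [|i s z _ IH]; first by rewrite /= trunc_log0.
by apply: leq_trans (data_size_intD _ _) _; lia.
Qed.

Lemma sum_nat_le d (F : 'I_d -> nat) m : (forall i, (F i <= m)%N) -> (\sum_i F i <= d * m)%N.
Proof.
move=> h; apply: leq_trans (_ : \sum_(i < d) m <= _)%N; first by apply: leq_sum => i _.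
by rewrite sum_nat_const card_ord.
Qed.

(** Products add bit lengths and sums have [d] terms: [direction] needs at most [w ^ 2] bits, [mulv]
    at most [w ^ 3], and [w ^ 6] covers [curv] times the grid. *)
Lemma cut_ok_bound d (O : oracles d) (x : state d) (c : 'rV[rat]_d) e a :
  (forall i j, (data_size (Int (quad x i j)) <= e)%N) ->
  (data_size (Int (grid x)) <= e)%N -> (data_size (data_of_vec c) <= a)%N ->
  cut_ok O (x, fractions c) ((d + e + a + 3) ^ 6)%N.
Proof.
move=> hM hs; rewrite data_of_vecE => ha.
set w := (d + e + a + 3)%N.
have hf i : (data_size (Int (fractions c i).1) + data_size (Int (fractions c i).2) <= a)%N.
  apply: leq_trans ha; apply: ltnW; apply: leq_trans (data_size_dfun_nth _ i).
  by rewrite /=; lia.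
have hD : (data_size (Int (common_den (fractions c))) <= 2 + d * a)%N.
  apply: leq_trans (data_size_prod _) _; rewrite leq_add2l; apply: sum_nat_le => i.
  by have := hf i; lia.
have hG i : (data_size (Int (direction (fractions c) i)) <= w * w)%N.
  apply: leq_trans (data_size_intM _ _) _.
  have := data_size_int_div (common_den (fractions c)) (fractions c i).2.
  have := hf i; rewrite /w; nia.
have hV i : (data_size (Int (mulv (quad x) (direction (fractions c)) i)) <= w * w * w)%N.
  apply: leq_trans (data_size_sum _) _.
  apply: leq_trans (_ : _ <= 2 + d * (e + w * w))%N _.
    rewrite leq_add2l; apply: sum_nat_le => j.
    by apply: leq_trans (data_size_intM _ _) _; apply: leq_add.
  have : (e <= w)%N by lia.
  have : (d + 3 <= w)%N by lia.
  have : (3 <= w)%N by lia.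
  clearbody w => h3 h4 h5; nia.
rewrite /cut_ok /=; apply: leq_trans (data_size_intM _ _) _.
apply: leq_trans (_ : _ <= 2 + d * (w * w * w + w * w) + e)%N _.
  apply: leq_add => //; apply: leq_trans (data_size_sum _) _.
  rewrite leq_add2l; apply: sum_nat_le => j.
  by apply: leq_trans (data_size_intM _ _) _; apply: leq_add.
have -> : (w ^ 6 = w * w * w * (w * w * w))%N by rewrite !expnS; ring.
have h1 : (e <= w)%N by lia.
have h2 : (d + 3 <= w)%N by lia.
have h3 : (3 <= w)%N by lia.
clearbody w; clear hV hG hD hf.
have hu : (w * w * 3 <= w * w * w)%N by rewrite leq_mul2l h3 orbT.
have hw9 : (w * 9 <= w * w * w)%N by nia.
move: hu hw9; move: (w * w * w)%N => u; move: (w * w)%N => v hu hw9.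
have hd : (d * (u + v) + 3 * (u + v) <= w * (u + v))%N by rewrite -mulnDl leq_mul2r h2 orbT.
have hw : (w * (u + v) <= u * u)%N by nia.
lia.
Qed.

Lemma absz_numq_denq_le (a b : int) : b != 0 ->
  (`|numq (a%:~R / b%:~R)| <= `|a|)%N /\ (`|denq (a%:~R / b%:~R)| <= `|b|)%N.
Proof.
move=> b0.
have [s [ea eb]] : exists s, a = s * numq (fracq (a, b)) /\ b = s * denq (fracq (a, b)).
  by case: (@valq_frac (a, b) b0) => ea eb; eexists; split; [exact: ea|exact: eb].
rewrite fracqE /= in ea eb.
have s0 : s != 0 by apply: contraNneq b0 => s0; rewrite eb s0 mul0r.
by split; [rewrite {2}ea|rewrite {2}eb]; rewrite abszM leq_pmull // absz_gt0.
Qed.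

(** The bounds on the oracles refer to reduced fractions, while the program submits unreduced
    ones. *)
Lemma data_size_query d (x : state d) : 0 < grid x ->
  (data_size (data_of_vec (query x)) <= data_size (dquery x))%N.
Proof.
move=> s0; rewrite data_of_vecE /dquery /dfrac !data_size_dfun leq_add2r.
apply: leq_sum => i _; rewrite /fractions !mxE.
have [h1 h2] := absz_numq_denq_le (centre x i) (lt0r_neq0 s0).
have := leq_data_size_int h1; have := leq_data_size_int h2.
move=> h3 h4; change (data_size (Pair ?u ?v)) with (data_size u + data_size v).+1.
by rewrite !ltnS; apply: leq_add.
Qed.

Lemma data_size_dquery_le d (x : state d) e :
  (forall i, (data_size (Int (centre x i)) <= e)%N) -> (data_size (Int (grid x)) <= e)%N ->
  (data_size (dquery x) <= d * (2 * e + 2) + 2)%N.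
Proof.
move=> hc hg; apply: leq_trans (data_size_dfun_le (m := (2 * e + 1)%N) _) _ => [i|].
  rewrite -[data_size _]/((data_size (Int (centre x i)) + data_size (Int (grid x))).+1).
  by have := leq_add (hc i) hg; lia.
by rewrite leq_add2r leq_mul2l; lia.
Qed.

Lemma data_size_dstate_le d (x : state d) e :
  (forall i, (data_size (Int (centre x i)) <= e)%N) ->
  (forall i j, (data_size (Int (quad x i j)) <= e)%N) ->
  (data_size (dstate x) <= (d * e.+1 + 2) + (d * (d * e.+1 + 3) + 2) + data_size (dconst x) + 2)%N.
Proof.
move=> hc hq.
have h1 : (data_size (dvec (centre x)) <= d * e.+1 + 2)%N by apply: data_size_dfun_le.
have h2 : (data_size (dmat (quad x)) <= d * (d * e.+1 + 3) + 2)%N.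
  apply: leq_trans (data_size_dfun_le (m := (d * e.+1 + 2)%N) _) _ => [i|].
    exact: data_size_dfun_le.
  by rewrite leq_add2r leq_mul2l; lia.
by rewrite /dstate; change (data_size (Pair ?u (Pair ?v ?w))) with
  (data_size u + (data_size v + data_size w).+1).+1; lia.
Qed.

(** The closure properties below replace the computation of an explicit exponent for the running
    time by a syntactic search. *)
Definition polynomial2 (F : nat -> nat -> nat) :=
  exists c, forall a b, (F a b <= (a + b + 2) ^ c)%N.

Lemma polynomial2_const c : polynomial2 (fun _ _ => c).
Proof.
exists c => a b; apply: leq_trans (ltnW (ltn_expl c (ltnSn 1))) _.
by case: c => // c; rewrite leq_exp2r //; lia.
Qed.

Lemma polynomial2_fst : polynomial2 (fun a _ => a).
Proof. by exists 1%N => a b; rewrite expn1; lia. Qed.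

Lemma polynomial2_snd : polynomial2 (fun _ b => b).
Proof. by exists 1%N => a b; rewrite expn1; lia. Qed.

Lemma polynomial2_mul F G : polynomial2 F -> polynomial2 G ->
  polynomial2 (fun a b => F a b * G a b)%N.
Proof. by move=> [c hF] [c' hG]; exists (c + c')%N => a b; rewrite expnD leq_mul. Qed.

Lemma polynomial2_add F G : polynomial2 F -> polynomial2 G ->
  polynomial2 (fun a b => F a b + G a b)%N.
Proof.
move=> [c hF] [c' hG]; exists (c + c').+1 => a b.
have h1 : ((a + b + 2) ^ c <= (a + b + 2) ^ (c + c'))%N by apply: leq_pow_pow; lia.
have h2 : ((a + b + 2) ^ c' <= (a + b + 2) ^ (c + c'))%N by apply: leq_pow_pow; lia.
have := hF a b; have := hG a b; rewrite expnS; nia.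
Qed.

Lemma polynomial2_exp F c : polynomial2 F -> polynomial2 (fun a b => F a b ^ c)%N.
Proof.
move=> [c' hF]; exists (c' * c)%N => a b; rewrite expnM.
by case: c => // c; rewrite leq_exp2r.
Qed.

Lemma polynomial2_succ F : polynomial2 F -> polynomial2 (fun a b => (F a b).+1).
Proof.
move=> hF; have [c h] := polynomial2_add hF (polynomial2_const 1).
by exists c => a b; rewrite -addn1.
Qed.

(** * Bounds on steps, bit lengths and time in terms of [d] and [K] *)

Section Bounds.
Variables (cO ci cl : nat).

Definition steps_bd d K := (64 * d.+1 * (2 * (d * K)).+1)%N.
(** The grid times the squared radius needs [12 + 3 d + 2 K] bits, each cut adds one, and 5 covers
    the overhead of [data_size] and the factor 2 for the centre. *)
Definition bits_bd d K := (12 + 3 * d + 2 * K + steps_bd d K + 5)%N.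
Definition query_bd d K := (d * (2 * bits_bd d K + 2) + 2)%N.
Definition answer_bd d K := (cO * (d + query_bd d K).+1 ^ cO)%N.
Definition poly_bd d K := ((d + bits_bd d K + answer_bd d K + 3) ^ 6 + query_bd d K + answer_bd d K)%N.

Lemma poly_bd_ge d K :
  [/\ ((d + bits_bd d K + answer_bd d K + 3) ^ 6 <= poly_bd d K)%N,
      (query_bd d K <= poly_bd d K)%N, (answer_bd d K <= poly_bd d K)%N
    & (d.+2 <= poly_bd d K)%N].
Proof.
rewrite /poly_bd; split.
- exact: leq_trans (leq_addr _ _) (leq_addr _ _).
- exact: leq_trans (leq_addl _ _) (leq_addr _ _).
- exact: leq_addl.
apply: leq_trans _ (leq_trans (leq_addr _ _) (leq_addr _ _)).
apply: leq_trans (_ : (d + bits_bd d K + answer_bd d K + 3) ^ 1 <= _)%N.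
  by rewrite expn1; lia.
by rewrite leq_pexp2l // addn3.
Qed.

Definition state_bd d K := ((d * (bits_bd d K).+1 + 2) + (d * (d * (bits_bd d K).+1 + 3) + 2) + 2)%N.

(** The time of the initialization reappears inside the loop because it bounds the size of the
    constants kept in the state; this is how [S] enters, linearly. *)
Definition time_bd d K S :=
  (d.+2 ^ ci * ((d + 4) * S) +
   poly_bd d K ^ cl * (steps_bd d K).+1 * (state_bd d K + d.+2 ^ ci * ((d + 4) * S)))%N.

Lemma time_bd_poly : exists c, forall d K S, (0 < S)%N ->
  (time_bd d K S <= (d + K + 2) ^ c * S)%N.
Proof.
have [c hc] : polynomial2 (fun d K => d.+2 ^ ci * (d + 4) +
   poly_bd d K ^ cl * (steps_bd d K).+1 * (state_bd d K + d.+2 ^ ci * (d + 4)))%N.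
  rewrite /poly_bd /state_bd /answer_bd /query_bd /bits_bd /steps_bd.
  by do ?[exact: polynomial2_const | exact: polynomial2_fst | exact: polynomial2_snd
     | apply: polynomial2_add | apply: polynomial2_mul | apply: polynomial2_exp
     | apply: polynomial2_succ].
exists c => d K S S0; apply: leq_trans (leq_mul (hc d K) (leqnn S)).
rewrite /time_bd.
move: (d.+2 ^ ci)%N (poly_bd d K ^ cl * (steps_bd d K).+1)%N (state_bd d K) => x y z.
have -> : ((x * (d + 4) + y * (z + x * (d + 4))) * S =
  x * ((d + 4) * S) + y * (z * S + x * ((d + 4) * S)))%N by ring.
by rewrite leq_add2l leq_mul2l leq_add2r leq_pmulr ?orbT.
Qed.
End Bounds.

Lemma poly_bound_nat (R : realType) C m : poly_bound C (m%:R : R) = (C * m.+1 ^ C)%:R.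
Proof. by rewrite /poly_bound natrM natrX -nat1r. Qed.

Lemma ratr_le_expR_logp (R : realType) (x : rat) : 0 < x -> ratr x <= expR (logp R x).
Proof.
move=> x0; have x0' : 0 < ratr x :> R by rewrite ltr0q.
by rewrite -{1}[ratr x]lnK ?posrE // ler_expR /logp le_max lexx orbT.
Qed.

Lemma logp_ge0 (R : realType) (x : rat) : 0 <= logp R x.
Proof. by rewrite /logp le_max lexx. Qed.

(** [condition] is at most [B / (lam * eps) + 1], whose first term is at most the exponential of the
    sum [l] of two of the logarithms; the constant [ce] passes from base [e] to base 2. *)
Lemma exponent_bound (R : realType) (k : nat) : exists c : nat, forall d (lam eps L B : rat),
  0 < lam -> 0 < eps -> 0 < B ->
  exists K : nat,
    [/\ (dom_radius k d)%:~R * (inv_margin k d lam eps B)%:~R <= 2 ^+ K :> R,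
      (init_scale k d lam eps B)%:~R * (dom_radius k d)%:~R ^+ 2 <= 2 ^+ (12 + 3 * d + 2 * K) :> R &
      (d + K + 2)%:R <= c%:R * (1 + (d%:R + logp R (B / eps) + logp R (1 / lam) + logp R L)) :> R].
Proof.
have [ce hce] : exists ce : nat, expR 1 <= 2 ^+ ce :> R.
  exists (Num.truncn (expR 1 : R)).+1.
  have /andP[_ h] := Num.Theory.truncn_itv (ltW (expR_gt0 (1 : R))).
  apply: le_trans (ltW h) _; rewrite -natrX ler_nat.
  exact: ltnW (ltn_expl _ _).
exists (20 + 4 * k + ce)%N => d lam eps L B lam0 eps0 B0.
have p1 : 0 < B / eps by rewrite divr_gt0.
have p2 : 0 < 1 / lam by rewrite divr_gt0.
move: (ratr_le_expR_logp R p1) (ratr_le_expR_logp R p2).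
move: (logp_ge0 R (B / eps)) (logp_ge0 R (1 / lam)) (logp_ge0 R L).
move: (logp R (B / eps)) (logp R (1 / lam)) (logp R L) => l1 l2 l3 l10 l20 l30 e1 e2.
pose l := l1 + l2.
have l0 : 0 <= l by rewrite addr_ge0.
pose J := (Num.truncn l).+1.
have /andP[J1 J2] := Num.Theory.truncn_itv l0.
have cond_bd : (condition lam eps B)%:~R <= 2 ^+ (ce * J).+1 :> R.
  have /andP[_ h0] := @condition_bounds R _ _ B lam0 eps0; apply: le_trans h0 _.
  have h1 : ratr B / (ratr lam * ratr eps) <= expR l :> R.
    rewrite expRD; have -> : ratr B / (ratr lam * ratr eps) = ratr (B / eps) * ratr (1 / lam) :> R.
      by rewrite !fmorph_div rmorph1 /=; field; rewrite !fmorph_eq0 !gt_eqF.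
    by apply: ler_pM e1 e2; rewrite ler0q ltW.
  have h2 : expR l <= 2 ^+ (ce * J).
    apply: le_trans (_ : expR J%:R <= _); first by rewrite ler_expR ltW.
    rewrite -[J%:R]mulr1 expRM_natl exprM; apply: lerXn2r; rewrite ?nnegrE ?expR_ge0 ?exprn_ge0 //.
  have h3 : 1 <= 2 ^+ (ce * J) :> R by rewrite exprn_ege1 // ler1n.
  by rewrite exprS mulr_natl mulr2n lerD // (le_trans h1).
have dR : d.+1%:R <= 2 ^+ d :> R by rewrite -natrX ler_nat ltn_expl.
have kR : k.+1%:R <= 2 ^+ k :> R by rewrite -natrX ler_nat ltn_expl.
set rho : R := (dom_radius k d)%:~R.
have rhoE : rho = k.+1%:R * d.+1%:R ^+ k by rewrite /rho /dom_radius intrM rmorphXn.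
have rho0 : 0 <= rho by rewrite rhoE mulr_ge0 ?exprn_ge0.
have rho_bd : rho <= 2 ^+ (k + d * k).
  rewrite rhoE exprD exprM; apply: ler_pM; rewrite ?exprn_ge0 //.
  by apply: lerXn2r; rewrite ?nnegrE ?exprn_ge0.
set q : R := (inv_margin k d lam eps B)%:~R.
have qE : q = 256 * d.+1%:R * (rho * (condition lam eps B)%:~R).
  by rewrite /q /inv_margin 3!intrM rmorph_nat.
have cond0 : 0 <= (condition lam eps B)%:~R :> R.
  by rewrite ler0z (le_trans _ (condition_ge1 lam0 eps0 B0)).
have q0 : 0 <= q by rewrite qE !mulr_ge0.
(* The exponents stand for 256, for [d + 1], for the square of the radius and for [condition]. *)
pose K := (8 + d + 2 * (k + d * k) + (ce * J).+1)%N.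
have hK : rho * q <= 2 ^+ K.
  rewrite qE; have -> : rho * (256 * d.+1%:R * (rho * (condition lam eps B)%:~R)) =
    256 * d.+1%:R * rho ^+ 2 * (condition lam eps B)%:~R by ring.
  rewrite /K 3!exprD; apply: ler_pM => //; first by rewrite !mulr_ge0 ?exprn_ge0.
  apply: ler_pM; rewrite ?mulr_ge0 ?exprn_ge0 //.
    by apply: ler_pM => //; rewrite -natrX ler_nat.
  by rewrite mulnC exprM; apply: lerXn2r; rewrite ?nnegrE ?exprn_ge0.
exists K; split => //.
- rewrite /init_scale intrM !rmorphXn /= intrM rmorph_nat -/q -/rho.
  have -> : (16 * d.+1%:R) ^+ 3 * q ^+ 2 * rho ^+ 2 = 2 ^+ 12 * d.+1%:R ^+ 3 * (rho * q) ^+ 2 :> R.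
    by rewrite !exprMn -(natrX _ 16 3) -(natrX _ 2 12); ring.
  rewrite 2!exprD; apply: ler_pM; rewrite ?mulr_ge0 ?exprn_ge0 ?mulr_ge0 //.
    apply: ler_pM; rewrite ?exprn_ge0 // mulnC exprM.
    by apply: lerXn2r; rewrite ?nnegrE ?exprn_ge0.
  rewrite mulnC exprM; apply: lerXn2r; rewrite ?nnegrE ?exprn_ge0 ?mulr_ge0 //.
- have hJ : J%:R <= l + 1 by rewrite /J -natr1 lerD2r.
  rewrite /K; have := ler0n R d; move: hJ; rewrite /l => hJ d0.
  set x := d%:R + l1 + l2 + l3.
  have dx : d%:R <= x by rewrite /x; lra.
  have lx : l1 + l2 <= x by rewrite /x; lra.
  have x0 : 0 <= x by apply: le_trans dx.
  clearbody x.
  rewrite !(natrD, natrM) -[(ce * J).+1%:R]natr1 natrM.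
  have k0 := ler0n R k; have ce0 := ler0n R ce.
  have h1 : ce%:R * J%:R <= ce%:R * (x + 1) :> R by rewrite ler_wpM2l //; lra.
  have h2 : d%:R * k%:R <= x * k%:R by rewrite ler_wpM2r.
  have h3 := mulr_ge0 x0 k0.
  lra.
Qed.

Lemma data_size_input d lam eps L B :
  (data_size (algorithm_input d lam eps L B) <=
     (d + 4) * data_size (data_of_rats [:: lam; eps; L; B]))%N.
Proof.
rewrite /algorithm_input; change (data_size (Pair ?u ?v)) with (data_size u + data_size v).+1.
have h : (data_size (Int d) <= d.+2)%N by rewrite data_size_int absz_nat (ltn_trans (ltnSn d)) // ltn_expl.
have := data_size_ge2 (data_of_rats [:: lam; eps; L; B]).
by move: (data_size (data_of_rats _)) => S; nia.
Qed.

Lemma absz_data_size z m : (`|z| <= 2 ^ m)%N -> (data_size (Int z) <= m.+2)%N.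
Proof.
move=> h; rewrite data_size_int; apply: leq_ltn_trans h _.
by rewrite ltn_exp2l.
Qed.

Theorem corollary1p9 (R : realType) (cR : nat) :
  exists A : prog, forall cO : nat, exists cT : nat,
  forall (d : nat) (X : set 'rV[R]_d) (f : 'rV[R]_d -> R) (O : oracles d)
    (lam eps L B : rat),
    convex_set X -> compact X -> isotropic_position X cR ->
    separation_oracle X cO O ->
    0 < lam -> lam <= 1 -> 0 < eps -> 0 < L -> 0 < B ->
    differentiable_on X f ->
    quasar_convex X (ratr lam) f ->
    gradient_oracle X f cO O ->
    (forall x x', X x -> X x' ->
      enorm (gradient f x - gradient f x') <= ratr L * enorm (x - x')) ->
    (forall x, X x -> enorm (gradient f x) <= ratr B) ->
    exists (out : data) (t : nat) (x : 'rV[rat]_d),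
      [/\ run O A (algorithm_input d lam eps L B) out t,
          represents out x,
          X (rvec R x),
          forall xmin, minimizer X f xmin ->
            f (rvec R x) <= f xmin + ratr eps
        & t%:R <= poly_bound cT
                    (d%:R + logp R (B / eps) + logp R (1 / lam) + logp R L)
                  * (data_size (data_of_rats [:: lam; eps; L; B]))%:R].
Proof.
exists (EllipsoidP cR) => cO.
have [ci init_runs] := computes_init cR.
have [cl loop] := loop_runs.
have [cp time_poly] := time_bd_poly cO ci cl.
have [ck exponent] := exponent_bound R cR.
(* [poly_bound] has a single constant for its coefficient and its degree; the sum dominates both
   [ck ^ cp] and [cp]. *)
exists (ck ^ cp + cp)%N => d X f O lam eps L B cX _ [_ [r [hr ballX Xball]]] hsep lam0 lam1 eps0 _ B0
  _ [xs xs_min xs_quasar] hgrad _ gradB.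
have [K [hK1 hK2 hK3]] := exponent d lam eps L B lam0 eps0 B0.
have XballR : X `<=` eball ((dom_radius cR d)%:~R : R).
  by move=> x /Xball hx; apply: le_trans hx (le_trans hr (dom_radius_bound R cR d)).
pose Inv := search_inv cR lam eps B xs.
set S := data_size (data_of_rats _).
set x0 := init_state cR d (lam, eps, L, B).
have hinit := init_runs d O (lam, eps, L, B) d.+2 (leqnn _) I.
set n := poly_bd cO d K.
set T := steps_bd d K.
set e := bits_bd d K.
have InvT t x : Inv t x -> (t < T)%N.
  by move=> h; exact: (invariant_lt lam0 eps0 B0 h hK1).
have sizes t x : Inv t x ->
    [/\ 0 < grid x, forall i j, (data_size (Int (quad x i j)) <= e)%N,
     forall i, (data_size (Int (centre x i)) <= e)%N & (data_size (Int (grid x)) <= e)%N].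
  move=> h; have tT := InvT _ _ h.
  have gE : grid x = init_scale cR d lam eps B := inv_grid h.
  have [hq hc] := invariant_absz cX ballX XballR lam0 eps0 B0 xs_min h
    (K := 12 + 3 * d + 2 * K) (ltac:(by rewrite gE)).
  have [s sE hs] := init_scale_ge cR d lam0 eps0 B0.
  split.
  - by rewrite gE sE ltz_nat (leq_trans _ hs) // addn1.
  - by move=> i j; apply: leq_trans (absz_data_size (hq i j)) _; rewrite /e /bits_bd -/T; lia.
  - by move=> i; apply: leq_trans (absz_data_size (hc i)) _; rewrite /e /bits_bd -/T; lia.
  - apply: leq_trans (absz_data_size (m := 12 + 3 * d + 2 * K) _) _; last by rewrite /e /bits_bd; lia.
    rewrite gE sE absz_nat -(ler_nat R) natrX; apply: le_trans hK2; rewrite sE.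
    have rho1 : 1 <= (dom_radius cR d)%:~R :> R by rewrite ler1z dom_radius_ge1.
    by rewrite ler_peMr ?exprn_ege1.
have [n6 nq na nd] := poly_bd_ge cO d K.
have nat_bound a m : (a%:R <= poly_bound cO (m%:R : R)) -> (m <= d + query_bd d K)%N ->
    (a <= answer_bd cO d K)%N.
  rewrite poly_bound_nat ler_nat => h hm; apply: leq_trans h _; rewrite leq_mul2l.
  by apply/orP; right; case: (cO) => // c; rewrite leq_exp2r // ltnS.
have Iok t x : Inv t x -> iterate_ok O (O, x) n.
  move=> h; have [g0 hq hc hg] := sizes _ _ h.
  have q1 : (data_size (dquery x) <= query_bd d K)%N by apply: data_size_dquery_le.
  have q2 := leq_trans (data_size_query g0) q1.
  have a1 : (data_size (data_of_answer (sep O (query x))) <= answer_bd cO d K)%N.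
    by have [h1 _] := hsep (query x); apply: nat_bound h1 _; exact: leq_trans q2 (leq_addl _ _).
  have cutn c : (data_size (data_of_vec c) <= answer_bd cO d K)%N -> cut_ok O (x, fractions c) n.
    move=> hcc; have := cut_ok_bound O hq hg hcc; rewrite /cut_ok /= => h1.
    by apply: leq_trans h1 n6.
  split => //.
  - exact: leq_trans q1 nq.
  - exact: leq_trans a1 na.
  move: a1; rewrite [(O, x).2]/=; have [_] := hsep (query x).
  case: (sep O (query x)) => [c _ a1|aX _].
    by apply: cutn; apply: leq_trans a1; rewrite /= -addSn leq_addl.
  have [_ h1 h2] := hgrad _ aX.
  have a2 : (data_size (data_of_vec (grad O (query x))) <= answer_bd cO d K)%N.
    by apply: nat_bound h1 _; exact: leq_trans q2 (leq_addl _ _).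
  have a3 : (grad_time O (query x) <= answer_bd cO d K)%N.
    by apply: nat_bound h2 _; rewrite leq_add2l.
  split; first exact: cutn.
    exact: leq_trans a2 na.
  exact: leq_trans a3 na.
have hin := data_size_input d lam eps L B; rewrite -/S in hin.
have hinit' : Runs O (InitP cR) (algorithm_input d lam eps L B) (Pair (Int 1) (dstate x0))
    (d.+2 ^ ci * ((d + 4) * S)).
  by apply: Runs_le hinit; rewrite leq_mul2l hin orbT.
have Isize t x : Inv t x ->
    (data_size (dstate x) <= state_bd d K + d.+2 ^ ci * ((d + 4) * S))%N.
  move=> h; clear n6; have [_ hq hc _] := sizes _ _ h.
  (* The constants never change, so they are no longer than the output of the initialization, whose
     length is at most its running time. *)
  have ec : dconst x = dconst x0.
    by rewrite /dconst (inv_grid h); have [-> ->] := inv_tol h.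
  have := Runs_size hinit'.
  have h1 : (data_size (dconst x0) <= data_size (Pair (Int 1) (dstate x0)))%N by rewrite /=; lia.
  have := data_size_dstate_le hc hq; rewrite ec /state_bd -/e; lia.
have step t x : Inv t x -> (iterate O x).1 = 1 -> Inv t.+1 (iterate O x).2.
  move=> h1 h2.
  exact: (invariant_iterate cX ballX XballR hsep hgrad lam0 eps0 B0 xs_min xs_quasar gradB h1 h2).
have Inv0 : Inv 0%N x0 := invariant0 L cX ballX XballR lam0 eps0 B0 xs_min.
have [t [y [hy stop hrun]]] := loop d O Inv T n _ nd InvT Iok Isize step x0 Inv0.
have [g0 _ _ _] := sizes _ _ hy.
have [t' run_t ht'] := Runs_seq hinit' hrun.
exists (dquery y), t', (query y); split => //.
- exact: represents_query.
- by have [] := iterate_stop XballR hsep hgrad lam0 eps0 B0 xs_min xs_quasar gradB xs hy stop.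
- move=> xmin hmin.
  by have [_] := iterate_stop XballR hsep hgrad lam0 eps0 B0 xs_min xs_quasar gradB xmin hy stop; apply.
have S0 : (0 < S)%N by exact: (leq_trans _ (data_size_ge2 _)).
set x := _ + logp R L in hK3 *.
have x0' : 0 <= x by rewrite /x !addr_ge0 ?logp_ge0.
have ht2 : (t' <= (d + K + 2) ^ cp * S)%N.
  by apply: leq_trans ht' _; exact: time_poly.
apply: le_trans (_ : ((d + K + 2) ^ cp * S)%:R <= _); first by rewrite ler_nat.
rewrite natrM ler_wpM2r // natrX.
apply: le_trans (_ : (ck%:R * (1 + x)) ^+ cp <= _).
  apply: lerXn2r hK3; rewrite nnegrE ?ler0n //.
  by rewrite mulr_ge0 ?ler0n // addr_ge0.
rewrite exprMn /poly_bound natrD natrX.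
have x1 : 1 <= 1 + x by rewrite lerDl.
apply: ler_pM.
- by rewrite exprn_ge0.
- by rewrite exprn_ge0 // addr_ge0.
- by rewrite lerDl.
- by rewrite ler_weXn2l // leq_addl.
Qed.
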